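(* Let $I$ be an ideal of the polynomial ring $K[x_1,\dots,x_n]$ over a field $K$ generated by a regular sequence $f_1,f_2,f_3$ of homogeneous forms of degree $d$. Then $K[(I^e)_{ed+c}]$ is Koszul for all integers $c \geq \frac{d}{2}$ and $e >0$.
   Context: $K[(I^e)_{ed+c}]$ denotes the $K$-subalgebra of $K[x_1,\dots,x_n]$ generated by the homogeneous forms of degree $ed+c$ in $I^e$ (with generators in degree $1$); equivalently it is the $(c,e)$-diagonal subalgebra $\bigoplus_s \operatorname{Rees}(I)_{(cs,es)}$ of the Rees algebra $\operatorname{Rees}(I)=\bigoplus_j I^jt^j$ bigraded by $\deg x_i=(1,0)$, $\deg f_jt=(0,1)$. A standard graded $K$-algebra $A$ is Koszul if $K=A/A_+$ has a linear free resolution over $A$. *)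

(* Defs.v *)
From HB Require Import structures.
From mathcomp Require Import all_boot all_algebra.
From mathcomp Require Import mpoly.
Set Implicit Arguments. Unset Strict Implicit. Unset Printing Implicit Defensive.
Import GRing.Theory.
Local Open Scope ring_scope.

Section Defs.
Variables (K : fieldType) (n : nat).
Local Notation P := {mpoly K[n]}.

Definition is_form (D : nat) (p : P) : Prop :=
  p \is @ishomog1 n K D (@mdeg n).

Definition in_ideal (k : nat) (f : 'I_k -> P) (p : P) : Prop :=
  exists g : 'I_k -> P, p = \sum_(i < k) g i * f i.

Definition regular_seq (k : nat) (f : 'I_k -> P) : Prop :=
  (forall (i : 'I_k) (g : P),
     in_ideal (fun j : 'I_i => f (widen_ord (ltnW (ltn_ord i)) j)) (g * f i) ->
     in_ideal (fun j : 'I_i => f (widen_ord (ltnW (ltn_ord i)) j)) g)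
  /\ ~ in_ideal f 1.

Definition in_ideal_pow (k : nat) (f : 'I_k -> P) (e : nat) (p : P) : Prop :=
  exists s : seq (P * seq 'I_k),
    (forall x, x \in s -> size x.2 = e) /\
    p = \sum_(x <- s) x.1 * \prod_(i <- x.2) f i.

Definition pow_component (k : nat) (f : 'I_k -> P) (e D : nat) (p : P) : Prop :=
  is_form D p /\ in_ideal_pow f e p.

Definition in_subalg (V : P -> Prop) (p : P) : Prop :=
  exists s : seq (K * seq P),
    (forall x, x \in s -> forall v, v \in x.2 -> V v) /\
    p = \sum_(x <- s) x.1 *: \prod_(v <- x.2) v.

Definition in_irrelevant (V : P -> Prop) (p : P) : Prop :=
  exists s : seq (K * seq P),
    (forall x, x \in s -> (0 < size x.2)%N /\ forall v, v \in x.2 -> V v) /\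
    p = \sum_(x <- s) x.1 *: \prod_(v <- x.2) v.

Definition row_in (V : P -> Prop) (m : nat) (v : 'rV[P]_m) : Prop :=
  forall j, in_subalg V (v 0 j).

(** A = K[V], standard graded with A_1 = V, is Koszul: K = A/A_+ has a
    linear graded free resolution over A
      ... -> A(-3)^(b 2) -> A(-2)^(b 1) -> A(-1)^(b 0) -> A -> K -> 0,
    i.e. all differentials are matrices with entries in A_1 = V
    (elements are row vectors, the maps act by right multiplication). *)
Definition Koszul (V : P -> Prop) : Prop :=
  exists (b : nat -> nat) (d1 : 'M[P]_(b 0%N, 1%N))
         (M : forall i : nat, 'M[P]_(b i.+1, b i)),
    (forall j k, V (d1 j k)) /\
    (forall i j k, V (M i j k)) /\
    M 0%N *m d1 = 0 /\
    (forall i, M i.+1 *m M i = 0) /\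
    (* exactness at A : the image of d1 is the kernel A_+ of A -> K *)
    (forall p, in_irrelevant V p ->
       exists w : 'rV[P]_(b 0%N), row_in V w /\ p = (w *m d1) 0 0) /\
    (forall v : 'rV[P]_(b 0%N), row_in V v -> v *m d1 = 0 ->
       exists w : 'rV[P]_(b 1%N), row_in V w /\ v = w *m M 0%N) /\
    (forall i (v : 'rV[P]_(b i.+1)), row_in V v -> v *m M i = 0 ->
       exists w : 'rV[P]_(b i.+2), row_in V w /\ v = w *m M i.+1).

End Defs.

(* Main.v *)
Require Import Defs.
From mathcomp Require Import all_boot all_order all_algebra.
From mathcomp Require Import mpoly.
From mathcomp Require Import zify ring.
From Stdlib Require Import Classical ClassicalEpsilon.
Set Implicit Arguments. Unset Strict Implicit. Unset Printing Implicit Defensive.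
Import Order.TTheory GRing.Theory Num.Theory.
Local Open Scope ring_scope.

(** Let P = K[x_1, ..., x_n] and S = P[t1, t2, t3], bigraded so that x_i has degree (1, 0)
    and t_j has degree (0, 1).  The Rees algebra is S/(g1, g2, g3), where
    g1 = t1 f2 - t2 f1, g2 = t1 f3 - t3 f1, g3 = t2 f3 - t3 f2 have degree (d, 1), and
    K[(I^e)_(ed+c)] is its (c, e)-diagonal.  Koszulness is carried along the diagonals of
    S/(g1), S/(g1, g2) and S/(g1, g2, g3): the residue field keeps a linear resolution when
    passing to a quotient ring whose kernel has regularity at most 2.
    Over S/(g1) one shows, by induction on the length of the resolution and on a + b, that the
    diagonal of S/(g1) shifted by (a, b), a, b >= 0, has a linear resolution: the x_i (or the
    t_j) form a regular sequence whose ideal m agrees with the unit ideal in these degrees, so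
    that the Koszul complex resolves m/g1 m by such modules.  The next kernel is
    (g1, g2)/(g1) = S/(g1)(-d, -1), the last one is (S/(t1, f1))(-d, -1), because
    (g1, g2) : g3 = (t1, f1); the same induction applies to S/(t1, f1) over S/(g1, g2).  The
    hypothesis d <= 2c (and 1 <= 2e) says that the shift by (d, 1) costs at most two steps of
    the diagonal. *)

(** Two statements feed each other: shifted diagonals gain a resolution step once the residue field
    has [k] steps, and the residue field gains one from the shift (c, e), which is the irrelevant
    ideal. Hence everything concerns initial segments of length [k], with mere upper bounds on
    generator degrees; the infinite linear resolution is extracted at the end by choosing minimal
    generators. The constant 2: over the quotient ring, syzygies are the old ones modulo copies of
    the kernel. Syzygies are allowed one degree more than the generators, and the kernel enters one
    homological step later still. The induction on a + b breaks down at (0, 0), where neither (x)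
    nor (t) agrees with the unit ideal. There S/(g1) is free over itself, but S/(t1, f1) is not free
    over S/(g1, g2): it is reached through multiplication by t1, which links it to the Rees algebra
    and thus to shorter segments for S/(t1, f1) itself. Quotient rings are never formed; modules are
    pairs of subsets, and ideals are relations on the ambient ring. *)

Lemma subr_ACA (V : zmodType) (x y z t : V) : x - y - (z - t) = x - z - (y - t).
Proof. by rewrite [- (z - t)]opprD opprK addrACA [- y + t]addrC -[t - y]opprB. Qed.

(** * Initial segments of graded resolutions *)

Section LinearCombination.
Variables (S : comNzRingType) (L : lmodType S).

Definition comb b (m : 'I_b -> L) (v : 'rV[S]_b) : L := \sum_j v 0 j *: m j.

Lemma comb0 b (m : 'I_b -> L) : comb m 0 = 0.
Proof. by rewrite /comb big1 // => j _; rewrite mxE scale0r. Qed.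

Lemma combD b (m : 'I_b -> L) v w : comb m (v + w) = comb m v + comb m w.
Proof. by rewrite -big_split /=; apply: eq_bigr => j _; rewrite mxE scalerDl. Qed.

Lemma combZ b (m : 'I_b -> L) a v : comb m (a *: v) = a *: comb m v.
Proof. by rewrite /comb scaler_sumr; apply: eq_bigr => j _; rewrite mxE scalerA. Qed.

Lemma combB b (m : 'I_b -> L) v w : comb m (v - w) = comb m v - comb m w.
Proof. by rewrite combD -[- w]scaleN1r combZ scaleN1r. Qed.

Definition cat_fun T b1 b2 (m1 : 'I_b1 -> T) (m2 : 'I_b2 -> T) (j : 'I_(b1 + b2)) : T :=
  match split j with inl i => m1 i | inr i => m2 i end.

Lemma cat_funl T b1 b2 (m1 : 'I_b1 -> T) (m2 : 'I_b2 -> T) i :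
  cat_fun m1 m2 (lshift b2 i) = m1 i.
Proof. by rewrite /cat_fun (unsplitK (inl i)). Qed.

Lemma cat_funr T b1 b2 (m1 : 'I_b1 -> T) (m2 : 'I_b2 -> T) i :
  cat_fun m1 m2 (rshift b1 i) = m2 i.
Proof. by rewrite /cat_fun (unsplitK (inr i)). Qed.

Lemma comb_cat b1 b2 (m1 : 'I_b1 -> L) (m2 : 'I_b2 -> L) v :
  comb (cat_fun m1 m2) v = comb m1 (lsubmx v) + comb m2 (rsubmx v).
Proof.
rewrite /comb big_split_ord /=; congr (_ + _); apply: eq_bigr => j _.
  by rewrite cat_funl mxE.
by rewrite cat_funr mxE.
Qed.

End LinearCombination.

(** A grading is encoded by its relation [C u s x]: "x is homogeneous of degree
    [s - u]".  This makes degree shifts and the passage to a diagonal a mere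
    reindexing, and no subtraction of degrees is ever needed. *)
Section Gradings.
Variables (S : comNzRingType) (G : Type) (C : G -> G -> S -> Prop).

Record grading : Prop := Grading {
  gr0 : forall u s, C u s 0;
  grB : forall u s x y, C u s x -> C u s y -> C u s (x - y);
  gr1 : forall u, C u u 1;
  grM : forall u s w x y, C u s x -> C s w y -> C u w (y * x) }.

Record gideal (J : G -> G -> S -> Prop) : Prop := GIdeal {
  gi_sub : forall u s x, J u s x -> C u s x;
  gi0 : forall u s, J u s 0;
  giB : forall u s x y, J u s x -> J u s y -> J u s (x - y);
  giMl : forall u s w x y, J u s x -> C s w y -> J u w (y * x);
  giMr : forall u s w x y, C u s x -> J s w y -> J u w (y * x) }.

Record gsub (L : lmodType S) (M : G -> L -> Prop) : Prop := GSub {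
  gs0 : forall s, M s 0;
  gsB : forall s x y, M s x -> M s y -> M s (x - y);
  gsZ : forall u s a x, C u s a -> M u x -> M s (a *: x) }.

(** [gmod J M N]: the subquotient [M / N] of [L] is a module over the quotient
    by [J] of the graded ring. *)
Record gmod (J : G -> G -> S -> Prop) (L : lmodType S) (M N : G -> L -> Prop) : Prop :=
  GMod {
  gm_l : gsub M;
  gm_r : gsub N;
  gm_sub : forall s x, N s x -> M s x;
  gm_J : forall u s a x, J u s a -> M u x -> N s (a *: x) }.

(** Degree [s] of the free module with basis degrees [u], of its multiple by [J], and of the first
    syzygy module of [m] modulo [N]. *)
Definition Fm b (u : 'I_b -> G) s (v : 'rV[S]_b) := forall j, C (u j) s (v 0 j).
Definition FJ (J : G -> G -> S -> Prop) b (u : 'I_b -> G) s (v : 'rV[S]_b) :=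
  forall j, J (u j) s (v 0 j).
Definition Ker (L : lmodType S) b u (m : 'I_b -> L) (N : G -> L -> Prop) s v :=
  Fm u s v /\ N s (comb m v).

(** [M / N] has the first [k] steps of a graded free resolution over the quotient
    by [J], the generators of the [i]-th free module having degrees in [D i].  Kernels are
    computed inside row vectors over the ambient ring, modulo [J]. *)
Fixpoint Good (J : G -> G -> S -> Prop) (D : nat -> G -> Prop) (k : nat)
    (L : lmodType S) (M N : G -> L -> Prop) {struct k} : Prop :=
  if k is k'.+1 then
    exists b (u : 'I_b -> G) (m : 'I_b -> L),
      [/\ forall j, D 0%N (u j) /\ M (u j) (m j),
          forall s x, M s x -> exists2 v, Fm u s v & N s (x - comb m v) &
          Good J (fun i => D i.+1) k' (Ker u m N) (FJ J u)]
  else True.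

Lemma GoodS J D k (L : lmodType S) (M N : G -> L -> Prop) :
  Good J D k.+1 M N <->
  exists b (u : 'I_b -> G) (m : 'I_b -> L),
    [/\ forall j, D 0%N (u j) /\ M (u j) (m j),
        forall s x, M s x -> exists2 v, Fm u s v & N s (x - comb m v) &
        Good J (fun i => D i.+1) k (Ker u m N) (FJ J u)].
Proof. by []. Qed.

Hypothesis HC : grading.

Lemma gsN (L : lmodType S) (M : G -> L -> Prop) (HM : gsub M) s x : M s x -> M s (- x).
Proof. by move=> Mx; rewrite -sub0r; apply: gsB => //; apply: gs0. Qed.

Lemma gsD (L : lmodType S) (M : G -> L -> Prop) (HM : gsub M) s x y :
  M s x -> M s y -> M s (x + y).
Proof. by move=> Mx My; rewrite -[y]opprK; apply: gsB => //; apply: gsN. Qed.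

Lemma gs_sum (L : lmodType S) (M : G -> L -> Prop) (HM : gsub M) s
    (I : Type) (r : seq I) (F : I -> L) :
  (forall i, M s (F i)) -> M s (\sum_(i <- r) F i).
Proof. by move=> H; elim/big_ind: _ => //; [apply: gs0 | move=> *; apply: gsD]. Qed.

Lemma gs_comb (L : lmodType S) (M : G -> L -> Prop) (HM : gsub M) b u (m : 'I_b -> L) s v :
  (forall j, M (u j) (m j)) -> Fm u s v -> M s (comb m v).
Proof. by move=> Hm Hv; apply: gs_sum => // j; apply: gsZ (Hm j). Qed.

Lemma gm_combJ J (L : lmodType S) (M N : G -> L -> Prop) (H : gmod J M N) b u (m : 'I_b -> L) s v :
  (forall j, M (u j) (m j)) -> FJ J u s v -> N s (comb m v).
Proof.
move=> Hm Hv; apply: gs_sum; first exact: gm_r H.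
by move=> j; apply: (gm_J H) (Hm j).
Qed.

Lemma grN u s x : C u s x -> C u s (- x).
Proof. by move=> Cx; rewrite -sub0r; apply: grB => //; apply: gr0. Qed.

Lemma grD u s x y : C u s x -> C u s y -> C u s (x + y).
Proof. by move=> Cx Cy; rewrite -[y]opprK; apply: grB => //; apply: grN. Qed.

Lemma Fm_gsub b (u : 'I_b -> G) : gsub (Fm u).
Proof.
split=> [s j|s v w Hv Hw j|t s a v Ha Hv j]; rewrite !mxE.
- exact: gr0.
- by apply: grB.
- exact: grM Ha.
Qed.

Lemma FJ_gsub J (HJ : gideal J) b (u : 'I_b -> G) : gsub (FJ J u).
Proof.
split=> [s j|s v w Hv Hw j|t s a v Ha Hv j]; rewrite !mxE.
- exact: gi0.
- by apply: giB.
- exact: (giMl HJ) Ha.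
Qed.

Lemma FJ_Fm J (HJ : gideal J) b (u : 'I_b -> G) s v : FJ J u s v -> Fm u s v.
Proof. by move=> H j; apply: gi_sub (H j). Qed.

Lemma Fm_mod J (HJ : gideal J) b (u : 'I_b -> G) : gmod J (Fm u) (FJ J u).
Proof.
split; [exact: Fm_gsub | exact: FJ_gsub | move=> s v; exact: FJ_Fm |].
by move=> t s a v Ha Hv j; rewrite mxE; apply: (giMr HJ) Ha.
Qed.

Lemma Ker_gsub (L : lmodType S) (N : G -> L -> Prop) (HN : gsub N) b u (m : 'I_b -> L) :
  gsub (Ker u m N).
Proof.
have HF := Fm_gsub u.
split=> [s|s v w [v1 v2] [w1 w2]|t s a v Ha [v1 v2]].
- by split; [exact: gs0 HF _ | rewrite comb0; exact: gs0 HN _].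
- by split; [exact: gsB HF _ _ _ v1 w1 | rewrite combB; exact: gsB HN _ _ _ v2 w2].
- by split; [exact: gsZ HF _ _ _ _ Ha v1 | rewrite combZ; exact: gsZ HN _ _ _ _ Ha v2].
Qed.

Lemma Ker_mod J (HJ : gideal J) (L : lmodType S) (M N : G -> L -> Prop) b u (m : 'I_b -> L) :
  gmod J M N -> (forall j, M (u j) (m j)) -> gmod J (Ker u m N) (FJ J u).
Proof.
move=> H Hm; split; [exact/Ker_gsub/gm_r/H | exact: FJ_gsub | |].
- by move=> s v Hv; split; [exact: (FJ_Fm HJ Hv) | exact: (gm_combJ H Hm Hv)].
- by move=> t s a v Ha [Hv _] j; rewrite mxE; apply: (giMr HJ) Ha.
Qed.

(** [E] stands for an isomorphism of subquotients; it is a relation because representatives are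
    determined only modulo [N] and [N']. Generators are carried along [E], and the syzygies remain
    the same row vectors. *)
Lemma Good_iso J D k (L L' : lmodType S) (M N : G -> L -> Prop) (M' N' : G -> L' -> Prop)
    (E : G -> L -> L' -> Prop) :
  gsub M -> gsub M' -> (forall s, E s 0 0) ->
  (forall s x y x' y', E s x x' -> E s y y' -> E s (x - y) (x' - y')) ->
  (forall u s a x x', C u s a -> E u x x' -> E s (a *: x) (a *: x')) ->
  (forall s x, M s x -> exists2 x', M' s x' & E s x x') ->
  (forall s x', M' s x' -> exists2 x, M s x & E s x x') ->
  (forall s x x', M s x -> M' s x' -> E s x x' -> N s x <-> N' s x') ->
  Good J D k M N -> Good J D k M' N'.
Proof.
move=> HM HM' E0 EB EZ tot sur EN; case: k => //= k [b [u [m [Hm gen HK]]]].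
have /fin_all_exists[m' Hm'] : forall j, exists x', M' (u j) x' /\ E (u j) (m j) x'.
  by move=> j; have [x' ? ?] := tot _ _ (Hm j).2; exists x'.
have ED s x y x' y' : E s x x' -> E s y y' -> E s (x + y) (x' + y').
  move=> Ex Ey; rewrite -[y]opprK -[y']opprK; apply: (EB) => //.
  by rewrite -[- y]sub0r -[- y']sub0r; apply: (EB).
have Ec s v : Fm u s v -> E s (comb m v) (comb m' v).
  move=> Hv; rewrite /comb; elim/big_ind2: _ => //; first by move=> *; apply: ED.
  by move=> j _; apply: EZ (Hv j) (Hm' j).2.
have Mc s v : Fm u s v -> M s (comb m v).
  by move=> Hv; apply: gs_comb Hv => // j; exact: (Hm j).2.
have Mc' s v : Fm u s v -> M' s (comb m' v).
  by move=> Hv; apply: gs_comb Hv => // j; exact: (Hm' j).1.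
exists b, u, m'; split.
- by move=> j; split; [exact: (Hm j).1 | exact: (Hm' j).1].
- move=> s x' Hx'; have [x Hx Exx'] := sur _ _ Hx'; have [v Hv Nv] := gen _ _ Hx.
  exists v => //; apply/(EN s (x - comb m v)) => //.
  + by apply: gsB => //; apply: Mc.
  + by apply: gsB => //; apply: Mc'.
  + by apply: (EB) => //; apply: Ec.
have KE s v : Ker u m N s v <-> Ker u m' N' s v.
  by split=> -[Hv Nv]; split=> //; move: Nv; apply EN; auto.
(* The two kernels agree only pointwise. Unfolding one more stage is enough, since the stage after
   it mentions [FJ J u] and no longer the kernel. *)
case: k HK => // k.
move=> /=[b2 [u2 [m2 [Hm2 gen2 HK]]]].
exists b2, u2, m2; split.
- by move=> j; have [? /KE] := Hm2 j.
- by move=> s x /KE/gen2.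
- exact: HK.
Qed.

Lemma Good_mono J D D' k k' (L : lmodType S) (M N : G -> L -> Prop) :
  (forall i u, D i u -> D' i u) -> (k' <= k)%N -> Good J D k M N -> Good J D' k' M N.
Proof.
elim: k k' D D' L M N => [|k IH] [|k'] D D' L M N //= DD le [b [u [m [Hm gen HK]]]].
exists b, u, m; split=> //; last by apply: IH HK => // i w; exact: DD.
by move=> j; have [/DD] := Hm j.
Qed.

Lemma Good_zero J D k (L : lmodType S) (M N : G -> L -> Prop) :
  (forall s x, M s x -> N s x) -> Good J D k M N.
Proof.
elim: k D L M N => //= k IH D L M N MN.
exists 0%N, (fun i : 'I_0 => False_rect G (notF (ltn_ord i))).
exists (fun _ => 0); split=> [[]//|s x /MN Nx|].
  by exists 0; [case | rewrite comb0 subr0].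
by apply: IH => s v _ [].
Qed.

(** Second isomorphism theorem, with congruence modulo [N'] as the correspondence. *)
Lemma Good_iso2 J D k (L : lmodType S) (M N M' N' : G -> L -> Prop) :
  gsub M -> gsub M' -> gsub N' ->
  (forall s x, M s x -> M' s x) ->
  (forall s x', M' s x' -> exists2 x, M s x & N' s (x - x')) ->
  (forall s x, M s x -> N s x <-> N' s x) ->
  Good J D k M N <-> Good J D k M' N'.
Proof.
move=> HM HM' HN' MM sur NN.
have ED s (x y x' y' : L) : N' s (x - x') -> N' s (y - y') -> N' s (x - y - (x' - y')).
  by move=> Nx Ny; rewrite subr_ACA; exact: gsB.
have EZ u s a (x x' : L) : C u s a -> N' u (x - x') -> N' s (a *: x - a *: x').
  by move=> Ca Nx; rewrite -scalerBr; apply: gsZ Ca Nx.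
have E0 s : N' s (0 - 0 : L) by rewrite subrr; apply: gs0.
have EN s x x' : M s x -> N' s (x - x') -> N s x <-> N' s x'.
  move=> Mx Nxx'; have [N1 N2] := NN s x Mx; split=> [/N1 H|H].
    by rewrite -[x'](subKr x); apply: gsB.
  by apply: N2; rewrite -[x](subrK x'); apply: gsD.
split.
  apply: (@Good_iso _ _ _ _ _ _ _ _ _ (fun s x x' => N' s (x - x'))) => //.
  - by move=> s x Mx; exists x; [exact: MM | rewrite subrr; exact: gs0].
  - by move=> s x x' Mx _; exact: EN.
apply: (@Good_iso _ _ _ _ _ _ _ _ _ (fun s x' x => N' s (x - x'))) => //.
- by move=> s x y x' y' Ex Ey; apply: (ED).
- by move=> u s a x x'; apply: (EZ).
- by move=> s x Mx; exists x; [exact: MM | rewrite subrr; exact: gs0].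
- by move=> s x' x _ Mx Nx; apply: iff_sym; exact: EN.
Qed.

Lemma Good_eq J D k (L : lmodType S) (M N M' N' : G -> L -> Prop) :
  gsub M -> (forall s x, M s x <-> M' s x) ->
  (forall s x, M s x -> N s x <-> N' s x) ->
  Good J D k M N -> Good J D k M' N'.
Proof.
move=> HM MM NN; apply: (@Good_iso _ _ _ _ _ _ _ _ _ (fun _ => eq)) => //.
- split=> [s|s x y /MM Mx /MM My|u s a x Ca /MM Mx]; apply/MM.
  + exact: gs0.
  + exact: gsB.
  + exact: gsZ Ca Mx.
- by move=> s x y x' y' -> ->.
- by move=> u s a x x' _ ->.
- by move=> s x Mx; exists x => //; apply/MM.
- by move=> s x Mx; exists x => //; apply/MM.
- by move=> s x x' Mx _ <-; exact: NN.
Qed.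

Lemma delta_Fm b (u : 'I_b -> G) j : Fm u (u j) (delta_mx 0 j).
Proof.
by move=> i; rewrite mxE eqxx /=; case: eqP => [->|_]; [exact: gr1 | exact: gr0].
Qed.

Lemma comb_delta_id b (v : 'rV[S]_b) : comb (fun j => delta_mx 0 j) v = v.
Proof. by rewrite [RHS]row_sum_delta. Qed.

Lemma Good_free J (HJ : gideal J) (D : nat -> G -> Prop) k b (u : 'I_b -> G) :
  (forall j, D 0%N (u j)) -> Good J D k (Fm u) (FJ J u).
Proof.
move=> Du; case: k => //= k; exists b, u, (fun j => delta_mx 0 j); split.
- by move=> j; split; [exact: Du | exact: delta_Fm].
- by move=> s v Hv; exists v => //; rewrite comb_delta_id subrr; apply: gs0; exact: FJ_gsub.
- by apply: Good_zero => s v [_]; rewrite comb_delta_id.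
Qed.

Lemma Fm_cat b1 b2 (u1 : 'I_b1 -> G) (u2 : 'I_b2 -> G) s v :
  Fm (cat_fun u1 u2) s v <-> Fm u1 s (lsubmx v) /\ Fm u2 s (rsubmx v).
Proof.
split=> [H|[H1 H2] j].
  by split=> j; rewrite mxE; [have := H (lshift b2 j) | have := H (rshift b1 j)];
     rewrite ?cat_funl ?cat_funr.
by case: (split_ordP j) => i ->; [have := H1 i | have := H2 i]; rewrite mxE ?cat_funl ?cat_funr.
Qed.

Lemma FJ_cat J b1 b2 (u1 : 'I_b1 -> G) (u2 : 'I_b2 -> G) s v :
  FJ J (cat_fun u1 u2) s v <-> FJ J u1 s (lsubmx v) /\ FJ J u2 s (rsubmx v).
Proof.
split=> [H|[H1 H2] j].
  by split=> j; rewrite mxE; [have := H (lshift b2 j) | have := H (rshift b1 j)];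
     rewrite ?cat_funl ?cat_funr.
by case: (split_ordP j) => i ->; [have := H1 i | have := H2 i]; rewrite mxE ?cat_funl ?cat_funr.
Qed.

Lemma gmod_sub J (L : lmodType S) (M' M N : G -> L -> Prop) :
  gmod J M N -> gsub M' -> (forall s x, N s x -> M' s x) -> (forall s x, M' s x -> M s x) ->
  gmod J M' N.
Proof.
move=> H HM' NM MM; split=> //; first exact: gm_r H.
by move=> u s a x Ja /MM; exact: (gm_J H).
Qed.

Lemma gmod_quo J (L : lmodType S) (M' M N : G -> L -> Prop) :
  gmod J M N -> gsub M' -> (forall s x, N s x -> M' s x) -> (forall s x, M' s x -> M s x) ->
  gmod J M M'.
Proof.
move=> H HM' NM MM; split=> //; first exact: gm_l H.
by move=> u s a x Ja Mx; apply: NM; exact: (gm_J H) Mx.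
Qed.

(** Horseshoe lemma for 0 -> M1/N -> M2/N -> M2/M1 -> 0. With the generators of both ends
    concatenated, the syzygies form an extension of the same kind, so the induction on [k]
    closes. *)
Lemma Good_ext J (HJ : gideal J) D k (L : lmodType S) (M2 M1 N : G -> L -> Prop) :
  gmod J M2 N -> gsub M1 -> (forall s x, N s x -> M1 s x) -> (forall s x, M1 s x -> M2 s x) ->
  Good J D k M1 N -> Good J D k M2 M1 -> Good J D k M2 N.
Proof.
elim: k D L M2 M1 N => //= k IH D L M2 M1 N H HM1 NM1 M12.
move=> [b1 [u1 [m1 [Hm1 gen1 K1]]]] [b2 [u2 [m2 [Hm2 gen2 K2]]]].
have HM2 := gm_l H; have HN := gm_r H.
have m1M s v : Fm u1 s v -> M1 s (comb m1 v).
  by move=> Hv; apply: gs_comb Hv => // j; exact: (Hm1 j).2.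
have m2M s v : Fm u2 s v -> M2 s (comb m2 v).
  by move=> Hv; apply: gs_comb Hv => // j; exact: (Hm2 j).2.
have m2J s v : FJ J u2 s v -> N s (comb m2 v).
  by move=> Hv; apply: (gm_combJ H) Hv => j; exact: (Hm2 j).2.
have m1J s v : FJ J u1 s v -> N s (comb m1 v).
  by move=> Hv; apply: (gm_combJ H) Hv => j; apply/M12; exact: (Hm1 j).2.
pose u := cat_fun u1 u2; pose m := cat_fun m1 m2.
have Hm j : D 0%N (u j) /\ M2 (u j) (m j).
  rewrite /u /m; case: (split_ordP j) => i ->; rewrite ?cat_funl ?cat_funr.
    by have [? /M12] := Hm1 i.
  exact: Hm2.
exists (b1 + b2)%N, u, m; split=> //.
  move=> s x Mx; have [v2 Fv2 Hv2] := gen2 _ _ Mx; have [v1 Fv1 Hv1] := gen1 _ _ Hv2.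
  exists (row_mx v1 v2); first by apply/Fm_cat; rewrite row_mxKl row_mxKr.
  by rewrite comb_cat row_mxKl row_mxKr opprD [- comb m1 _ + _]addrC addrA.
have HK : gmod J (Ker u m N) (FJ J u) by apply: (Ker_mod HJ H) => j; exact: (Hm j).2.
(* Syzygies whose block over [M2 / M1] is zero modulo [J]: they amount to the syzygies of [M1 / N],
   and the quotient by them to those of [M2 / M1]. *)
pose X s v := Ker u m N s v /\ FJ J u2 s (rsubmx v).
have HX : gsub X.
  have HF := FJ_gsub HJ u2; have HKs := gm_l HK.
  split=> [s|s v w [v1 v2] [w1 w2]|t s a v Ha [v1 v2]].
  - by split; [exact: gs0 | rewrite linear0; exact: (gs0 HF)].
  - by split; [exact: (gsB HKs) | rewrite linearB; exact: (gsB HF)].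
  - by split; [exact: (gsZ HKs) Ha _ | rewrite linearZ; exact: (gsZ HF) Ha _].
have FX s v : FJ J u s v -> X s v.
  by move=> Hv; split; [exact: (gm_sub HK) | have [] := (FJ_cat J u1 u2 s v).1 Hv].
apply: (IH _ _ _ X) => //.
- by move=> s v [].
- apply: (@Good_iso _ _ _ _ _ _ _ _ _ (fun s v1 v => v1 = lsubmx v)) K1 => //.
  + exact: Ker_gsub.
  + by move=> s; rewrite linear0.
  + by move=> s x y x' y' -> ->; rewrite linearB.
  + by move=> t s a x x' _ ->; rewrite linearZ.
  + move=> s v [Fv Nv]; exists (row_mx v 0); last by rewrite row_mxKl.
    split; last by rewrite row_mxKr; apply: gs0; exact: FJ_gsub.
    split; first by apply/Fm_cat; rewrite row_mxKl row_mxKr; split=> //; apply: gs0; exact: Fm_gsub.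
    by rewrite comb_cat row_mxKl row_mxKr comb0 addr0.
  + move=> s v [[/Fm_cat[Fv1 Fv2] Nv] Jv]; exists (lsubmx v) => //; split=> //.
    have -> : comb m1 (lsubmx v) = comb m v - comb m2 (rsubmx v) by rewrite comb_cat addrK.
    by apply: gsB => //; exact: m2J.
  + move=> s _ v _ [_ Jv] ->; split=> [Hv|Hv]; first exact/FJ_cat.
    by have [] := (FJ_cat J u1 u2 s v).1 Hv.
- apply: (@Good_iso _ _ _ _ _ _ _ _ _ (fun s v2 v => v2 = rsubmx v)) K2 => //.
  + exact: Ker_gsub.
  + exact: (gm_l HK).
  + by move=> s; rewrite linear0.
  + by move=> s x y x' y' -> ->; rewrite linearB.
  + by move=> t s a x x' _ ->; rewrite linearZ.
  + move=> s v2 [Fv2 Mv2]; have [v1 Fv1 Nv1] := gen1 _ _ Mv2.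
    exists (row_mx (- v1) v2); last by rewrite row_mxKr.
    split; first by apply/Fm_cat; rewrite row_mxKl row_mxKr; split=> //; exact: (gsN (Fm_gsub u1)).
    rewrite comb_cat row_mxKl row_mxKr -[- v1]sub0r combB comb0 sub0r addrC //.
  + move=> s v [/Fm_cat[Fv1 Fv2] Nv]; exists (rsubmx v) => //; split=> //.
    have -> : comb m2 (rsubmx v) = comb m v - comb m1 (lsubmx v) by rewrite comb_cat addrAC subrr add0r.
    by apply: gsB => //; [exact: NM1 | exact: m1M].
  + by move=> s _ v _ Kv ->; split=> [Hv|[]].
Qed.

(** Mapping cone. The kernel of the cover F -> M2/M1 contains that of F -> M2/N, with quotient M1/N;
    so the resolution of [M1 / N] enters one step later. *)
Lemma Good_quo J (HJ : gideal J) D k (L : lmodType S) (M2 M1 N : G -> L -> Prop) :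
  gmod J M2 N -> gsub M1 -> (forall s x, N s x -> M1 s x) -> (forall s x, M1 s x -> M2 s x) ->
  Good J D k.+1 M2 N -> Good J (fun i => D i.+1) k M1 N -> Good J D k.+1 M2 M1.
Proof.
move=> H HM1 NM1 M12 /= [b [u [m [Hm gen HK]]]] G1.
have HM j : M2 (u j) (m j) by exact: (Hm j).2.
exists b, u, m; split=> //.
  by move=> s x Mx; have [v Fv Nv] := gen _ _ Mx; exists v => //; exact: NM1.
have H1 : gmod J M2 M1 by exact: gmod_quo H _ _ _.
have HK1 := Ker_mod HJ H HM; have HK2 := Ker_mod HJ H1 HM.
apply: (@Good_ext _ HJ _ _ _ _ (Ker u m N)) => //; first exact: gm_l HK1.
- by move=> s v /(gm_sub HK1).
- by move=> s v [Fv Nv]; split=> //; exact: NM1.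
apply: (@Good_iso _ _ _ _ _ _ _ _ _ (fun s x v => N s (x - comb m v))) G1 => //.
- exact: gm_l HK2.
- by move=> s; rewrite comb0 subrr; apply: gs0; exact: gm_r H.
- move=> s x y v w Nx Ny; rewrite combB subr_ACA.
  exact: (gsB (gm_r H)).
- by move=> t s a x v Ca Nx; rewrite combZ -scalerBr; exact: (gsZ (gm_r H)) Ca _.
- move=> s x Mx; have [v Fv Nv] := gen _ _ (M12 _ _ Mx); exists v => //; split=> //.
  by rewrite -[comb m v](subKr x); apply: gsB => //; exact: NM1.
- move=> s v [Fv Mv]; exists (comb m v) => //; rewrite subrr; apply: gs0; exact: gm_r H.
- move=> s x v Mx [Fv Mv] Nxv; split=> [Nx|[_ Nv]].
    by split=> //; rewrite -[comb m v](subKr x); apply: gsB => //; exact: gm_r H.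
  by rewrite -[x](subrK (comb m v)); apply: gsD => //; exact: gm_r H.
Qed.

Lemma Good_filtration J (HJ : gideal J) D k (L : lmodType S) (X : nat -> G -> L -> Prop) b :
  gmod J (X b) (X 0%N) -> (forall i, gsub (X i)) -> (forall i s x, X i s x -> X i.+1 s x) ->
  (forall i, (i < b)%N -> Good J D k (X i.+1) (X i)) -> Good J D k (X b) (X 0%N).
Proof.
move=> H HX XS; elim: b H => [|b IH] H HG; first exact: Good_zero.
have X0 i s x : X 0%N s x -> X i s x by elim: i => // i IHi /IHi/XS.
have Hb : gmod J (X b) (X 0%N) by apply: gmod_sub H _ _ _ => //; [exact: X0 | exact: XS].
apply: (@Good_ext _ HJ _ _ _ _ (X b)) => //; [exact: X0 | exact: XS | | exact: HG].
by apply: IH => // i ib; apply: HG; rewrite ltnS ltnW.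
Qed.

(** A finite direct sum is an iterated extension: the filtration passes from [N] to [M] one
    coordinate at a time. *)
Lemma Good_prod J (HJ : gideal J) D k b (M N : 'I_b -> G -> S^o -> Prop) :
  (forall j, gmod J (M j) (N j)) -> (forall j, Good J D k (M j) (N j)) ->
  Good J D k (fun s (v : 'rV[S]_b) => forall j, M j s (v 0 j))
    (fun s (v : 'rV[S]_b) => forall j, N j s (v 0 j)).
Proof.
move=> H HG.
pose X (i : nat) s (v : 'rV[S]_b) :=
  forall j : 'I_b, if (j < i)%N then M j s (v 0 j) else N j s (v 0 j).
have HX i : gsub (X i).
  split=> [s j|s v w Hv Hw j|t s a v Ha Hv j]; rewrite !mxE.
  - by case: ifP => _; [exact: gs0 (gm_l (H j)) _ | exact: gs0 (gm_r (H j)) _].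
  - move: (Hv j) (Hw j); case: ifP => _.
      exact: (gsB (gm_l (H j))).
    exact: (gsB (gm_r (H j))).
  - move: (Hv j); case: ifP => _.
      exact: (gsZ (gm_l (H j)) Ha).
    exact: (gsZ (gm_r (H j)) Ha).
have Xb s v : X b s v <-> forall j, M j s (v 0 j).
  by split=> Hv j; move: (Hv j); rewrite ltn_ord.
have X0 s v : X 0%N s v <-> forall j, N j s (v 0 j) by split.
have XS i s v : X i s v -> X i.+1 s v.
  move=> Hv j; move: (Hv j); rewrite ltnS; case: ltngtP => // _.
  exact: (gm_sub (H j)).
apply: (@Good_eq _ _ _ _ (X b) (X 0%N)) => //.
apply: Good_filtration => //.
  split=> // [s v /X0 Nv|t s a v Ha /Xb Hv].
    by apply/Xb => j; exact: (gm_sub (H j)).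
  by apply/X0 => j; rewrite mxE; exact: (gm_J (H j)) Ha _.
move=> i ib; pose i0 := Ordinal ib.
apply: (@Good_iso _ _ _ _ _ _ _ _ _ (fun s (x : S^o) (v : 'rV[S]_b) => x = v 0 i0)) (HG i0) => //.
- exact: gm_l (H i0).
- by move=> s; rewrite mxE.
- by move=> s x y v w -> ->; rewrite !mxE.
- by move=> t s a x v _ ->; rewrite mxE.
- move=> s x Mx; exists (x *: delta_mx 0 i0); last by rewrite !mxE !eqxx mulr1.
  move=> j; rewrite !mxE eqxx /=; case: (eqVneq j i0) => [->|ji]; first by rewrite ltnSn mulr1.
  by rewrite mulr0; case: ifP => _; [exact: gs0 (gm_l (H j)) _ | exact: gs0 (gm_r (H j)) _].
- by move=> s v Hv; exists (v 0 i0) => //; have := Hv i0; rewrite ltnSn.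
- move=> s x v Mx Hv ->; split=> [Nx j|Hx]; last by have := Hx i0; rewrite ltnn.
  have := Hv j; rewrite ltnS; case: (ltngtP j i) => // ji.
  by have -> : j = i0 by exact: val_inj.
Qed.

Lemma gmod_ideal J J' (HJ : gideal J) (HJ' : gideal J') u :
  (forall u s x, J u s x -> J' u s x) -> gmod J (J' u : G -> S^o -> Prop) (J u).
Proof.
move=> JJ; split=> //.
- split=> [s|s x y|t s a x Ca Jx]; [exact: gi0 | exact: giB | exact: (giMl HJ') Jx Ca].
- split=> [s|s x y|t s a x Ca Jx]; [exact: gi0 | exact: giB | exact: (giMl HJ) Jx Ca].
- exact: JJ.
- by move=> t s a x Ja /(gi_sub HJ') Jx; exact: (giMr HJ) Jx Ja.
Qed.

(* If J'/J has regularity at most 2, then M is also well resolved over the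
   quotient by J': the syzygies over J' are those over J modulo copies of J'/J. *)
Lemma Good_change_ring J J' (HJ : gideal J) (HJ' : gideal J') D k (L : lmodType S)
    (M N : G -> L -> Prop) :
  (forall u s x, J u s x -> J' u s x) ->
  (forall i u, D i u ->
     Good J (fun j => D (j + i).+2) k (J' u : G -> S^o -> Prop) (J u)) ->
  gmod J' M N -> Good J D k M N -> Good J' D k M N.
Proof.
move=> JJ; elim: k D L M N => // k IH D L M N HD H [b [u [m [Hm gen HK]]]].
exists b, u, m; split=> //.
have H0 : gmod J M N.
  split; [exact: gm_l H | exact: gm_r H | exact: gm_sub H |].
  by move=> t s a x /JJ; exact: (gm_J H).
have HM j : M (u j) (m j) by exact: (Hm j).2.
have HK0 := Ker_mod HJ H0 HM; have HK' := Ker_mod HJ' H HM.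
case: k IH HD HK => // k IH HD HK.
apply: IH => //.
  move=> i t Dt; have := HD _ _ Dt; apply: Good_mono => // j v.
  by rewrite addnS.
(* The submodule divided out is [FJ J' u] modulo [FJ J u], a sum of shifted copies of [J' / J].
   [Good_quo] delays it by one step on top of the step already taken to the syzygies: this is the
   [.+2] in the hypothesis. *)
apply: (@Good_quo _ HJ _ _ _ _ _ (FJ J u)) => //; first exact: gm_r HK'.
- by move=> s v Hv j; apply: JJ.
- exact: (gm_sub HK').
apply: (@Good_prod _ HJ _ _ _ (fun j => J' (u j)) (fun j => J (u j))) => j.
  exact: gmod_ideal.
by have := HD _ _ (Hm j).1; apply: Good_mono => // [i v|]; [rewrite addn0 | rewrite !leqW].
Qed.

(* Schanuel's lemma. *)
Lemma Good_kernel J (HJ : gideal J) D k (L : lmodType S) (M N : G -> L -> Prop)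
    b (u : 'I_b -> G) (m : 'I_b -> L) :
  (forall i u, D i u -> D i.+1 u) -> gmod J M N -> Good J D k.+1 M N ->
  (forall j, D 0%N (u j) /\ M (u j) (m j)) ->
  (forall s x, M s x -> exists2 v, Fm u s v & N s (x - comb m v)) ->
  Good J (fun i => D i.+1) k (Ker u m N) (FJ J u).
Proof.
move=> DD H /GoodS[b0 [u0 [m0 [Hm0 gen0 HK0]]]] Hm gen.
case: k HK0 => // k HK0.
have HM0 j : M (u0 j) (m0 j) by exact: (Hm0 j).2.
have HM j : M (u j) (m j) by exact: (Hm j).2.
have HN := gm_r H; have HMs := gm_l H.
pose uc := cat_fun u0 u; pose mc := cat_fun m0 m.
have HMc j : M (uc j) (mc j).
  by rewrite /uc /mc; case: (split_ordP j) => i ->; rewrite ?cat_funl ?cat_funr.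
have HX := Ker_mod HJ H HMc; have HK := Ker_mod HJ H HM.
have /fin_all_exists[sg Hsg] : forall j, exists v, Fm u (u0 j) v /\ N (u0 j) (m0 j - comb m v).
  by move=> j; have [v ? ?] := gen _ _ (HM0 j); exists v.
have sgF s v : Fm u0 s v -> Fm u s (comb sg v).
  move=> Hv; apply: (gs_comb (Fm_gsub u)) Hv => j; exact: (Hsg j).1.
have sgN s v : Fm u0 s v -> N s (comb m0 v - comb m (comb sg v)).
  move=> Hv; have -> : comb m (comb sg v) = comb (fun j => comb m (sg j)) v.
    rewrite (_ : comb sg v = \sum_j v 0 j *: sg j) // (big_morph (comb m) (@combD _ _ _ m) (comb0 m)).
    by apply: eq_bigr => j _; rewrite combZ.
  rewrite /comb -sumrB; apply: gs_sum => // j; rewrite -scalerBr.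
  exact: (gsZ HN) (Hv j) (Hsg j).2.
(* Relations among both generating systems together: the relations of [m0] form a submodule with
   quotient the free module on [u]. The degrees [u] lie in [D 0] but are used at [D 1], hence the
   monotonicity of [D]. *)
have GX : Good J (fun i => D i.+1) k.+1 (Ker uc mc N) (FJ J uc).
  pose X0 s v := Ker uc mc N s v /\ FJ J u s (rsubmx v).
  have HX0 : gsub X0.
    have HF := FJ_gsub HJ u; have HXs := gm_l HX.
    split=> [s|s v w [v1 v2] [w1 w2]|t s a v Ha [v1 v2]].
    - by split; [exact: gs0 | rewrite linear0; exact: (gs0 HF)].
    - by split; [exact: (gsB HXs) | rewrite linearB; exact: (gsB HF)].
    - by split; [exact: (gsZ HXs) Ha _ | rewrite linearZ; exact: (gsZ HF) Ha _].
  apply: (@Good_ext _ HJ _ _ _ _ X0) => //.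
  + move=> s v Hv; split; first exact: (gm_sub HX).
    by have [] := (FJ_cat J u0 u s v).1 Hv.
  + by move=> s v [].
  + apply: (@Good_iso _ _ _ _ _ _ _ _ _ (fun s v0 (v : 'rV[S]_(b0 + b)) => v0 = lsubmx v)) HK0 => //.
    * exact: Ker_gsub.
    * by move=> s; rewrite linear0.
    * by move=> s x y x' y' -> ->; rewrite linearB.
    * by move=> t s a x x' _ ->; rewrite linearZ.
    * move=> s v [Fv Nv]; exists (row_mx v 0); last by rewrite row_mxKl.
      split; last by rewrite row_mxKr; apply: gs0; exact: FJ_gsub.
      split; first by apply/Fm_cat; rewrite row_mxKl row_mxKr; split=> //; apply: gs0; exact: Fm_gsub.
      by rewrite comb_cat row_mxKl row_mxKr comb0 addr0.
    * move=> s v [[/Fm_cat[Fv1 Fv2] Nv] Jv]; exists (lsubmx v) => //; split=> //.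
      have -> : comb m0 (lsubmx v) = comb mc v - comb m (rsubmx v) by rewrite comb_cat addrK.
      by apply: gsB => //; exact: (gm_combJ H HM).
    * move=> s _ v _ [_ Jv] ->; split=> [Hv|Hv]; first exact/FJ_cat.
      by have [] := (FJ_cat J u0 u s v).1 Hv.
  + have GF : Good J (fun i => D i.+1) k.+1 (Fm u) (FJ J u).
      by apply: Good_free => // j; apply: DD; exact: (Hm j).1.
    apply: (@Good_iso _ _ _ _ _ _ _ _ _ (fun s w (v : 'rV[S]_(b0 + b)) => w = rsubmx v)) GF => //.
    * exact: Fm_gsub.
    * exact: (gm_l HX).
    * by move=> s; rewrite linear0.
    * by move=> s x y x' y' -> ->; rewrite linearB.
    * by move=> t s a x x' _ ->; rewrite linearZ.
    * move=> s v Fv; have [w Fw Nw] := gen0 _ _ (gs_comb HMs HM Fv).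
      exists (row_mx (- w) v); last by rewrite row_mxKr.
      split; first by apply/Fm_cat; rewrite row_mxKl row_mxKr; split=> //; exact: (gsN (Fm_gsub u0)).
      by rewrite comb_cat row_mxKl row_mxKr -[- w]sub0r combB comb0 sub0r addrC.
    * by move=> s v [/Fm_cat[Fv1 Fv2] Nv]; exists (rsubmx v).
    * by move=> s _ v _ Kv ->; split=> [Hv|[]].
(* Kernel of the map onto the relations of [m] that rewrites each [m0 j] through [m] by means of
   [sg]. It is free on [u0] modulo [J], so [Good_quo] resolves the quotient. *)
pose X1 s v := Ker uc mc N s v /\ FJ J u s (rsubmx v + comb sg (lsubmx v)).
have HX1 : gsub X1.
  have HF := FJ_gsub HJ u; have HXs := gm_l HX.
  split=> [s|s v w [v1 v2] [w1 w2]|t s a v Ha [v1 v2]].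
  - by split; [exact: gs0 | rewrite !linear0 comb0 addr0; exact: (gs0 HF)].
  - split; first exact: (gsB HXs).
    by rewrite !linearB /= combB addrACA -opprD; exact: (gsB HF).
  - split; first exact: (gsZ HXs) Ha _.
    by rewrite !linearZ /= combZ -scalerDr; exact: (gsZ HF) Ha _.
have FX s v : FJ J uc s v -> X1 s v.
  move=> Hv; split; first exact: (gm_sub HX).
  have [Hl Hr] := (FJ_cat J u0 u s v).1 Hv.
  apply: (gsD (FJ_gsub HJ u)) => //.
  by apply: (gm_combJ (Fm_mod HJ u)) Hl => j; exact: (Hsg j).1.
have GQ : Good J (fun i => D i.+1) k.+1 (Ker uc mc N) X1.
  apply: (@Good_quo _ HJ _ _ _ _ _ (FJ J uc)) => //; first by move=> s v [].
  have GF : Good J (fun i => D i.+2) k (Fm u0) (FJ J u0).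
    by apply: Good_free => // j; apply/DD/DD; exact: (Hm0 j).1.
  apply: (@Good_iso _ _ _ _ _ _ _ _ _ (fun s w (v : 'rV[S]_(b0 + b)) => FJ J u s (rsubmx v + comb sg (lsubmx v)) /\ w = lsubmx v)) GF => //.
  - exact: Fm_gsub.
  - move=> s; rewrite !linear0 comb0 addr0; split=> //; apply: gs0; exact: FJ_gsub.
  - move=> s x y x' y' [Hx ->] [Hy ->]; rewrite !linearB /= combB addrACA -opprD.
    by split=> //; apply: (gsB (FJ_gsub HJ u)).
  - move=> t s a x x' Ca [Hx ->]; rewrite !linearZ /= combZ -scalerDr.
    by split=> //; apply: (gsZ (FJ_gsub HJ u)) Ca _.
  - move=> s w Fw; exists (row_mx w (- comb sg w)); last first.
      by rewrite row_mxKl row_mxKr addNr; split=> //; apply: gs0; exact: FJ_gsub.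
    split; last by rewrite row_mxKl row_mxKr addNr; apply: gs0; exact: FJ_gsub.
    split.
      apply/Fm_cat; rewrite row_mxKl row_mxKr; split=> //.
      by apply: (gsN (Fm_gsub u)); exact: sgF.
    rewrite comb_cat row_mxKl row_mxKr -[- comb sg w]sub0r combB comb0 sub0r.
    exact: sgN.
  - by move=> s v [[/Fm_cat[Fv1 Fv2] Nv] Jv]; exists (lsubmx v).
  - move=> s w v Fw [_ Jv] [_ ->]; split=> [Jl|/FJ_cat[]//].
    apply/FJ_cat; split=> //; rewrite -[rsubmx v](addrK (comb sg (lsubmx v))).
    apply: (gsB (FJ_gsub HJ u)) => //.
    by apply: (gm_combJ (Fm_mod HJ u)) Jl => j; exact: (Hsg j).1.
apply: (@Good_iso _ _ _ _ _ _ _ _ _ (fun s (v : 'rV[S]_(b0 + b)) w => w = rsubmx v + comb sg (lsubmx v))) GQ => //.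
- exact: (gm_l HX).
- exact: (gm_l HK).
- by move=> s; rewrite !linear0 comb0 addr0.
- by move=> s x y x' y' -> ->; rewrite !linearB /= combB addrACA -opprD.
- by move=> t s a x x' _ ->; rewrite !linearZ /= combZ -scalerDr.
- move=> s v [/Fm_cat[Fv1 Fv2] Nv]; exists (rsubmx v + comb sg (lsubmx v)) => //; split.
    by apply: (gsD (Fm_gsub u)) => //; exact: sgF.
  have -> : comb m (rsubmx v + comb sg (lsubmx v)) =
    comb mc v - (comb m0 (lsubmx v) - comb m (comb sg (lsubmx v))).
    by rewrite comb_cat combD opprB [comb m0 _ + _]addrC addrACA subrr addr0.
  by apply: gsB => //; exact: sgN.
- move=> s w [Fw Nw]; exists (row_mx 0 w); last by rewrite row_mxKl row_mxKr comb0 addr0.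
  split; last by rewrite comb_cat row_mxKl row_mxKr comb0 add0r.
  by apply/Fm_cat; rewrite row_mxKl row_mxKr; split=> //; apply: gs0; exact: Fm_gsub.
- by move=> s v w Kv _ ->; split=> [[]|].
Qed.

End Gradings.

(** * Degree shifts *)

Section Reindexing.
Variables (S : comNzRingType) (G : Type) (C : G -> G -> S -> Prop).
Hypothesis HC : grading C.

Lemma gr_gideal : gideal C C.
Proof.
by split=> [//|||u s w x y Cx Cy|u s w x y Cx Cy];
  [exact: gr0 | exact: grB | exact: (grM HC Cx Cy) | exact: (grM HC Cx Cy)].
Qed.

Lemma gi_gsub J (HJ : gideal C J) u : gsub C (J u : G -> S^o -> Prop).
Proof.
by split=> [s|s x y|t s a x Ca Cx]; [exact: (gi0 HJ) | exact: (giB HJ) | exact: (giMl HJ Cx Ca)].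
Qed.

Lemma gr_gsub u : gsub C (C u : G -> S^o -> Prop).
Proof. exact: gi_gsub gr_gideal u. Qed.

Lemma gr_gmod J (HJ : gideal C J) u : gmod C J (C u : G -> S^o -> Prop) (J u).
Proof. by apply: (gmod_ideal HJ gr_gideal) => t s x; exact: gi_sub. Qed.

(** On the diagonal [tau] is the successor of nat, so degree 0 is not of the form [tau s']. The
    second alternatives say that in such degrees nothing survives modulo [J] and [N]. *)
Lemma Good_shift (tau : G -> G) J D D' k (L : lmodType S) (M N : G -> L -> Prop) :
  gideal C J -> (forall u s x, C (tau u) (tau s) x <-> C u s x) ->
  (forall u s x, J (tau u) (tau s) x <-> J u s x) ->
  (forall s, (exists s', s = tau s') \/ (forall u x, C (tau u) s x -> J (tau u) s x)) ->
  (forall s, (exists s', s = tau s') \/ (forall x, M s x -> N s x)) ->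
  (forall i u, D i u -> D' i (tau u)) -> gsub C N ->
  Good C J D k (fun s => M (tau s)) (fun s => N (tau s)) -> Good C J D' k M N.
Proof.
move=> HJ Ct Jt im; elim: k D D' L M N => // k IH D D' L M N imM DD HN.
move=> /GoodS[b [u [m [Hm gen HK]]]]; apply/GoodS; exists b, (tau \o u), m; split.
- by move=> j; have [Du Mm] := Hm j; split=> //; exact: DD.
- move=> s x Mx; case: (imM s) => [[s' es]|MN].
    subst s; have [v Fv Nv] := gen _ _ Mx; exists v => // j; exact/Ct.
  exists 0; first by move=> j; rewrite mxE; exact: gr0.
  by rewrite comb0 subr0; exact: MN.
apply: (IH (fun i => D i.+1)) => //.
- move=> s; case: (im s) => [|CJ]; [by left | right=> v [Fv _] j; exact: CJ (Fv j)].
- by move=> i w; exact: DD.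
- exact: FJ_gsub.
- apply: (@Good_eq _ _ _ J _ _ _ (Ker C u m (fun s => N (tau s))) (FJ J u) _ _ _ _ _ HK).
  + apply: (Ker_gsub HC); split=> [s|s x y|t s a x /Ct Ca]; [exact: (gs0 HN) | exact: (gsB HN) |].
    exact: (gsZ HN Ca).
  + by move=> s v; split=> -[Fv Nv]; split=> // j; have := Fv j; apply Ct.
  + by move=> s v _; split=> Jv j; have := Jv j; apply Jt.
Qed.

End Reindexing.

(** * Restriction of a resolution to a slice of the grading *)

Section Slicing.
Variables (S : comNzRingType) (G G' : Type).
Variables (C : G -> G -> S -> Prop) (C' : G' -> G' -> S -> Prop) (delta : G' -> G).
Hypotheses (HC : grading C) (HC' : grading C').
Hypothesis CC : forall u s x, C' u s x -> C (delta u) (delta s) x.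
Variables (J : G -> G -> S -> Prop) (J' : G' -> G' -> S -> Prop).
Hypotheses (HJ : gideal C J) (HJ' : gideal C' J').
Hypothesis JJ : forall u s x, J' u s x -> J (delta u) (delta s) x.

Lemma gsub_slice (L : lmodType S) (M : G -> L -> Prop) :
  gsub C M -> gsub C' (fun s => M (delta s)).
Proof.
by move=> HM; split=> [s|s x y|u s a x /CC Ca]; [exact: (gs0 HM) | exact: (gsB HM) | exact: (gsZ HM Ca)].
Qed.

Lemma gmod_slice (L : lmodType S) (M N : G -> L -> Prop) :
  gmod C J M N -> gmod C' J' (fun s => M (delta s)) (fun s => N (delta s)).
Proof.
move=> H; split; [exact/gsub_slice/gm_l/H | exact/gsub_slice/gm_r/H | |].
- by move=> s x; exact: (gm_sub H).
- by move=> u s a x /JJ; exact: (gm_J H).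
Qed.

(** Slices of free modules need not be free over the slice ring. If the slice of the free module in
    step [i] is itself resolved within the degrees allowed from step [i] on, iterated mapping cones
    assemble a resolution of the slice of [M / N]. *)
Lemma Good_slice D D' k (L : lmodType S) (M N : G -> L -> Prop) :
  gmod C J M N ->
  (forall i u, (i < k)%N -> D i u ->
     Good C' J' (fun j => D' (j + i)%N) (k - i) (fun s => C u (delta s) : S^o -> Prop)
       (fun s => J u (delta s))) ->
  Good C J D k M N -> Good C' J' D' k (fun s => M (delta s)) (fun s => N (delta s)).
Proof.
elim: k D D' L M N => // k IH D D' L M N H HD /GoodS[b [u [m [Hm gen HK]]]].
have HM j : M (u j) (m j) by exact: (Hm j).2.
have HKm := Ker_mod HC HJ H HM; have HN := gm_r H.
have GQ : Good C' J' D' k.+1 (fun s => Fm C u (delta s)) (fun s => Ker C u m N (delta s)).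
  apply: (@Good_quo _ _ _ HC' _ HJ' _ _ _ _ _ (fun s => FJ J u (delta s))).
  - exact/gmod_slice/Fm_mod.
  - exact/gsub_slice/gm_l/HKm.
  - by move=> s; exact: (gm_sub HKm).
  - by move=> s v [].
  - apply: (@Good_prod _ _ _ HC' _ HJ' _ _ _ (fun j s => C (u j) (delta s)) (fun j s => J (u j) (delta s))).
      by move=> j; exact/gmod_slice/gr_gmod.
    move=> j; have := HD 0%N _ isT (Hm j).1; rewrite subn0; apply: Good_mono => // i w.
    by rewrite addn0.
  - apply: IH HK => // i w ik Dw; have := HD i.+1 w ik Dw; rewrite subSS.
    by apply: Good_mono => // j v; rewrite addnS.
have HMs := gm_l H.
have E0 s : N (delta s) (comb m (0 : 'rV_b) - 0) by rewrite comb0 subrr; exact: (gs0 HN).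
apply: (@Good_iso _ _ _ _ _ _ _ _ _ _ _ _ (fun s v x => N (delta s) (comb m v - x))) GQ => //.
- by apply: gsub_slice; exact: Fm_gsub.
- exact: gsub_slice.
- by move=> s v w x y Nv Nw; rewrite combB subr_ACA; exact: (gsB HN).
- by move=> t s a v x /CC Ca Nv; rewrite combZ -scalerBr; exact: (gsZ HN Ca Nv).
- by move=> s v Fv; exists (comb m v); [exact: (gs_comb HMs HM Fv) | rewrite subrr; exact: (gs0 HN)].
- move=> s x Mx; have [v Fv Nv] := gen _ _ Mx; exists v => //.
  by rewrite -opprB; exact: (gsN HN).
- move=> s v x Fv Mx Nvx; split=> [[_ Nv]|Nx].
    by rewrite -[x](subKr (comb m v)); exact: (gsB HN).
  by split=> //; rewrite -[comb m v](subrK x); exact: (gsD HN).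
Qed.

End Slicing.

(** * Reduction modulo a homogeneous regular element *)

Section Reduction.
Variables (S : comNzRingType) (G : Type) (C : G -> G -> S -> Prop).
Hypothesis HC : grading C.
Variables (p : G -> G) (g : S).
Hypothesis Cp : forall u s x, C (p u) (p s) x <-> C u s x.
Hypothesis Cg : forall s, C (p s) s g.

(** [p s] is the degree [s] minus the degree of [g]. *)
Definition add_mul (L : lmodType S) (N M : G -> L -> Prop) s x :=
  exists y z, [/\ N s y, M (p s) z & x = y + g *: z].

Definition add_gen (J : G -> G -> S -> Prop) u : G -> S -> Prop :=
  @add_mul S^o (J u) (C u).

Lemma add_mul_gsub (L : lmodType S) (N M : G -> L -> Prop) :
  gsub C N -> gsub C M -> gsub C (add_mul N M).
Proof.
move=> HN HM; split=> [s|s x y [x1 [x2 [Nx1 Mx2 ->]]] [y1 [y2 [Ny1 My2 ->]]]|u s a x Ca [x1 [x2 [Nx1 Mx2 ->]]]].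
- by exists 0, 0; split; rewrite ?scaler0 ?addr0 //; [exact: (gs0 HN) | exact: (gs0 HM)].
- exists (x1 - y1), (x2 - y2); split; [exact: (gsB HN) | exact: (gsB HM) |].
  by rewrite scalerBr opprD addrACA.
- exists (a *: x1), (a *: x2); split; [exact: (gsZ HN Ca) | apply: (gsZ HM) Mx2; exact/Cp |].
  by rewrite scalerDr !scalerA mulrC.
Qed.

Lemma add_mul_r (L : lmodType S) (N M : G -> L -> Prop) s x :
  gsub C M -> N s x -> add_mul N M s x.
Proof. by move=> HM Nx; exists x, 0; rewrite scaler0 addr0; split=> //; exact: (gs0 HM). Qed.

Lemma add_gen_gideal J : gideal C J -> gideal C (add_gen J).
Proof.
move=> HJ; have HA u := add_mul_gsub (gi_gsub HJ u) (gr_gsub HC u); split.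
- move=> u s x [y [z [Jy Cz ->]]]; apply: (grD HC); first exact: (gi_sub HJ).
  exact: (grM HC Cz).
- by move=> u s; exact: (gs0 (HA u)).
- by move=> u s x y; exact: (gsB (HA u)).
- by move=> u s w x a Jx Ca; exact: (gsZ (HA u) Ca Jx).
- move=> u s w x a Cx [y [z [Jy Cz ->]]]; exists (y * x), (z * x); split.
  + exact: (giMr HJ Cx Jy).
  + exact: (grM HC Cx Cz).
  + by rewrite mulrDl -mulrA.
Qed.

Lemma add_gen_gmod J (L : lmodType S) (M N : G -> L -> Prop) :
  gmod C J M N -> gmod C (add_gen J) M (add_mul N M).
Proof.
move=> H; have HM := gm_l H; have HN := gm_r H; split=> //; first exact: add_mul_gsub.
- move=> s x [y [z [/(gm_sub H) My Mz ->]]]; apply: (gsD HM) => //.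
  exact: (gsZ HM (Cg s) Mz).
- move=> u s a x [y [z [Jy Cz ->]]] Mx; exists (y *: x), (z *: x); split.
  + exact: (gm_J H Jy Mx).
  + exact: (gsZ HM Cz Mx).
  + by rewrite scalerDl -scalerA.
Qed.

(* Tensoring a resolution with the quotient by a regular element. *)
Lemma Good_reduce J D k (L : lmodType S) (M N : G -> L -> Prop) :
  gideal C J -> (forall u s x, C u (p s) x -> J u s (g * x) -> J u (p s) x) ->
  gmod C J M N -> (forall s x, M (p s) x -> N s (g *: x) -> N (p s) x) ->
  Good C J D k M N -> Good C (add_gen J) D k M (add_mul N M).
Proof.
move=> HJ regJ; elim: k D L M N => // k IH D L M N H regM /GoodS[b [u [m [Hm gen HK]]]].
have HM := gm_l H; have HN := gm_r H.
apply/GoodS; exists b, u, m; split=> //.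
  by move=> s x Mx; have [v Fv Nv] := gen _ _ Mx; exists v => //; exact: add_mul_r.
have Hmm j : M (u j) (m j) by exact: (Hm j).2.
have HKm := Ker_mod HC HJ H Hmm; have HF := Fm_gsub HC u.
have HJ' := add_gen_gideal HJ; have H' := add_gen_gmod H.
have FJE s v : FJ (add_gen J) u s v <-> add_mul (FJ J u) (Fm C u) s v.
  split=> [Hv|[y [z [Jy Cz ->]]] j]; last by rewrite !mxE; exists (y 0 j), (z 0 j).
  have /fin_all_exists[y Hy] : forall j, exists yz : S * S,
      [/\ J (u j) s yz.1, C (u j) (p s) yz.2 & v 0 j = yz.1 + g * yz.2].
    by move=> j; have [y [z Hyz]] := Hv j; exists (y, z).
  exists (\row_j (y j).1), (\row_j (y j).2); split.
  - by move=> j; rewrite mxE; have [] := Hy j.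
  - by move=> j; rewrite mxE; have [] := Hy j.
  - by apply/rowP => j; rewrite !mxE; have [] := Hy j.
have regF s v : Fm C u (p s) v -> FJ J u s (g *: v) -> FJ J u (p s) v.
  by move=> Fv Jv j; apply: regJ => //; move: (Jv j); rewrite mxE.
have KM s v : Ker C u m N s v -> Ker C u m (add_mul N M) s v.
  by case=> Fv Nv; split=> //; exact: add_mul_r.
have /(IH _ _ _ _ HKm) HK' : forall s v, Ker C u m N (p s) v -> FJ J u s (g *: v) -> FJ J u (p s) v.
  by move=> s v [Fv _]; exact: regF.
have {}HK' := HK' _ HK.
have HKs := gm_l HKm; have HFJ := gm_r HKm.
refine ((Good_iso2 _ _ _ _ _ _ _ _ _).1 HK').
- exact: HKs.
- by apply: Ker_gsub => //; exact: (gm_r H').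
- exact: FJ_gsub.
- exact: KM.
(* Every relation modulo [g] lifts: the part [g *: z] of its value is cancelled by [g] times the
   coefficients of [z]. *)
- move=> s v [Fv [y [z [Ny Mz e]]]]; have [w Fw Nw] := gen _ _ Mz.
  exists (v - g *: w).
    split; first by apply: (gsB HF) => //; apply: (gsZ HF (Cg s)) Fw.
    rewrite combB combZ e -addrA -scalerBr; apply: (gsD HN) => //.
    exact: (gsZ HN (Cg s) Nw).
  rewrite addrC addKr -scaleN1r scalerA mulN1r scaleNr -scalerN.
  apply/FJE; exists 0, (- w); split; [exact: (gs0 HFJ) | exact: (gsN HF) | by rewrite add0r].
- move=> s v [Fv Nv]; split=> [[y [z [Jy [Fz _] ->]]]|/FJE[y [z [Jy Fz e]]]].
    by apply/FJE; exists y, z.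
  exists y, z; split=> //; split=> //.
  apply: regM; first exact: (gs_comb HM Hmm Fz).
  rewrite -combZ; have -> : g *: z = v - y by rewrite e addrC addKr.
  by rewrite combB; apply: (gsB HN) => //; exact: (gm_combJ H Hmm Jy).
Qed.

End Reduction.

Lemma Good_regular (S : comNzRingType) G (C : G -> G -> S -> Prop) J D k u :
  grading C -> gideal C J -> D 0%N u ->
  Good C J D k (C u : G -> S^o -> Prop) (J u).
Proof.
move=> HC HJ Du.
have GF : Good C J D k (Fm C (fun _ : 'I_1 => u)) (FJ J (fun _ : 'I_1 => u)) by exact: Good_free.
apply: (@Good_iso _ _ _ _ _ _ _ _ _ _ _ _ (fun s (v : 'rV[S]_1) (x : S^o) => x = v 0 0)) GF => //.
- exact: Fm_gsub.
- exact: gr_gsub.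
- by move=> s; rewrite mxE.
- by move=> s x y x' y' -> ->; rewrite !mxE.
- by move=> t s a x x' _ ->; rewrite mxE.
- by move=> s v Fv; exists (v 0 0).
- by move=> s x Cx; exists (\row__ x); [move=> j; rewrite mxE | rewrite mxE].
- by move=> s v x _ _ ->; split=> [Jv|Jx j]; [exact: Jv | rewrite ord1].
Qed.

(** * Diagonals of bigraded rings *)

Section Diagonal.
Variables (S : comNzRingType) (hom : int -> int -> S -> Prop).

(** The last two fields make every component a finite-dimensional space over the field in degree (0,
    0); this is what allows a module in a single degree to be cut into copies of the residue
    field. *)
Record bigraded : Prop := Bigraded {
  hom0 : forall a b, hom a b 0;
  homB : forall a b x y, hom a b x -> hom a b y -> hom a b (x - y);
  hom1 : hom 0 0 1;
  homM : forall a b a' b' x y, hom a b x -> hom a' b' y -> hom (a + a') (b + b') (x * y);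
  hom_neg : forall a b x, (a < 0) || (b < 0) -> hom a b x -> x = 0;
  hom_fin : forall a b, exists m (l : 'I_m -> S), (forall i, hom a b (l i)) /\
     forall x, hom a b x -> exists c : 'I_m -> S,
       (forall i, hom 0 0 (c i)) /\ x = \sum_i c i * l i;
  hom_field : forall x, hom 0 0 x -> x = 0 \/ exists2 y, hom 0 0 y & y * x = 1 }.

Hypothesis HB : bigraded.

Definition unit_id (s : int * int) : S^o -> Prop := hom s.1 s.2.

Record gid (X : int * int -> S^o -> Prop) : Prop := Gid {
  gid_sub : forall s x, X s x -> hom s.1 s.2 x;
  gid0 : forall s, X s 0;
  gidB : forall s x y, X s x -> X s y -> X s (x - y);
  gidM : forall a b s x y, hom a b y -> X s x -> X (s.1 + a, s.2 + b) (y * x) }.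

Lemma gid_cast (X : int * int -> S^o -> Prop) s t x : s.1 = t.1 -> s.2 = t.2 -> X s x -> X t x.
Proof. by case: s t => [? ?] [? ?] /= -> ->. Qed.

Lemma hom_cast a b a' b' x : a = a' -> b = b' -> hom a b x -> hom a' b' x.
Proof. by move=> -> ->. Qed.

Lemma unit_gid : gid unit_id.
Proof.
split=> // [s|s x y|a b s x y Hy Hx]; [exact: hom0 | exact: homB |].
by rewrite /unit_id /= mulrC; apply: homM.
Qed.

Lemma gidN X (HX : gid X) s x : X s x -> X s (- x).
Proof. by move=> Xx; rewrite -sub0r; apply: gidB => //; exact: gid0. Qed.

Lemma gidD X (HX : gid X) s x y : X s x -> X s y -> X s (x + y).
Proof. by move=> Xx Xy; rewrite -[y]opprK; apply: gidB => //; exact: gidN. Qed.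

Definition bigr (u s : int * int) (x : S) : Prop := hom (s.1 - u.1) (s.2 - u.2) x.
Definition bigr_id (X : int * int -> S^o -> Prop) (u s : int * int) (x : S) : Prop :=
  X (s.1 - u.1, s.2 - u.2) x.

Lemma bigr_grading : grading bigr.
Proof.
split=> [u s|u s x y|u|u s w x y Hx Hy]; rewrite /bigr.
- exact: hom0.
- exact: homB.
- by rewrite !subrr; exact: hom1.
- by have := homM HB Hy Hx; apply: hom_cast; ring.
Qed.

Lemma bigr_gideal X : gid X -> gideal bigr (bigr_id X).
Proof.
move=> HX; split=> [u s x|u s|u s x y|u s w x y Xx Hy|u s w x y Hx Xy]; rewrite /bigr_id /bigr.
- exact: (gid_sub HX).
- exact: gid0.
- exact: gidB.
- by have := gidM HX Hy Xx; apply: gid_cast => /=; ring.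
- rewrite mulrC; have := gidM HX Hx Xy; by apply: gid_cast => /=; ring.
Qed.

Lemma gid_gsub X : gid X -> gsub bigr X.
Proof.
move=> HX; split=> [s|s x y|u s a x Ha Xx]; [exact: gid0 | exact: gidB |].
by have := gidM HX Ha Xx; apply: gid_cast => /=; ring.
Qed.

Lemma gid_gmod J X Y : gid X -> gid Y -> (forall s x, Y s x -> X s x) ->
  (forall s t x y, J s x -> X t y -> Y (s.1 + t.1, s.2 + t.2) (x * y)) ->
  gmod bigr (bigr_id J) X Y.
Proof.
move=> HX HY YX JX; split=> //; [exact: gid_gsub | exact: gid_gsub |].
move=> u s a x Ja Xx; have := JX _ _ _ _ Ja Xx; by apply: gid_cast => /=; ring.
Qed.

Variables (c e : nat).
Hypotheses (c0 : (0 < c)%N) (e0 : (0 < e)%N).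

(** [sl X a b] is the [(c, e)]-diagonal of [X] shifted by [(a, b)]; [digr] and [digr_id] are
    the gradings of the diagonal ring in the encoding of [grading]. *)
Definition dia (a b : int) (s : nat) : int * int := (a + c%:Z * s%:Z, b + e%:Z * s%:Z).
Definition sl (X : int * int -> S^o -> Prop) a b (s : nat) : S^o -> Prop := X (dia a b s).
Definition digr (u s : nat) (x : S) : Prop := hom (c%:Z * (s%:Z - u%:Z)) (e%:Z * (s%:Z - u%:Z)) x.
Definition digr_id (X : int * int -> S^o -> Prop) (u s : nat) (x : S) : Prop :=
  X (c%:Z * (s%:Z - u%:Z), e%:Z * (s%:Z - u%:Z)) x.

Lemma dia_sub a b u s :
  ((dia a b s).1 - (dia a b u).1, (dia a b s).2 - (dia a b u).2) =
  (c%:Z * (s%:Z - u%:Z), e%:Z * (s%:Z - u%:Z)).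
Proof. by rewrite /dia /=; congr pair; ring. Qed.

Lemma digr_bigr a b u s x : digr u s x -> bigr (dia a b u) (dia a b s) x.
Proof. by rewrite /digr /bigr; have [-> ->] := dia_sub a b u s. Qed.

Lemma digr_bigr_id X a b u s x : digr_id X u s x -> bigr_id X (dia a b u) (dia a b s) x.
Proof. by rewrite /digr_id /bigr_id dia_sub. Qed.

Lemma digr_grading : grading digr.
Proof.
split=> [u s|u s x y|u|u s w x y Hx Hy]; rewrite /digr.
- exact: hom0.
- exact: homB.
- by rewrite !subrr !mulr0; exact: hom1.
- by have := homM HB Hy Hx; apply: hom_cast; ring.
Qed.

Lemma digr_gideal X : gid X -> gideal digr (digr_id X).
Proof.
move=> HX; split=> [u s x|u s|u s x y|u s w x y Xx Hy|u s w x y Hx Xy]; rewrite /digr_id /digr.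
- exact: (gid_sub HX).
- exact: gid0.
- exact: gidB.
- by have := gidM HX Hy Xx; apply: gid_cast => /=; ring.
- by rewrite [y * x]mulrC; have := gidM HX Hx Xy; apply: gid_cast => /=; ring.
Qed.

Lemma sl_gsub X a b : gid X -> gsub digr (sl X a b).
Proof.
by move=> HX; apply: (gsub_slice (@digr_bigr a b)); exact: gid_gsub.
Qed.

Lemma sl_gmod J X Y a b : gmod bigr (bigr_id J) X Y -> gmod digr (digr_id J) (sl X a b) (sl Y a b).
Proof. exact: (gmod_slice (@digr_bigr a b) (@digr_bigr_id J a b)). Qed.

Lemma slS X a b s x : sl X a b s.+1 x <-> sl X (a + c%:Z) (b + e%:Z) s x.
Proof.
by rewrite /sl; split; apply: gid_cast; rewrite /dia /= -[in s.+1]addn1 PoszD; ring.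
Qed.

(** Only an upper bound, as for Castelnuovo-Mumford regularity; the matching lower bound comes from
    minimality in [syzygies_step]. *)
Definition Dle (r i u : nat) : Prop := (u <= r + i)%N.

Lemma digr_neg u s x : (s < u)%N -> digr u s x -> x = 0.
Proof.
move=> su; apply: (hom_neg HB); apply/orP; left.
by rewrite pmulr_rlt0 ?ltz_nat // subr_lt0 ltz_nat.
Qed.

Lemma digr_shift u s x : digr u.+1 s.+1 x <-> digr u s x.
Proof. by rewrite /digr (_ : s.+1%:Z - u.+1%:Z = s%:Z - u%:Z) //; lia. Qed.

(** * Regularity over the diagonal of S/J *)

Section OverDiagonal.
Variable J : int * int -> S^o -> Prop.
Hypothesis HJ : gid J.

(** If this holds for all [k], the regularity of [M / N] over the diagonal of [S / J] is
    at most [r]. *)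
Definition DGood r k (L : lmodType S) (M N : nat -> L -> Prop) :=
  Good digr (digr_id J) (Dle r) k M N.

Let HC := digr_grading.
Let HJd := digr_gideal HJ.

Lemma DGood_mono r r' k k' (L : lmodType S) (M N : nat -> L -> Prop) :
  (r <= r')%N -> (k' <= k)%N -> DGood r k M N -> DGood r' k' M N.
Proof.
move=> rr kk; apply: Good_mono => // i u; rewrite /Dle => /leq_trans; apply.
by rewrite leq_add2r.
Qed.

Lemma DGood_succ r k (L : lmodType S) (M N : nat -> L -> Prop) :
  Good digr (digr_id J) (fun i => Dle r i.+1) k M N <-> DGood r.+1 k M N.
Proof.
by split; apply: Good_mono => // i u; rewrite /Dle addnS addSn.
Qed.

(** In terms of regularity: reg(M2/M1) is at most the maximum of reg(M2/N) and reg(M1/N) - 1. *)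
Lemma DGood_quo r k (L : lmodType S) (M2 M1 N : nat -> L -> Prop) :
  gmod digr (digr_id J) M2 N -> gsub digr M1 ->
  (forall s x, N s x -> M1 s x) -> (forall s x, M1 s x -> M2 s x) ->
  DGood r k.+1 M2 N -> DGood r.+1 k M1 N -> DGood r k.+1 M2 M1.
Proof. by move=> H H1 N1 M1' G2 /DGood_succ G1; apply: (Good_quo HC HJd H). Qed.

Lemma DGood_shift r k (L : lmodType S) (M N : nat -> L -> Prop) :
  gsub digr N -> (forall x, M 0%N x -> N 0%N x) ->
  DGood r k (fun s => M s.+1) (fun s => N s.+1) -> DGood r.+1 k M N.
Proof.
move=> HN M0; apply: (Good_shift HC HJd) => //.
- exact: digr_shift.
- by move=> u s x; rewrite /digr_id (_ : s.+1%:Z - u.+1%:Z = s%:Z - u%:Z) //; lia.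
- case=> [|s]; last by left; exists s.
  by right=> u x /digr_neg->//; exact: (gi0 HJd).
- by case=> [|s]; [right | left; exists s].
Qed.

Lemma DGood_sl_shift r k X Y a b :
  gid X -> gid Y -> (forall x, sl X a b 0%N x -> sl Y a b 0%N x) ->
  DGood r k (sl X (a + c%:Z) (b + e%:Z)) (sl Y (a + c%:Z) (b + e%:Z)) ->
  DGood r.+1 k (sl X a b) (sl Y a b).
Proof.
move=> HX HY XY GX; apply: DGood_shift => //; first exact: sl_gsub.
apply: Good_eq GX; first exact: sl_gsub.
  by move=> s x; apply: iff_sym; exact: slS.
by move=> s x _; apply: iff_sym; exact: slS.
Qed.

(** The residue field, as a module over the diagonal. *)
Definition resM s : S^o -> Prop := digr 0 s.
Definition resN s (x : S^o) : Prop := digr 0 s x /\ (s = 0%N -> x = 0).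

Lemma resN_gsub : gsub digr resN.
Proof.
split=> [s|s x y [Cx x0] [Cy y0]|u s a x Ca [Cx x0]].
- by split=> //; exact: (gr0 HC).
- by split; [exact: (grB HC) | move=> s0; rewrite x0 ?y0 ?subr0].
- split; first exact: (grM HC Cx Ca).
  move=> s0; case: (posnP u) => [/x0->|u0]; first by rewrite scaler0.
  by rewrite (@digr_neg u s a) ?scale0r // s0.
Qed.

Definition res_good k := DGood 0 k resM resN.

Hypothesis J00 : forall x, J (0, 0) x -> x = 0.

Lemma res_gmod : gmod digr (digr_id J) resM resN.
Proof.
split.
- exact: gr_gsub.
- exact: resN_gsub.
- by move=> s x [].
- move=> u s a x Ja Cx; split; first exact: (grM HC Cx (gi_sub HJd Ja)).
  move=> s0; subst s; case: (posnP u) => u0.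
    subst u; move: Ja; rewrite /digr_id subrr !mulr0 => /J00->; exact: scale0r.
  by rewrite (@digr_neg u 0 a) ?scale0r //; exact: (gi_sub HJd Ja).
Qed.

(* A finite-dimensional module concentrated in degree 0 is an iterated
   extension of copies of the residue field. *)
Lemma DGood_deg0 k (L : lmodType S) (M N : nat -> L -> Prop) m (l : 'I_m -> L) :
  gmod digr (digr_id J) M N -> (forall s x, M s.+1 x -> N s.+1 x) ->
  (forall i, M 0%N (l i)) ->
  (forall x, M 0%N x -> exists a : 'I_m -> S,
      (forall i, hom 0 0 (a i)) /\ N 0%N (x - \sum_i a i *: l i)) ->
  res_good k -> DGood 0 k M N.
Proof.
move=> H MN Ml gen GK; have HM := gm_l H; have HN := gm_r H.
have C00 x : digr 0 0 x <-> hom 0 0 x by rewrite /digr subrr !mulr0.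
pose X (i : nat) s (x : L) := if s is 0%N then
   exists a : 'I_m -> S, [/\ forall j, hom 0 0 (a j), forall j : 'I_m, (i <= j)%N -> a j = 0 &
       N 0%N (x - \sum_j a j *: l j)] else M s x.
have XM i s x : X i s x -> M s x.
  case: s => //= -[a [Ha _ Nx]]; rewrite -[x](subrK (\sum_j a j *: l j)).
  apply: (gsD HM); first exact: (gm_sub H).
  by apply: (gs_sum HM) => j; apply: (gsZ HM) (Ml j); exact/C00.
have NX i s x : N s x -> X i s x.
  case: s => [Nx|s]; last exact: (gm_sub H).
  exists (fun _ => 0); split=> // [_|]; first exact: (hom0 HB).
  by rewrite big1 ?subr0 // => j _; rewrite scale0r.
have HX i : gsub digr (X i).
  split=> [s|[|s] x y|u [|s] a x Ca]; [exact/NX/(gs0 HN) | | exact: (gsB HM) | |].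
  - move=> /=[f [f1 f2 f3]] [g [g1 g2 g3]]; exists (fun j => f j - g j); split.
    + by move=> j; exact: (homB HB).
    + by move=> j ij; rewrite f2 ?g2 ?subr0.
    + have -> : \sum_j (f j - g j) *: l j = \sum_j f j *: l j - \sum_j g j *: l j.
        by rewrite -sumrB; apply: eq_bigr => j _; rewrite scalerBl.
      by rewrite subr_ACA; exact: (gsB HN).
  - case: (posnP u) => u0; last by rewrite (digr_neg u0 Ca) scale0r => _; exact/NX/(gs0 HN).
    subst u; move=> [f [f1 f2 f3]]; exists (fun j => a * f j); split.
    + by move=> j; rewrite -[0]addr0 ; apply: (homM HB) => //; exact/C00.
    + by move=> j ij; rewrite f2 ?mulr0.
    + have -> : \sum_j (a * f j) *: l j = a *: \sum_j f j *: l j.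
        by rewrite scaler_sumr; apply: eq_bigr => j _; rewrite scalerA.
      by rewrite -scalerBr; exact: (gsZ HN Ca).
  - by move=> /(XM i u); exact: (gsZ HM Ca).
have XS i s x : X i s x -> X i.+1 s x.
  case: s => //= -[a [a1 a2 a3]]; exists a; split=> // j ij; exact/a2/ltnW.
have X0N s x : X 0%N s x -> N s x.
  case: s => [[a [_ a2]]|s]; last exact: MN.
  by rewrite big1 ?subr0 // => j _; rewrite a2 ?scale0r.
have XbM s x : M s x -> X m s x.
  case: s => //= /gen[a [a1 a2]]; exists a; split=> // j; by rewrite leqNgt ltn_ord.
have step i : (i < m)%N -> Good digr (digr_id J) (Dle 0) k (X i.+1) (X i).
  move=> im; pose i0 := Ordinal im.
  have lX : X i.+1 0%N (l i0).
    exists (fun j => if j == i0 then 1 else 0); split=> [j|j ij|].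
    - by case: ifP => _; [exact: (hom1 HB) | exact: (hom0 HB)].
    - by case: eqP => // ji; rewrite ji ltnn in ij.
    - rewrite (bigD1 i0) //= eqxx scale1r big1 ?addr0 ?subrr; first exact: (gs0 HN).
      by move=> j /negPf->; rewrite scale0r.
  have Xdec x : X i.+1 0%N x -> exists2 a, hom 0 0 a & X i 0%N (x - a *: l i0).
    move=> [a [a1 a2 a3]]; exists (a i0) => //.
    exists (fun j => if j == i0 then 0 else a j); split=> [j|j ij|].
    - by case: ifP => _ //; exact: (hom0 HB).
    - case: eqP => // /eqP ji; apply: a2; rewrite ltn_neqAle ij andbT.
      by apply: contra ji => /eqP ji; apply/eqP/val_inj.
    - have -> // : x - a i0 *: l i0 - \sum_j (if j == i0 then 0 else a j) *: l j =
           x - \sum_j a j *: l j.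
      rewrite [in RHS](bigD1 i0) //= opprD addrA [in LHS](bigD1 i0) //= eqxx scale0r add0r.
      by congr (_ - _); apply: eq_bigr => j /negPf->.
  (* Each factor is zero or a copy of the residue field: when [l i0] is new, a coefficient sending
     it into the previous stage must be 0, being invertible otherwise. *)
  case: (classic (X i 0%N (l i0))) => [Xl|nXl].
    apply: Good_zero => -[|s] x // /Xdec[a Ha Xa].
    rewrite -[x](subrK (a *: l i0)); apply: (gsD (HX i)) => //.
    by apply: (gsZ (HX i)) Xl; exact/C00.
  apply: (@Good_iso _ _ _ _ _ _ _ _ _ _ _ _
     (fun s (a : S^o) x => if s is 0%N then X i 0%N (x - a *: l i0) else True)) GK => //.
  - exact: gr_gsub.
  - by move=> [|s] //; rewrite scale0r subrr; exact: (gs0 (HX i)).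
  - move=> [|s] x y x' y' //.
    have -> : x' - y' - (x - y) *: l i0 = (x' - x *: l i0) - (y' - y *: l i0).
      by rewrite scalerBl subr_ACA.
    exact: (gsB (HX i)).
  - move=> [|u] [|s] a x x' // Ca.
      by rewrite -scalerA -scalerBr; exact: (gsZ (HX i) Ca).
    by rewrite (digr_neg _ Ca) // !(scale0r, mul0r) subrr => _; exact: (gs0 (HX i)).
  - move=> [|s] a Ca; last by exists 0 => //; exact: (gs0 HM).
    exists (a *: l i0); first exact: (gsZ (HX i.+1) Ca lX).
    by rewrite subrr; exact: (gs0 (HX i)).
  - move=> [|s] x; last by move=> Mx; exists 0 => //; exact: (gr0 HC).
    by move=> /Xdec[a Ha Xa]; exists a => //; exact/C00.
  - move=> [|s] a x Ca Xx; last by split.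
    move=> Xa; split=> [[_ /(_ erefl) a0]|Xix].
      by move: Xa; rewrite a0 scale0r subr0.
    split=> // _; case: (hom_field HB (x := a)) => [|//|[y Hy ya]]; first exact/C00.
    case: nXl; rewrite -[l i0]scale1r -ya -scalerA; apply: (gsZ (HX i)) (_ : X i 0%N _); first exact/C00.
    by rewrite -[_ *: _](subKr x); exact: (gsB (HX i)).
have GX : Good digr (digr_id J) (Dle 0) k (X m) (X 0%N).
  apply: (Good_filtration HC HJd) => //.
  split=> // [s x /X0N|u s a x Ja /XM Mx]; first exact: NX.
  by apply: NX; exact: (gm_J H Ja Mx).
apply: Good_eq GX => // [s x|s x _]; first by split; [exact: XM | exact: XbM].
by split; [exact: X0N | exact: NX].
Qed.

(** The part in positive degrees has regularity at most [r + 1], and the quotient by it, living in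
    degree 0, is built from residue fields. *)
Lemma DGood_step k r (L : lmodType S) (M N : nat -> L -> Prop) m (l : 'I_m -> L) :
  gmod digr (digr_id J) M N ->
  (forall i, M 0%N (l i)) ->
  (forall x, M 0%N x -> exists a : 'I_m -> S,
      (forall i, hom 0 0 (a i)) /\ N 0%N (x - \sum_i a i *: l i)) ->
  res_good k -> DGood r k (fun s => M s.+1) (fun s => N s.+1) -> DGood r.+1 k M N.
Proof.
move=> H Ml gen GK GS; have HM := gm_l H; have HN := gm_r H.
pose M1 s x := if s is 0%N then N 0%N x else M s x.
have NM1 s x : N s x -> M1 s x by case: s => // s; exact: (gm_sub H).
have M1M s x : M1 s x -> M s x by case: s => //; exact: (gm_sub H).
have HM1 : gsub digr M1.
  split=> [s|[|s]|[|u] [|s] a x Ca].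
  - exact/NM1/(gs0 HN).
  - exact: (gsB HN).
  - exact: (gsB HM).
  - exact: (gsZ HN Ca).
  - by move=> /(gm_sub H); exact: (gsZ HM Ca).
  - by rewrite (digr_neg _ Ca) // scale0r => _; exact: (gs0 HN).
  - exact: (gsZ HM Ca).
apply: (Good_ext HC HJd H HM1 NM1 M1M); first exact: DGood_shift.
have H1 := gmod_quo H HM1 NM1 M1M.
by apply: (@DGood_mono 0 _ k) => //; exact: DGood_deg0 Ml gen GK.
Qed.

Lemma sl_fin Y a b : gid Y -> exists m (l : 'I_m -> S^o),
  (forall i, sl unit_id a b 0%N (l i)) /\
  forall x, sl unit_id a b 0%N x -> exists f : 'I_m -> S,
    (forall i, hom 0 0 (f i)) /\ sl Y a b 0%N (x - \sum_i f i *: l i).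
Proof.
move=> HY; have [m [l [Hl gen]]] := hom_fin HB a b.
have E x : sl unit_id a b 0%N x <-> hom a b x by rewrite /sl /unit_id /dia /= !mulr0 !addr0.
exists m, l; split=> [i|x /E/gen[f [f0 ->]]]; first exact/E.
by exists f; split=> //; rewrite subrr; exact: (gid0 HY).
Qed.

Lemma DGood_up k r Y a b : gmod bigr (bigr_id J) unit_id Y -> gid Y -> res_good k ->
  DGood r k (sl unit_id (a + c%:Z) (b + e%:Z)) (sl Y (a + c%:Z) (b + e%:Z)) ->
  DGood r.+1 k (sl unit_id a b) (sl Y a b).
Proof.
move=> H HY GK GS; have [m [l [Hl gen]]] := sl_fin a b HY.
apply: (DGood_step (sl_gmod a b H) Hl gen GK).
apply: Good_eq GS; first exact/sl_gsub/unit_gid.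
  by move=> s x; apply: iff_sym; exact: slS.
by move=> s x _; apply: iff_sym; exact: slS.
Qed.

(** Converts shifts into regularity: the bound is the number of diagonal steps (c, e) that bring (a,
    b) into the nonnegative quadrant. *)
Lemma DGood_up_iter k r Y a b : gmod bigr (bigr_id J) unit_id Y -> gid Y -> res_good k ->
  (forall a b : int, 0 <= a -> 0 <= b -> DGood 0 k (sl unit_id a b) (sl Y a b)) ->
  0 <= a + c%:Z * r%:Z -> 0 <= b + e%:Z * r%:Z ->
  DGood r k (sl unit_id a b) (sl Y a b).
Proof.
move=> H HY GK G0; elim: r a b => [|r IH] a b ha hb.
  by apply: G0; [move: ha | move: hb]; rewrite mulr0 addr0.
apply: DGood_up => //; apply: IH.
  by move: ha; rewrite -addn1 PoszD; congr (_ <= _); ring.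
by move: hb; rewrite -addn1 PoszD; congr (_ <= _); ring.
Qed.

(** What remains in degrees 0 and 1 is built from residue fields. The two alternatives are the ones
    that occur for the module (m : g)/m: it is all of S/m, or zero. *)
Lemma DGood_vanish1 k X Y a b : gmod bigr (bigr_id J) X Y -> gid X -> gid Y -> res_good k ->
  ((forall s x, X s x <-> unit_id s x) \/ (forall s x, X s x -> Y s x)) ->
  (forall s x, (2 <= s)%N -> sl X a b s x -> sl Y a b s x) ->
  DGood 1 k (sl X a b) (sl Y a b).
Proof.
move=> H HX HY GK [XU|XY] V2; last by apply: Good_zero => s x; exact: XY.
have HU : gmod bigr (bigr_id J) unit_id Y.
  split; [exact/gid_gsub/unit_gid | exact: gm_r H | by move=> s x /(gm_sub H)/XU |].
  by move=> u s w x Jw Ux; apply: (gm_J H Jw); exact/XU.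
suff GU : DGood 1 k (sl unit_id a b) (sl Y a b).
  apply: Good_eq GU; first exact/sl_gsub/unit_gid.
    by move=> s x; apply: iff_sym; exact: XU.
  by [].
apply: DGood_up => //; have [m [l [Hl gen]]] := sl_fin (a + c%:Z) (b + e%:Z) HY.
apply: (DGood_deg0 (sl_gmod _ _ HU)) Hl gen GK => s x Ux.
apply: (slS Y a b s.+1 x).1; apply: V2 => //; apply/XU.
exact: (slS unit_id a b s.+1 x).2.
Qed.

(** The irrelevant ideal is the diagonal shifted by (c, e), placed in degree 1; it is the first
    syzygy module of the residue field. *)
Lemma res_goodS k : DGood 0 k (sl unit_id c%:Z e%:Z) (sl J c%:Z e%:Z) -> res_good k.+1.
Proof.
move=> G1.
have J0 x : digr_id J 0 0 x -> x = 0 by rewrite /digr_id subrr !mulr0; exact: J00.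
have JC s x : digr_id J 0 s x -> digr 0 s x by exact: (gi_sub HJd).
apply: (@DGood_quo _ _ _ _ _ (digr_id J 0 : nat -> S^o -> Prop)).
- exact: gr_gmod.
- exact: resN_gsub.
- by move=> s x Jx; split; [exact: JC | move=> s0; apply: J0; rewrite -[X in digr_id J 0 X]s0].
- by move=> s x [].
- exact: Good_regular.
- apply: DGood_shift; first exact: gi_gsub.
    by move=> x [_ ->] //; exact: (gi0 HJd).
  apply: Good_eq G1; first exact/sl_gsub/unit_gid.
    move=> s x; split.
      by move=> Ux; split=> //; move: Ux; apply: hom_cast; rewrite /dia /= -[in RHS]addn1 PoszD; ring.
    by case=> Ux _; move: Ux; apply: hom_cast; rewrite /dia /= -[in LHS]addn1 PoszD; ring.
  move=> s x _; rewrite /sl /digr_id; split; apply: gid_cast => /=.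
  + by rewrite -[in RHS]addn1 PoszD; ring.
  + by rewrite -[in RHS]addn1 PoszD; ring.
  + by rewrite -[in LHS]addn1 PoszD; ring.
  + by rewrite -[in LHS]addn1 PoszD; ring.
Qed.

Lemma DGood_free k : DGood 0 k (sl unit_id 0 0) (sl J 0 0).
Proof.
have GF : DGood 0 k (digr 0 : nat -> S^o -> Prop) (digr_id J 0) by exact: Good_regular.
apply: Good_eq GF; first exact: gr_gsub.
  by move=> s x; split; apply: hom_cast; rewrite /dia /=; ring.
by move=> s x _; split; apply: gid_cast; rewrite /dia /=; ring.
Qed.

End OverDiagonal.

Lemma DGood_change_ring J J' r k (L : lmodType S) (M N : nat -> L -> Prop) :
  gid J -> gid J' -> (forall s x, J s x -> J' s x) ->
  DGood J 2 k (sl J' 0 0) (sl J 0 0) ->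
  gmod digr (digr_id J') M N -> DGood J r k M N -> DGood J' r k M N.
Proof.
move=> HJ HJ' JJ G2; have HJd := digr_gideal HJ; have HJd' := digr_gideal HJ'.
apply: (Good_change_ring digr_grading HJd HJd') => [u s x|i u Du]; first exact: JJ.
suff GU : DGood J u.+2 k (digr_id J' u : nat -> S^o -> Prop) (digr_id J u).
  by apply: Good_mono GU => // j v; rewrite /Dle in Du *; lia.
elim: u {Du} => [|u IH].
  apply: Good_eq G2; first exact: sl_gsub.
    by move=> s x; rewrite /sl /digr_id /dia !add0r subr0.
  by move=> s x _; rewrite /sl /digr_id /dia !add0r subr0.
have E X s x : digr_id X u.+1 s.+1 x <-> digr_id X u s x.
  by rewrite /digr_id (_ : s.+1%:Z - u.+1%:Z = s%:Z - u%:Z) //; lia.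
apply: (DGood_shift HJ).
- exact: (gi_gsub HJd).
- by move=> x /(gi_sub HJd')/digr_neg->//; exact: (gi0 HJd).
- apply: Good_eq IH; first exact: (gi_gsub HJd').
    by move=> s x; apply: iff_sym; exact: E.
  by move=> s x _; apply: iff_sym; exact: E.
Qed.

Lemma unit_gmod J Y : gid Y -> (forall s x, J s x -> Y s x) -> gmod bigr (bigr_id J) unit_id Y.
Proof.
move=> HY JY; apply: gid_gmod => //; first exact: unit_gid.
  by move=> s x; exact: (gid_sub HY).
move=> s t x z /JY Yx Hz; rewrite mulrC; exact: (gidM HY Hz Yx).
Qed.

Lemma sub_gmod J X Y : gid X -> gid Y -> (forall s x, Y s x -> X s x) ->
  (forall s x, J s x -> Y s x) -> gmod bigr (bigr_id J) X Y.
Proof.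
move=> HX HY YX JY; apply: gid_gmod => // s t x z /JY Yx /(gid_sub HX) Hz.
by rewrite mulrC; exact: (gidM HY Hz Yx).
Qed.

(** * Koszul resolutions of ideals generated by regular sequences *)

Section RegularSequence.
Variables (gam : int * int) (m : nat) (Nf : nat -> int * int -> S^o -> Prop) (y : nat -> S).
Hypotheses (HN : forall j, gid (Nf j)) (Hy : forall j, hom gam.1 gam.2 (y j)).
Hypothesis Nstep : forall j (s : int * int) x, (j < m)%N -> Nf j.+1 s x <->
  exists a z, [/\ Nf j s a, hom (s.1 - gam.1) (s.2 - gam.2) z & x = a + y j * z].
Hypothesis Nreg : forall j (s : int * int) z, (j < m)%N -> hom (s.1 - gam.1) (s.2 - gam.2) z ->
  Nf j s (y j * z) -> Nf j (s.1 - gam.1, s.2 - gam.2) z.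

(** All members of the sequence have degree [gam], so each Koszul module is generated in a single
    degree; [t] is 0 for the quotient by the ideal and 1 for the ideal itself. *)
Definition Dlin (t i : nat) (u : int * int) : Prop :=
  u = (gam.1 * (i + t)%:Z, gam.2 * (i + t)%:Z).

Let J := Nf 0%N.
Let HC := bigr_grading.
Let HJb := bigr_gideal (HN 0%N).

Lemma regseq_sub0 j s x : (j <= m)%N -> J s x -> Nf j s x.
Proof.
elim: j => // j IH jm /(IH (ltnW jm)) Nx; apply/(Nstep _ _ jm); exists x, 0.
by split; rewrite ?mulr0 ?addr0 //; exact: hom0.
Qed.

Lemma regseq_subS j s x : (j < m)%N -> Nf j s x -> Nf j.+1 s x.
Proof.
move=> jm Nx; apply/(Nstep _ _ jm); exists x, 0.
by split; rewrite ?mulr0 ?addr0 //; exact: hom0.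
Qed.

(** The Koszul complex is not written down. [Nf j.+1 / Nf j] is [S / Nf j] shifted by [gam], so the
    ideals are iterated extensions of such quotients, and each quotient takes its syzygies from the
    ideal with one step fewer. *)
Lemma regseq_good k j : (j <= m)%N ->
  Good bigr (bigr_id J) (Dlin 0) k unit_id (Nf j) /\
  Good bigr (bigr_id J) (Dlin 1) k (Nf j) J.
Proof.
elim: k j => // k IH.
have A j : (j <= m)%N -> Good bigr (bigr_id J) (Dlin 0) k.+1 unit_id (Nf j).
  move=> jm.
  have GU : Good bigr (bigr_id J) (Dlin 0) k.+1 unit_id J.
    have D0 : Dlin 0 0 (0, 0) by rewrite /Dlin addn0 !mulr0.
    have := Good_regular k.+1 HC HJb D0.
    apply: Good_eq; first exact: gr_gsub.
      by move=> s x; rewrite /bigr /unit_id !subr0.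
    by move=> s x _; rewrite /bigr_id !subr0; case: s.
  have HU : gmod bigr (bigr_id J) unit_id J by exact: unit_gmod (HN 0%N) _.
  apply: (Good_quo HC HJb HU _ _ _ GU).
  - exact: gid_gsub.
  - by move=> s x; exact: regseq_sub0.
  - by move=> s x /(gid_sub (HN j)).
  - have [_] := IH j jm; apply: Good_mono => // i u ->; rewrite /Dlin.
    by rewrite addn1 addn0.
move=> j jm; split; first exact: A.
elim: j jm => [|j IHj] jm; first exact: Good_zero.
apply: (@Good_ext _ _ _ HC _ HJb _ _ _ _ (Nf j)).
- by apply: (sub_gmod (HN _) (HN 0%N)) => // s x; exact: regseq_sub0.
- exact: gid_gsub.
- by move=> s x; apply: regseq_sub0; exact: ltnW.
- by move=> s x; exact: regseq_subS.
- exact/IHj/ltnW.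
pose sh (s : int * int) := (s.1 - gam.1, s.2 - gam.2).
pose tau (s : int * int) := (s.1 + gam.1, s.2 + gam.2).
have GS : Good bigr (bigr_id J) (Dlin 1) k.+1 (fun s => unit_id (sh s)) (fun s => Nf j (sh s)).
  apply: (@Good_shift _ _ _ HC tau _ (Dlin 0)) => //.
  - by move=> u s x; rewrite /bigr; split; apply: hom_cast; rewrite /tau /=; ring.
  - by move=> u s x; rewrite /bigr_id; split; apply: gid_cast; rewrite /tau /=; ring.
  - by move=> s; left; exists (sh s); case: s => s1 s2; rewrite /tau /=; congr pair; ring.
  - by move=> s; left; exists (sh s); case: s => s1 s2; rewrite /tau /=; congr pair; ring.
  - by move=> i u ->; rewrite /tau /Dlin /=; congr pair; rewrite addn0 PoszD; ring.
  - split=> [s|s a b|u s a x Ha]; [exact: (gid0 (HN j)) | exact: (gidB (HN j)) |].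
    move=> Nx; have := gidM (HN j) Ha Nx; apply: gid_cast => /=; ring.
  - have := A j (ltnW jm); apply: Good_eq; first exact/gid_gsub/unit_gid.
      by move=> s x; split; apply: hom_cast; rewrite /sh /tau /=; ring.
    by move=> s x _; split; apply: gid_cast; rewrite /sh /tau /=; ring.
apply: (@Good_iso _ _ _ _ _ _ _ _ _ _ _ _ (fun s (z x : S^o) => Nf j s (y j * z - x))) GS => //.
- split=> [s|s a b|u s a x Ha]; [exact: hom0 | exact: homB |].
  by move=> Hx; have := homM HB Ha Hx; apply: hom_cast; rewrite /sh /=; ring.
- exact: gid_gsub.
- by move=> s; rewrite mulr0 subrr; exact: (gid0 (HN j)).
- by move=> s a b a' b' Na Nb; rewrite mulrBr subr_ACA; exact: (gidB (HN j)).
- move=> u s a z x Ca Nz; have := gidM (HN j) Ca Nz.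
  have -> : y j * (a *: z) - a *: x = a * (y j * z - x).
    by rewrite mulrBr mulrCA.
  by apply: gid_cast => /=; ring.
- move=> s z Hz; exists (y j * z); last by rewrite subrr; exact: (gid0 (HN j)).
  by apply/(Nstep _ _ jm); exists 0, z; rewrite add0r; split=> //; exact: (gid0 (HN j)).
- move=> s x /(Nstep _ _ jm)[a [z [Na Hz ->]]]; exists z => //.
  by rewrite opprD addrCA subrr addr0; exact: (gidN (HN j)).
- move=> s z x Hz Nx Nzx; split=> [Nz|{}Nx].
    rewrite -[x](subKr (y j * z)); apply: (gidB (HN j)) => //.
    have := gidM (HN j) (Hy j) Nz; apply: gid_cast => /=; ring.
  apply: Nreg => //; rewrite -[y j * z](subrK x); exact: (gidD (HN j)).
Qed.

Section Hypersurface.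
Variables (del : int * int) (g : S).
Hypotheses (Hg : hom del.1 del.2 g).
Hypothesis greg : forall (s : int * int) z, hom (s.1 - del.1) (s.2 - del.2) z -> J s (g * z) ->
  J (s.1 - del.1, s.2 - del.2) z.

Definition pdel (s : int * int) := (s.1 - del.1, s.2 - del.2).
Definition Wg : int * int -> S^o -> Prop := add_mul pdel g J unit_id.
Definition Vg : int * int -> S^o -> Prop := add_mul pdel g J (Nf m).
Definition colon (s : int * int) (z : S^o) := hom s.1 s.2 z /\ Nf m (s.1 + del.1, s.2 + del.2) (g * z).

Lemma add_mul_gid X Y : gid X -> gid Y -> gid (add_mul pdel g X Y).
Proof.
move=> HX HY; split.
- move=> s x [a [b [Xa Yb ->]]]; apply: (gidD unit_gid (s := s)); first exact: (gid_sub HX).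
  have := homM HB Hg (gid_sub HY Yb); rewrite /unit_id (_ : g *: b = g * b) //.
  by apply: hom_cast => /=; ring.
- by move=> s; exists 0, 0; split; [exact: gid0 | exact: gid0 | rewrite scaler0 addr0].
- move=> s x x' [a [b [Xa Yb ->]]] [a' [b' [Xa' Yb' ->]]]; exists (a - a'), (b - b').
  by split; [exact: gidB | exact: gidB | rewrite scalerBr opprD addrACA].
- move=> i j s x z Hz [a [b [Xa Yb ->]]]; exists (z * a), (z * b); split.
  + exact: (gidM HX Hz Xa).
  + have := gidM HY Hz Yb; apply: gid_cast => /=; ring.
  + by rewrite mulrDr mulrCA.
Qed.

Lemma Wg_gid : gid Wg.
Proof. exact: add_mul_gid (HN 0%N) unit_gid. Qed.

Lemma Vg_gid : gid Vg.
Proof. exact: add_mul_gid (HN 0%N) (HN m). Qed.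

Lemma colon_gid : gid colon.
Proof.
split.
- by move=> s x [].
- by move=> s; split; [exact: hom0 | rewrite mulr0; exact: (gid0 (HN m))].
- move=> s x z [Hx Nx] [Hz Nz]; split; first exact: homB.
  by rewrite mulrBr; exact: (gidB (HN m)).
- move=> a b s x z Hz [Hx Nx]; split; first by exact: (gidM unit_gid Hz Hx).
  by rewrite mulrCA; have := gidM (HN m) Hz Nx; apply: gid_cast => /=; ring.
Qed.

Lemma bigr_pdel u s x : bigr (pdel u) (pdel s) x <-> bigr u s x.
Proof. by rewrite /bigr; split; apply: hom_cast; rewrite /pdel /=; ring. Qed.

Lemma bigr_gen s : bigr (pdel s) s g.
Proof. by move: Hg; rewrite /bigr; apply: hom_cast; rewrite /pdel /=; ring. Qed.

Lemma hypersurface_bigraded k :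
  Good bigr (add_gen bigr pdel g (bigr_id J)) (Dlin 1) k (Nf m) Vg.
Proof.
have [_ G1] := regseq_good k (leqnn m).
apply: Good_reduce G1 => //.
- exact: bigr_pdel.
- exact: bigr_gen.
- move=> u s x Cx Jx; pose t := (s.1 - u.1, s.2 - u.2).
  have Hx : hom (t.1 - del.1) (t.2 - del.2) x by move: Cx; apply: hom_cast; rewrite /t /=; ring.
  by have := greg Hx Jx; apply: gid_cast; rewrite /t /=; ring.
- by apply: (sub_gmod (HN _) (HN 0%N)) => // s x; exact: regseq_sub0.
- move=> s x Nx; apply: greg; exact: (gid_sub (HN m) Nx).
Qed.

Lemma add_gen_Wg u s x :
  add_gen bigr pdel g (bigr_id J) u s x <-> Wg (s.1 - u.1, s.2 - u.2) x.
Proof.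
split=> -[v [z [Jv Hz ->]]]; exists v, z; split=> //; move: Hz;
  by rewrite /bigr /unit_id; apply: hom_cast; rewrite /pdel /=; ring.
Qed.

(* Write m for the ideal [Nf m].  The Koszul complex resolves m, hence m/gm, by shifts of S/g;
   between m/gm and S/g lies gS/gm, that is, a shift of (m : g)/m. *)
Lemma hypersurface_diagonal J0 k a b :
  gid J0 -> (forall s x, J0 s x -> Wg s x) ->
  (forall s x, sl unit_id a b s x -> sl (Nf m) a b s x) ->
  (forall i, (i <= k)%N ->
     DGood J0 i (k.+1 - i) (sl unit_id (a - gam.1 * i.+1%:Z) (b - gam.2 * i.+1%:Z))
       (sl Wg (a - gam.1 * i.+1%:Z) (b - gam.2 * i.+1%:Z))) ->
  DGood J0 1 k (sl colon (a - del.1) (b - del.2)) (sl (Nf m) (a - del.1) (b - del.2)) ->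
  DGood J0 0 k.+1 (sl unit_id a b) (sl Wg a b).
Proof.
move=> HJ0 JW cover HF Gc.
have VW s x : Vg s x -> Wg s x.
  by move=> [v [z [Jv Nz ->]]]; exists v, z; split=> //; exact: (gid_sub (HN m)).
have VN s x : Vg s x -> Nf m s x.
  move=> [v [z [Jv Nz ->]]]; apply: (gidD (HN m)); first exact: regseq_sub0.
  have := gidM (HN m) Hg Nz; rewrite (_ : g *: z = g * z) //; apply: gid_cast => /=; ring.
have HJa : gideal bigr (add_gen bigr pdel g (bigr_id J)).
  by apply: add_gen_gideal => //; [exact: bigr_pdel | exact: bigr_gen].
have HNJ : gmod bigr (bigr_id J) (Nf m) J.
  by apply: (sub_gmod (HN _) (HN 0%N)) => // s x; exact: regseq_sub0.
have HNV : gmod bigr (add_gen bigr pdel g (bigr_id J)) (Nf m) Vg.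
  have [H1 H2 H3 H4] : gmod bigr (add_gen bigr pdel g (bigr_id J)) (Nf m) (add_mul pdel g J (Nf m)).
    by apply: add_gen_gmod => //; [exact: bigr_pdel | exact: bigr_gen].
  by split.
have JJ u s x : digr_id J0 u s x ->
    add_gen bigr pdel g (bigr_id J) (dia a b u) (dia a b s) x.
  by move=> /JW Wx; apply/add_gen_Wg; rewrite dia_sub.
(* Slices of the reduced Koszul complex: its free module in step [i] consists of copies of S/(J + g)
   shifted by [-(i + 1) gam], which [HF] resolves. *)
have GV : DGood J0 0 k.+1 (sl (Nf m) a b) (sl Vg a b).
  apply: (@Good_slice _ _ _ _ _ (dia a b) bigr_grading digr_grading (@digr_bigr a b)
    _ _ HJa (digr_gideal HJ0) JJ _ _ _ _ _ _ HNV) (hypersurface_bigraded k.+1).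
  move=> i u ik Du.
  have DD j v : Dle i j v -> Dle 0 (j + i) v by rewrite /Dle add0n addnC.
  have := Good_mono DD (leqnn _) (HF i ik); apply: Good_eq; first exact/sl_gsub/unit_gid.
    move=> s x; rewrite /sl /unit_id /bigr Du; split; apply: hom_cast;
      by rewrite /dia /= addn1; ring.
  move=> s x _; apply: iff_sym; apply: iff_trans (add_gen_Wg _ _ _) _; rewrite Du.
  by split; apply: gid_cast; rewrite /dia /= addn1; ring.
(* Modulo [Vg], this intersection is (m : g)/m shifted by [del], as multiplication by [g] shows.
   Dividing it out leaves the image of m in S/g, and in the degrees considered m is everything. *)
pose X s x := Wg s x /\ Nf m s x.
have HX : gid X.
  split=> [s x [_]|s|s x z [W1 N1] [W2 N2]|i j s x z Hz [W1 N1]].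
  - exact: (gid_sub (HN m)).
  - by split; [exact: (gid0 Wg_gid) | exact: (gid0 (HN m))].
  - by split; [exact: (gidB Wg_gid) | exact: (gidB (HN m))].
  - by split; [exact: (gidM Wg_gid Hz) | exact: (gidM (HN m) Hz)].
have H0V : gmod bigr (bigr_id J0) (Nf m) Vg.
  apply: gid_gmod => //; first exact: Vg_gid.
  move=> s t x z /JW[v [w [Jv Hw ->]]] Nz; exists (z * v), (w * z); split.
  - by have := gidM (HN 0%N) (gid_sub (HN m) Nz) Jv.
  - by have := gidM (HN m) Hw Nz; apply: gid_cast; rewrite /pdel /=; ring.
  - by rewrite mulrDl [v * z]mulrC -mulrA.
have GX : DGood J0 0 k.+1 (sl (Nf m) a b) (sl X a b).
  apply: (DGood_quo HJ0 (sl_gmod a b H0V) _ _ _ GV).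
  - exact: sl_gsub.
  - by move=> s x Vx; split; [exact: VW | exact: VN].
  - by move=> s x [].
  apply: (@Good_iso _ _ _ _ _ _ _ _ _ _ _ _ (fun s (z x : S^o) => sl Vg a b s (g * z - x))) Gc.
  - exact/sl_gsub/colon_gid.
  - exact: sl_gsub.
  - by move=> s; rewrite mulr0 subrr; exact: (gid0 Vg_gid).
  - by move=> s v w v' w' Na Nb; rewrite mulrBr subr_ACA; exact: (gidB Vg_gid).
  - move=> u s v z x Cv Vz; have := gsZ (sl_gsub a b Vg_gid) Cv Vz.
    by rewrite scalerBr; congr (sl Vg a b s (_ - _)); exact: mulrCA.
  - move=> s z [Hz Nz]; exists (g * z); last by rewrite subrr; exact: (gid0 Vg_gid).
    split; last by move: Nz; apply: gid_cast; rewrite /dia /=; ring.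
    exists 0, z; split; [exact: (gid0 (HN 0%N)) | | by rewrite add0r].
    by move: Hz; apply: hom_cast; rewrite /pdel /dia /=; ring.
  - move=> s x [[v [z [Jv Hz ex]]] Nx]; exists z; last first.
      exists (- v), 0; split; [exact: (gidN (HN 0%N)) | exact: (gid0 (HN m)) |].
      by rewrite ex scaler0 addr0 opprD addrCA subrr addr0.
    split; first by move: Hz; apply: hom_cast; rewrite /pdel /dia /=; ring.
    have -> : g * z = x - v by rewrite ex addrC addKr.
    have := gidB (HN m) Nx (regseq_sub0 (leqnn m) Jv).
    by apply: gid_cast; rewrite /dia /=; ring.
  - move=> s z x [Hz _] [_ Nx] Vzx; split=> [Nz|Vx].
      rewrite -[x](subKr (g * z)); apply: (gidB Vg_gid) => //.
      exists 0, z; split; [exact: (gid0 (HN 0%N)) | | by rewrite add0r].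
      by move: Nz; apply: gid_cast; rewrite /pdel /dia /=; ring.
    have : sl Vg a b s (g * z) by rewrite -[g * z](subrK x); exact: (gidD Vg_gid).
    case=> v [w [Jv Nw egz]].
    have Hzw : hom ((dia a b s).1 - del.1) ((dia a b s).2 - del.2) (z - w).
      apply: (homB HB); first by move: Hz; apply: hom_cast; rewrite /dia /=; ring.
      exact: (gid_sub (HN m) Nw).
    have Jzw : J (dia a b s) (g * (z - w)).
      by rewrite mulrBr egz (_ : g *: w = g * w) // addrK.
    have := greg Hzw Jzw => /(regseq_sub0 (leqnn m)) Nzw.
    rewrite -[z](subrK w); apply: (gidD (HN m)).
      by move: Nzw; apply: gid_cast; rewrite /dia /=; ring.
    by move: Nw; apply: gid_cast; rewrite /pdel /dia /=; ring.
apply: Good_eq GX; first exact: sl_gsub.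
  move=> s x; split; last exact: cover.
  exact: (gid_sub (HN m)).
by move=> s x Nx; split=> [[]|].
Qed.

End Hypersurface.
End RegularSequence.

(** The recursion is chosen so that [Nstep] of the preceding section holds by definition. *)
Fixpoint seqid (gam : int * int) (y : nat -> S) (Y : int * int -> S^o -> Prop) (j : nat)
    (s : int * int) (x : S^o) : Prop :=
  if j is j'.+1 then exists a z,
    [/\ seqid gam y Y j' s a, hom (s.1 - gam.1) (s.2 - gam.2) z & x = a + y j' * z]
  else Y s x.

Lemma seqid_gid gam y Y j : (forall j, hom gam.1 gam.2 (y j)) -> gid Y -> gid (seqid gam y Y j).
Proof.
move=> Hy HY; elim: j => // j IH; split.
- move=> s x [a [z [Na Hz ->]]]; apply: (gidD unit_gid (s := s)); first exact: (gid_sub IH).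
  by have := homM HB (Hy j) Hz; apply: hom_cast => /=; ring.
- move=> s; exists 0, 0; rewrite mulr0 addr0.
  by split=> //; [exact: (gid0 IH) | exact: (hom0 HB)].
- move=> s x x' [a [z [Na Hz ->]]] [a' [z' [Na' Hz' ->]]]; exists (a - a'), (z - z').
  by split; [exact: (gidB IH) | exact: (homB HB) | rewrite mulrBr opprD addrACA].
- move=> i l s x w Hw [a [z [Na Hz ->]]]; exists (w * a), (w * z); split.
  + exact: (gidM IH Hw Na).
  + by have := homM HB Hw Hz; apply: hom_cast => /=; ring.
  + by rewrite mulrDr mulrCA.
Qed.

Definition reg_seq_mod gam y Y m := forall j (s : int * int) z, (j < m)%N ->
  hom (s.1 - gam.1) (s.2 - gam.2) z -> seqid gam y Y j s (y j * z) ->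
  seqid gam y Y j (s.1 - gam.1, s.2 - gam.2) z.

(** * Nonnegative shifts of the diagonal of a hypersurface *)

Section HypersurfaceInduction.
Variables (J0 Y : int * int -> S^o -> Prop) (del : int * int) (g : S).
Variables (yx yt : nat -> S) (mx mt : nat).
Let W := Wg (fun _ => Y) del g.
Let Nx := seqid (1, 0) yx Y.
Let Nt := seqid (0, 1) yt Y.
Hypotheses (HJ0 : gid J0) (HY : gid Y) (Hg : hom del.1 del.2 g) (JW : forall s x, J0 s x -> W s x).
Hypotheses (Hyx : forall j, hom 1 0 (yx j)) (Hyt : forall j, hom 0 1 (yt j)).
Hypotheses (regx : reg_seq_mod (1, 0) yx Y mx) (regt : reg_seq_mod (0, 1) yt Y mt).
Hypothesis greg : forall (s : int * int) z, hom (s.1 - del.1) (s.2 - del.2) z -> Y s (g * z) ->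
  Y (s.1 - del.1, s.2 - del.2) z.
Hypothesis coverx : forall (s : int * int) x, 0 < s.1 -> unit_id s x -> Nx mx s x.
Hypothesis covert : forall (s : int * int) x, 0 < s.2 -> unit_id s x -> Nt mt s x.
Let colx := colon mx Nx del g.
Let colt := colon mt Nt del g.
Hypothesis colonx :
  (forall s x, colx s x <-> unit_id s x) \/ (forall s x, colx s x -> Nx mx s x).
Hypothesis colont :
  (forall s x, colt s x <-> unit_id s x) \/ (forall s x, colt s x -> Nt mt s x).
Hypotheses (delc : del.1 <= 2 * c%:Z) (dele : del.2 <= 2 * e%:Z).

(** Induction on a + b, with the x's if a > 0 and the t's otherwise, so that the chosen ideal m is
    everything in the degrees concerned. After the shift by [-del], m is again everything from
    degree 2 of the diagonal on, by [delc] or [dele]; hence (m : g)/m has regularity at most 1. *)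
Lemma hypersurface_step k :
  (forall a b : int, 0 <= a -> 0 <= b -> DGood J0 0 k (sl unit_id a b) (sl W a b)) ->
  res_good J0 k -> DGood J0 0 k.+1 (sl unit_id 0 0) (sl W 0 0) ->
  forall a b : int, 0 <= a -> 0 <= b -> DGood J0 0 k.+1 (sl unit_id a b) (sl W a b).
Proof.
move=> IH GK G00.
have HW : gid W by exact: Wg_gid.
have HU : gmod bigr (bigr_id J0) unit_id W by exact: unit_gmod.
have HNx : gid (Nx mx) by exact: seqid_gid.
have HNt : gid (Nt mt) by exact: seqid_gid.
have JY s x : J0 s x -> exists v z, [/\ Y s v, hom (s.1 - del.1) (s.2 - del.2) z & x = v + g * z].
  by move=> /JW[v [z [Yv Hz ->]]]; exists v, z.
have YN gam y m s x : seqid gam y Y 0 s x -> seqid gam y Y m s x.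
  move=> Yx; elim: m => // m IHm; exists x, 0; rewrite mulr0 addr0; split=> //; exact: hom0 HB _ _.
have colG gam y m : (forall j, hom gam.1 gam.2 (y j)) ->
    gmod bigr (bigr_id J0) (colon m (seqid gam y Y) del g) (seqid gam y Y m).
  move=> Hy; have HN j := seqid_gid j Hy HY.
  apply: gid_gmod => //.
  - exact: colon_gid.
  - move=> s x Nx'; split; first exact: (gid_sub (HN m)).
    by have := gidM (HN m) Hg Nx'; apply: gid_cast => /=; ring.
  - move=> s t x z /JY[v [w [Yv Hw ->]]] [Hz Nz]; rewrite mulrDl; apply: (gidD (HN m)).
      have := gidM (HN m) Hz (YN gam y m _ _ Yv); rewrite mulrC; exact.
    have := gidM (HN m) Hw Nz; rewrite mulrCA mulrA; apply: gid_cast => /=; ring.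
suff H : forall n (a b : nat), (a + b <= n)%N -> DGood J0 0 k.+1 (sl unit_id a%:Z b%:Z) (sl W a%:Z b%:Z).
  by case=> // a [] // b _ _; exact: (H (a + b)%N).
elim=> [|n IHn] a b abn; first by have [-> ->] : a = 0%N /\ b = 0%N by lia.
case: (posnP a) => [a0|a0]; [case: (posnP b) => [b0|b0]; first by rewrite a0 b0|].
- refine (@hypersurface_diagonal (0, 1) mt Nt yt (fun j => seqid_gid (gam := (0, 1)) j Hyt HY) Hyt _ regt del g Hg greg J0 k a%:Z b%:Z HJ0 JW _ _ _).
  + by [].
  + by move=> s x; apply: covert; rewrite /dia /=; lia.
  (* The first Koszul module is the shift with [b - 1], available in full length by the induction on
     a + b. The later ones ask for at most [k] steps, and their shift becomes nonnegative after
     [i + 1] diagonal steps because c and e are positive. *)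
  + case=> [_|i ik].
      have := IHn a b.-1 ltac:(lia); apply: Good_eq; first exact/sl_gsub/unit_gid.
        by move=> s x; split; apply: hom_cast; rewrite /dia /=; lia.
      by move=> s x _; split; apply: gid_cast; rewrite /dia /=; lia.
    apply: (@DGood_mono _ i.+1 _ k) => //; first by rewrite subSS leq_subr.
    have ci : (i.+1 <= c * i.+1)%N by rewrite leq_pmull.
    have ei : (i.+1 <= e * i.+1)%N by rewrite leq_pmull.
    by apply: DGood_up_iter => //=; rewrite -PoszM; lia.
  + apply: DGood_vanish1 => //.
    * exact: colG.
    * by apply: colon_gid => // j; exact: seqid_gid.
    * move=> s x s2 [Hx _]; apply: covert => //; rewrite /dia /=; nia.
- refine (@hypersurface_diagonal (1, 0) mx Nx yx (fun j => seqid_gid (gam := (1, 0)) j Hyx HY) Hyx _ regx del g Hg greg J0 k a%:Z b%:Z HJ0 JW _ _ _).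
  + by [].
  + by move=> s x; apply: coverx; rewrite /dia /=; lia.
  + case=> [_|i ik].
      have := IHn a.-1 b ltac:(lia); apply: Good_eq; first exact/sl_gsub/unit_gid.
        by move=> s x; split; apply: hom_cast; rewrite /dia /=; lia.
      by move=> s x _; split; apply: gid_cast; rewrite /dia /=; lia.
    apply: (@DGood_mono _ i.+1 _ k) => //; first by rewrite subSS leq_subr.
    have ci : (i.+1 <= c * i.+1)%N by rewrite leq_pmull.
    have ei : (i.+1 <= e * i.+1)%N by rewrite leq_pmull.
    by apply: DGood_up_iter => //=; rewrite -PoszM; lia.
  + apply: DGood_vanish1 => //.
    * exact: colG.
    * by apply: colon_gid => // j; exact: seqid_gid.
    * move=> s x s2 [Hx _]; apply: coverx => //; rewrite /dia /=; nia.
Qed.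

End HypersurfaceInduction.

(** Multiplication by [h] identifies [S / Z], shifted by [-del], with [X / Y]. *)
Lemma DGood_mul J r k X Y Z (del : int * int) (h : S) a b :
  gid X -> gid Y -> gid Z -> hom del.1 del.2 h ->
  (forall s z, unit_id s z -> X (s.1 + del.1, s.2 + del.2) (h * z)) ->
  (forall s x, sl X a b s x -> exists2 z, sl unit_id (a - del.1) (b - del.2) s z &
      sl Y a b s (h * z - x)) ->
  (forall s z, unit_id s z -> Z s z <-> Y (s.1 + del.1, s.2 + del.2) (h * z)) ->
  (forall s x, Y s x -> X s x) ->
  DGood J r k (sl unit_id (a - del.1) (b - del.2)) (sl Z (a - del.1) (b - del.2)) ->
  DGood J r k (sl X a b) (sl Y a b).
Proof.
move=> HX HY HZ Hh hX sur ZY YX.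
have E (T : int * int -> S^o -> Prop) s x :
    T ((dia (a - del.1) (b - del.2) s).1 + del.1, (dia (a - del.1) (b - del.2) s).2 + del.2) x
    <-> sl T a b s x.
  by split; apply: gid_cast; rewrite /dia /=; ring.
apply: (@Good_iso _ _ _ _ _ _ _ _ _ _ _ _ (fun s (z x : S^o) => sl Y a b s (h * z - x))).
- exact/sl_gsub/unit_gid.
- exact: sl_gsub.
- by move=> s; rewrite mulr0 subrr; exact: (gid0 HY).
- by move=> s v w v' w' Na Nb; rewrite mulrBr subr_ACA; exact: (gidB HY).
- move=> u s v z x Cv Vz; have := gsZ (sl_gsub a b HY) Cv Vz.
  by rewrite scalerBr; congr (sl Y a b s (_ - _)); exact: mulrCA.
- move=> s z Hz; exists (h * z); last by rewrite subrr; exact: (gid0 HY).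
  by apply/E; exact: hX.
- exact: sur.
- move=> s z x Hz _ Yzx; have [ZY1 ZY2] := ZY _ _ Hz; split=> [/ZY1/E Yhz|Yx].
    by rewrite -[x](subKr (h * z)); exact: (gidB HY).
  by apply/ZY2/E; rewrite -[h * z](subrK x); exact: (gidD HY).
Qed.

(** * The diagonal of the Rees algebra *)

Section ReesDiagonal.
Variables (d : nat) (A1 J2 J3 W : int * int -> S^o -> Prop) (g2 g3 t1 : S).
Hypothesis (dc : (d <= 2 * c)%N).
Hypotheses (HA1 : gid A1) (HJ2 : gid J2) (HJ3 : gid J3) (HW : gid W).
Hypotheses (A1J2 : forall s x, A1 s x -> J2 s x) (J2J3 : forall s x, J2 s x -> J3 s x).
Hypothesis J2W : forall s x, J2 s x -> W s x.
Hypotheses (J300 : forall x, J3 (0, 0) x -> x = 0) (W00 : forall x, W (0, 0) x -> x = 0).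
Hypotheses (Hg2 : hom d%:Z 1 g2) (Hg3 : hom d%:Z 1 g3) (Ht1 : hom 0 1 t1).

(* Multiplication by g2, g3 and t1 induces isomorphisms A1(-d,-1) = J2/A1,
   W(-d,-1) = J3/J2, and, in positive t-degree, (S/J3)(0,-1) = W/J2, where A1 and W
   also stand for the corresponding quotients of S. *)
Hypothesis g2_mul : forall (s : int * int) z, unit_id s z -> J2 (s.1 + d%:Z, s.2 + 1) (g2 * z).
Hypothesis g2_sur : forall (s : int * int) x, J2 s x ->
  exists2 z, hom (s.1 - d%:Z) (s.2 - 1) z & A1 s (g2 * z - x).
Hypothesis g2_ker : forall (s : int * int) z, unit_id s z ->
  A1 s z <-> A1 (s.1 + d%:Z, s.2 + 1) (g2 * z).
Hypothesis g3_mul : forall (s : int * int) z, unit_id s z -> J3 (s.1 + d%:Z, s.2 + 1) (g3 * z).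
Hypothesis g3_sur : forall (s : int * int) x, J3 s x ->
  exists2 z, hom (s.1 - d%:Z) (s.2 - 1) z & J2 s (g3 * z - x).
Hypothesis g3_ker : forall (s : int * int) z, unit_id s z ->
  W s z <-> J2 (s.1 + d%:Z, s.2 + 1) (g3 * z).
Hypothesis t1_mul : forall (s : int * int) z, unit_id s z -> W (s.1 + 0, s.2 + 1) (t1 * z).
Hypothesis t1_sur : forall (s : int * int) x, 0 < s.2 -> W s x ->
  exists2 z, hom (s.1 - 0) (s.2 - 1) z & J2 s (t1 * z - x).
Hypothesis t1_ker : forall (s : int * int) z, unit_id s z ->
  J3 s z <-> J2 (s.1 + 0, s.2 + 1) (t1 * z).

Definition all_good J X k := forall a b : int, 0 <= a -> 0 <= b -> DGood J 0 k (sl unit_id a b) (sl X a b).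

Hypothesis A1step : forall k, all_good A1 A1 k -> res_good A1 k ->
  DGood A1 0 k.+1 (sl unit_id 0 0) (sl A1 0 0) -> all_good A1 A1 k.+1.
Hypothesis Wstep : forall k, all_good J2 W k -> res_good J2 k ->
  DGood J2 0 k.+1 (sl unit_id 0 0) (sl W 0 0) -> all_good J2 W k.+1.

Let J200 x : J2 (0, 0) x -> x = 0. Proof. by move=> /J2J3/J300. Qed.
Let A100 x : A1 (0, 0) x -> x = 0. Proof. by move=> /A1J2/J200. Qed.

(** The mutual induction: shifts of length [k + 1] use the residue field at [k], and the residue
    field at [k + 1] uses the shift (c, e) at [k]. *)
Lemma A1_good k : all_good A1 A1 k /\ res_good A1 k.
Proof.
elim: k => [|k [IH GK]]; first by [].
split; first by apply: A1step => //; exact: DGood_free.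
by apply: res_goodS => //; apply: IH.
Qed.

Lemma A1_up k r a b : 0 <= a + c%:Z * r%:Z -> 0 <= b + e%:Z * r%:Z ->
  DGood A1 r k (sl unit_id a b) (sl A1 a b).
Proof.
have [H GK] := A1_good k; apply: DGood_up_iter => //; exact: unit_gmod.
Qed.

Lemma J2_A1_good r k a b : 0 <= a - d%:Z + c%:Z * r%:Z -> 0 <= b - 1 + e%:Z * r%:Z ->
  DGood A1 r k (sl J2 a b) (sl A1 a b).
Proof.
move=> ha hb; apply: (@DGood_mul _ _ _ _ _ A1 (d%:Z, 1) g2) => //.
- move=> s x J2x; have [z Hz Az] := g2_sur J2x; exists z => //.
  by move: Hz; rewrite /sl /unit_id; apply: hom_cast; rewrite /dia /=; ring.
- exact: A1_up.
Qed.

Lemma A1_to_J2 r k (L : lmodType S) (M N : nat -> L -> Prop) :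
  gmod digr (digr_id J2) M N -> DGood A1 r k M N -> DGood J2 r k M N.
Proof.
move=> H; apply: DGood_change_ring => //.
by apply: J2_A1_good; nia.
Qed.

Lemma J2_res_good k : res_good J2 k.
Proof.
apply: A1_to_J2; last exact: (A1_good k).2.
exact: res_gmod.
Qed.

(** The shift (c, e - 1) is where (0, -1) arrives after one diagonal step. There J2/A1 is S/A1
    shifted by (c - d, e - 2), and one more step is enough since 2c >= d; this costs regularity 1,
    which the cone absorbs. *)
Lemma J2_good k : DGood J2 0 k (sl unit_id c%:Z (e%:Z - 1)) (sl J2 c%:Z (e%:Z - 1)).
Proof.
case: k => // k; apply: A1_to_J2; first exact/sl_gmod/unit_gmod.
apply: (DGood_quo HA1 (sl_gmod _ _ (unit_gmod HA1 (fun s x => id)))).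
- exact: sl_gsub.
- by move=> s x; exact: A1J2.
- by move=> s x; exact: (gid_sub HJ2).
- by apply: A1_up; lia.
- by apply: J2_A1_good; lia.
Qed.

Lemma J3_J2_good r k a b : all_good J2 W k ->
  0 <= a - d%:Z + c%:Z * r%:Z -> 0 <= b - 1 + e%:Z * r%:Z ->
  DGood J2 r k (sl J3 a b) (sl J2 a b).
Proof.
move=> HGW ha hb; apply: (@DGood_mul _ _ _ _ _ W (d%:Z, 1) g3) => //.
- move=> s x J3x; have [z Hz Az] := g3_sur J3x; exists z => //.
  by move: Hz; rewrite /sl /unit_id; apply: hom_cast; rewrite /dia /=; ring.
- apply: DGood_up_iter => //; [exact: unit_gmod | exact: J2_res_good].
Qed.

(** At (0, 0), S/W is the quotient of the free module S/J2 by W/J2, which is (S/J3)(0, -1) on the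
    diagonal. The latter vanishes in degree 0 and continues as the shift (c, e - 1) of S/J3, the
    quotient of S/J2 by J3/J2 = (S/W)(-d, -1). This uses the lemma itself for a shorter segment,
    hence the strong induction. *)
Lemma W_good k : all_good J2 W k.
Proof.
elim/ltn_ind: k => -[|k] IH; first by [].
apply: Wstep; [exact: IH | exact: J2_res_good |].
have HU X (HX : gid X) (JX : forall s x, J2 s x -> X s x) a b := sl_gmod a b (unit_gmod HX JX).
apply: (DGood_quo HJ2 (HU _ HJ2 (fun s x => id) 0 0)).
- exact: sl_gsub.
- by move=> s x; exact: J2W.
- by move=> s x; exact: (gid_sub HW).
- exact: DGood_free.
have GR : DGood J2 1 k (sl unit_id (0 - 0) (0 - 1)) (sl J3 (0 - 0) (0 - 1)).
  apply: DGood_sl_shift => //; first exact: unit_gid.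
    move=> x Hx; have -> : x = 0; last exact: (gid0 HJ3).
    by apply: (hom_neg HB _ Hx); apply/orP; right; rewrite /dia /=; lia.
  case: k IH => // k IH.
  have -> : 0 - 0 + c%:Z = c%:Z by lia.
  have -> : 0 - 1 + e%:Z = e%:Z - 1 by lia.
  apply: (DGood_quo HJ2 (HU _ HJ2 (fun s x => id) _ _)).
  - exact: sl_gsub.
  - by move=> s x; exact: J2J3.
  - by move=> s x; exact: (gid_sub HJ3).
  - exact: J2_good.
  - by apply: J3_J2_good; [exact: IH | lia | lia].
apply: (@DGood_mul _ _ _ _ _ J3 (0, 1) t1) => //.
move=> [|s] x Wx.
  exists 0; first exact: (gid0 unit_gid).
  have -> : x = 0 by apply: W00; move: Wx; apply: gid_cast; rewrite /dia /=; ring.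
  by rewrite mulr0 subr0; exact: (gid0 HJ2).
have [|z Hz Jz] := t1_sur _ Wx; first by rewrite /dia /=; nia.
exists z => //.
by move: Hz; rewrite /sl /unit_id; apply: hom_cast; rewrite /dia /=; ring.
Qed.

Theorem Rees_diagonal_good k : res_good J3 k.
Proof.
apply: (@DGood_change_ring J2 J3) => //.
- by apply: J3_J2_good; [exact: W_good | nia | nia].
- exact: res_gmod.
- exact: J2_res_good.
Qed.

End ReesDiagonal.

(** * Linear resolutions from initial segments *)

Section LinearResolution.
Variable J : int * int -> S^o -> Prop.
Hypothesis HJ : gid J.
Hypothesis J00 : forall x, J (0, 0) x -> x = 0.

Let HC := digr_grading.
Let HJd := digr_gideal HJ.
Local Notation FJr r b := (FJ (digr_id J) (fun _ : 'I_b => r)).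
Local Notation Fmr r b := (Fm digr (fun _ : 'I_b => r)).

(** A module of syzygies [X], inside a free module generated in degree [r], which is
    generated in degree [r + 1] and has a linear resolution. *)
Record syzygies r b (X : nat -> 'rV[S]_b -> Prop) : Prop := Syzygies {
  sy_mod : gmod digr (digr_id J) X (FJr r b);
  sy_low : forall s v, (s <= r)%N -> X s v -> FJr r b s v;
  sy_good : forall k, DGood J r.+1 k X (FJr r b) }.

Lemma digr_self u x : digr u u x <-> hom 0 0 x.
Proof. by rewrite /digr subrr !mulr0. Qed.

Lemma digr_id_self u x : digr_id J u u x -> x = 0.
Proof. by rewrite /digr_id subrr !mulr0; exact: J00. Qed.

Definition spans r b (X : nat -> 'rV[S]_b -> Prop) m (l : 'I_m -> 'rV[S]_b) :=
  (forall i, X r.+1 (l i)) /\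
  forall v, X r.+1 v -> exists2 a : 'rV[S]_m, forall i, hom 0 0 (a 0 i) &
    FJr r b r.+1 (v - comb l a).

Lemma spans_exists r b (X : nat -> 'rV[S]_b -> Prop) : syzygies r X ->
  exists m (l : 'I_m -> 'rV[S]_b), spans r X l.
Proof.
move=> [H low good]; have [m [u [l [Hl gen _]]]] := good 1%N.
have HX := gm_l H; have HF := gm_r H.
exists m, (fun j => if u j == r.+1 then l j else 0); split=> [j|v Xv].
  by have [_ Xl] := Hl j; case: eqP => [<-|_] //; exact: (gs0 HX).
have [w Fw Nw] := gen _ _ Xv.
exists (\row_j if u j == r.+1 then w 0 j else 0) => [j|].
  rewrite mxE; case: eqP => [ur|_]; last exact: (hom0 HB).
  by have := Fw j; rewrite ur => /digr_self.
rewrite -[v](subrK (comb l w)) -addrA; apply: (gsD HF) => //.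
rewrite /comb -sumrB; apply: (gs_sum HF) => j; rewrite mxE.
have [Du Xl] := Hl j; case: eqP => [_|/eqP ne]; first by rewrite subrr; exact: (gs0 HF).
rewrite scaler0 subr0; apply: (gsZ HF (Fw j)); apply: low Xl.
by move: Du; rewrite /Dle addn0 leq_eqVlt (negPf ne) ltnS.
Qed.

Lemma minimal_nat (P : nat -> Prop) : (exists n, P n) ->
  exists n, P n /\ forall m, (m < n)%N -> ~ P m.
Proof.
move=> [n]; elim/ltn_ind: n => n IH Pn.
case: (classic (exists2 m, (m < n)%N & P m)) => [[m mn Pm]|nP]; first exact: IH Pm.
by exists n; split=> // m mn Pm; apply: nP; exists m.
Qed.

(** Degree [r + 1] is spanned by as few elements as possible. They are then independent over the
    field, so their syzygies start in degree [r + 2], while Schanuel's lemma transfers the upper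
    bounds to this choice of generators. The two bounds together give linearity. *)
Lemma syzygies_step r b (X : nat -> 'rV[S]_b -> Prop) : syzygies r X ->
  exists m (A : 'M[S]_(m, b)),
    [/\ forall j, X r.+1 (row j A),
        forall s v, X s v -> exists2 w, Fmr r.+1 m s w & FJr r b s (v - w *m A) &
        syzygies r.+1 (Ker digr (fun _ => r.+1) (fun j => row j A) (FJr r b))].
Proof.
move=> HX; have [H low good] := HX; have HXs := gm_l H; have HF := gm_r H.
have [m [[l [lX lgen]] lmin]] := minimal_nat (spans_exists HX).
(* A nonzero coefficient is invertible, so the relation would express one [l i] through the others,
   against the minimality of [m]. *)
have indep (a : 'rV[S]_m) : (forall i, hom 0 0 (a 0 i)) -> FJr r b r.+1 (comb l a) -> a = 0.
  move=> Ha Ja; apply/rowP => i; rewrite mxE.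
  case: (hom_field HB (Ha i)) => // -[z Hz za]; exfalso.
  case: m i l lX lgen lmin a Ha Ja za => [[] //|m] i l lX lgen lmin a Ha Ja za.
  apply: (lmin m (ltnSn m)); exists (fun j => l (lift i j)); split=> // v /lgen[f Hf Jf].
  exists (\row_j (f 0 (lift i j) - f 0 i * z * a 0 (lift i j))).
    move=> j; rewrite mxE; apply: (homB HB) => //.
    have H1 := homM HB (homM HB (Hf i) Hz) (Ha (lift i j)).
    by move: H1; apply: hom_cast; rewrite !addr0.
  have Hfz : digr r.+1 r.+1 (f 0 i * z).
    by apply/digr_self; have := homM HB (Hf i) Hz; apply: hom_cast; rewrite addr0.
  have := gsD HF Jf (gsZ HF Hfz Ja).
  congr (FJr r b r.+1 _); rewrite -addrA; congr (_ + _).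
  have split_comb (h : 'rV[S]_m.+1) :
      comb l h = h 0 i *: l i + \sum_j h 0 (lift i j) *: l (lift i j).
    by rewrite /comb (bigD1_ord i).
  rewrite !split_comb scalerDr scalerA -mulrA za mulr1 opprD addrACA addNr add0r.
  have -> : comb (fun j => l (lift i j)) (\row_j (f 0 (lift i j) - f 0 i * z * a 0 (lift i j))) =
      \sum_j f 0 (lift i j) *: l (lift i j) -
      (f 0 i * z) *: \sum_j a 0 (lift i j) *: l (lift i j).
    rewrite scaler_sumr -sumrB; apply: eq_bigr => j _.
    by rewrite mxE scalerBl scalerA.
  by rewrite opprB addrC.
pose A := \matrix_i l i.
have rowA i : row i A = l i by rewrite rowK.
have combA w : comb (fun j => row j A) w = w *m A.
  by rewrite mulmx_sum_row.
have gen s v : X s v -> exists2 w, Fmr r.+1 m s w & FJr r b s (v - comb (fun j => row j A) w).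
  move=> Xv; have [m0 [u [l0 [Hl0 gen0 _]]]] := good 1%N.
  have [w0 Fw0 Nw0] := gen0 _ _ Xv.
  have /fin_all_exists[sg Hsg] : forall j, exists a : 'rV[S]_m, Fmr r.+1 m (u j) a /\
      FJr r b (u j) (l0 j - comb (fun j => row j A) a).
    move=> j; have [Du Xl] := Hl0 j.
    move: Du; rewrite /Dle addn0 leq_eqVlt ltnS => /orP[/eqP ur|ur].
      rewrite ur in Xl *; have [a Ha Ja] := lgen _ Xl; exists a; split.
        by move=> i; apply/digr_self.
      by move: Ja; congr (FJr r b _ (_ - _)); apply: eq_bigr => i _; rewrite rowA.
    exists 0; split; first by move=> i; rewrite mxE; exact: (gr0 HC).
    by rewrite comb0 subr0; exact: low ur Xl.
  exists (comb sg w0).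
    by apply: (gs_comb (Fm_gsub HC _)) Fw0 => j; have [] := Hsg j.
  rewrite -[v](subrK (comb l0 w0)) -addrA; apply: (gsD HF) => //.
  have -> : comb (fun j => row j A) (comb sg w0) = comb (fun j => comb (fun j => row j A) (sg j)) w0.
    rewrite (_ : comb sg w0 = \sum_j w0 0 j *: sg j) // (big_morph _ (combD _) (comb0 _)).
    by apply: eq_bigr => j _; rewrite combZ.
  rewrite /comb -sumrB; apply: (gs_sum HF) => j; rewrite -scalerBr.
  by apply: (gsZ HF (Fw0 j)); have [] := Hsg j.
have AX j : X r.+1 (row j A) by rewrite rowA.
exists m, A; split=> // [s v /gen[w Fw Nw]|]; first by exists w => //; rewrite -combA.
split.
- exact: (Ker_mod HC HJd H).
- move=> s w; rewrite leq_eqVlt ltnS => /orP[/eqP->|sr] [Fw Nw] j.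
    have -> : w = 0; last by rewrite mxE; exact: (gi0 HJd).
    apply: indep => [i|]; first by apply/digr_self/Fw.
    by move: Nw; congr (FJr r b _ _); apply: eq_bigr => i _; rewrite rowA.
  by rewrite (digr_neg (sr : (s < r.+1)%N) (Fw j)) //; exact: (gi0 HJd).
- move=> k; apply/DGood_succ.
  apply: (Good_kernel HC HJd _ H (good k.+1)) => //.
  + by move=> i u; rewrite /Dle addnS; exact: leqW.
  + by move=> j; split=> //; rewrite /Dle addn0.
Qed.

Definition homS (s : nat) (x : S) : Prop := hom (c%:Z * s%:Z) (e%:Z * s%:Z) x.
Definition JS (s : nat) (x : S) : Prop := J (c%:Z * s%:Z, e%:Z * s%:Z) x.

Lemma digr_homS u s x : digr u (u + s) x <-> homS s x.
Proof. by rewrite /digr /homS PoszD addrAC subrr add0r. Qed.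

Lemma digr_JS u s x : digr_id J u (u + s) x <-> JS s x.
Proof. by rewrite /digr_id /JS PoszD addrAC subrr add0r. Qed.

Definition row_of (Q : S -> Prop) b (v : 'rV[S]_b) := forall j, Q (v 0 j).

(** The irrelevant ideal, written as rows of length 1, is the syzygy module of the generator 1 of
    the residue field. *)
Lemma syzygies0 : (forall k, res_good J k) ->
  @syzygies 0 1 (fun s v => resN s (v 0 0)).
Proof.
move=> GK; have HR := resN_gsub; split.
- split.
  + split=> [s|s v w|u s a v Ha]; rewrite !mxE; [exact: (gs0 HR) | exact: (gsB HR) | exact: (gsZ HR Ha)].
  + exact: FJ_gsub.
  + move=> s v Jv; have Jv0 : digr_id J 0 s (v 0 0) := Jv 0; split; first exact: (gi_sub HJd Jv0).
    by move=> s0; move: Jv0; rewrite s0; exact: digr_id_self.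
  + by move=> u s a v Ja [Cv _] j; rewrite mxE ord1; exact: (giMr HJd Cv Ja).
- move=> s v; rewrite leqn0 => /eqP s0 [_ v0] j; rewrite ord1 v0 //; exact: (gi0 HJd).
- move=> k; apply/DGood_succ.
  pose m1 (_ : 'I_1) : S^o := 1.
  have combE v : comb m1 v = v 0 0 by rewrite /comb big_ord1 /m1 [LHS]mulr1.
  have HK := Good_kernel (D := Dle 0) (u := fun _ => 0%N) (m := m1) HC HJd.
  have D1 i u : Dle 0 i u -> Dle 0 i.+1 u by rewrite /Dle addnS; exact: leqW.
  have H1 (j : 'I_1) : Dle 0 0 0 /\ resM 0 (m1 j) by split=> //; exact: (gr1 HC).
  have H2 s (x : S^o) : resM s x -> exists2 v, Fm digr (fun _ : 'I_1 => 0%N) s v & resN s (x - comb m1 v).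
    move=> Cx; exists (\row__ x); first by move=> j; rewrite mxE.
    by rewrite combE mxE subrr; exact: (gs0 HR).
  have := HK _ _ _ D1 (res_gmod HJ J00) (GK k.+1) H1 H2; apply: Good_eq; first exact: (Ker_gsub HC).
    move=> s v; rewrite /Ker combE; split=> [[]|[Cv v0]] //; split=> // j; by rewrite ord1.
  by [].
Qed.

(** Each stage carries its rank, so that recursion on nat together with choice yields all
    differentials at once. *)
Definition sy_stage r := {b : nat & {X : nat -> 'rV[S]_b -> Prop | syzygies r X}}.

Definition sy_next r (x : sy_stage r) (p : {y : sy_stage r.+1 & 'M[S]_(projT1 y, projT1 x)}) : Prop :=
  let X := proj1_sig (projT2 x) in
  let Y := proj1_sig (projT2 (projT1 p)) in
  let A := projT2 p in
  [/\ forall j, X r.+1 (row j A),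
      forall s v, X s v -> exists2 w, Fmr r.+1 _ s w & FJr r _ s (v - w *m A) &
      forall s w, Y s w <-> Fmr r.+1 _ s w /\ FJr r _ s (w *m A)].

Lemma sy_next_exists r (x : sy_stage r) : exists p, @sy_next r x p.
Proof.
case: x => b [X HX]; have [m [A [A1 A2 A3]]] := syzygies_step HX.
exists (existT _ (existT _ m (exist _ _ A3)) A); split=> //= s w.
have -> // : w *m A = comb (fun j => row j A) w by rewrite mulmx_sum_row.
Qed.

(** Exactness is stated degree by degree, with [JS] as equality to zero in the diagonal ring.
    Kernels vanish in degree 0 because minimal generators have no constant relations. *)
Theorem linear_resolution : (forall k, res_good J k) ->
  exists (b : nat -> nat) (d1 : 'M[S]_(b 0%N, 1%N)) (M : forall i, 'M[S]_(b i.+1, b i)),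
    [/\ (forall j k, homS 1 (d1 j k)) /\ (forall i j k, homS 1 (M i j k)),
        (forall j k, JS 2 ((M 0%N *m d1) j k)) /\ (forall i j k, JS 2 ((M i.+1 *m M i) j k)),
        forall s x, homS s.+1 x -> exists2 w, row_of (homS s) w & JS s.+1 (x - (w *m d1) 0 0),
        (forall v, row_of (homS 0) v -> JS 1 ((v *m d1) 0 0) -> v = 0) /\
        (forall s v, row_of (homS s.+1) v -> JS s.+2 ((v *m d1) 0 0) ->
          exists2 w, row_of (homS s) w & row_of (JS s.+1) (v - w *m M 0%N)) &
        (forall i v, row_of (homS 0) v -> row_of (JS 1) (v *m M i) -> v = 0) /\
        (forall i s v, row_of (homS s.+1) v -> row_of (JS s.+2) (v *m M i) ->
          exists2 w, row_of (homS s) w & row_of (JS s.+1) (v - w *m M i.+1))].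
Proof.
move=> GK.
pose F r x := constructive_indefinite_description _ (@sy_next_exists r x).
pose x0 : sy_stage 0 := existT _ 1%N (exist _ _ (syzygies0 GK)).
pose f := nat_rect sy_stage x0 (fun r x => projT1 (proj1_sig (F r x))).
pose A r : 'M[S]_(projT1 (f r.+1), projT1 (f r)) := projT2 (proj1_sig (F r (f r))).
pose X r := proj1_sig (projT2 (f r)).
have HX r : syzygies r (X r) by exact: proj2_sig (projT2 (f r)).
have HA r : [/\ forall j, X r r.+1 (row j (A r)),
      forall s v, X r s v -> exists2 w, Fmr r.+1 _ s w & FJr r _ s (v - w *m A r) &
      forall s w, X r.+1 s w <-> Fmr r.+1 _ s w /\ FJr r _ s (w *m A r)].
  exact: proj2_sig (F r (f r)).
have XF r s v : X r s v -> Fmr r _ s v.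
  case: r v => [v [Cv _] j|r v]; first by rewrite ord1.
  by have [_ _ HY] := HA r => /HY[].
have deg u v w x : (u + v)%N = w -> digr u w x <-> homS v x by move=> <-; exact: digr_homS.
have degJ u v w x : (u + v)%N = w -> digr_id J u w x <-> JS v x by move=> <-; exact: digr_JS.
have A1 r j k : homS 1 (A r j k).
  have [Ar _ _] := HA r; have := XF _ _ _ (Ar j) k.
  by rewrite mxE => /(deg _ _ _ _ (addn1 r)).
have A2 r j k : JS 2 ((A r.+1 *m A r) j k).
  have [Ar _ _] := HA r.+1; have [_ _ HY] := HA r.
  have [_ /(_ k)] := (HY _ _).1 (Ar j).
  by rewrite -row_mul mxE => /(degJ _ _ _ _ (addn2 r)).
have ker0 r v : row_of (homS 0) v -> row_of (JS 1) (v *m A r) -> v = 0.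
  move=> Hv Jv; have [_ _ HY] := HA r.
  have Xv : X r.+1 r.+1 v.
    apply/HY; split=> j; first by apply/(deg _ _ _ _ (addn0 _)); exact: Hv.
    by apply/(degJ _ _ _ _ (addn1 _)); exact: Jv.
  apply/rowP => j; rewrite mxE; apply: (@digr_id_self r.+1).
  exact: (sy_low (HX r.+1) (leqnn _) Xv j).
have kerS r s v : row_of (homS s.+1) v -> row_of (JS s.+2) (v *m A r) ->
    exists2 w, row_of (homS s) w & row_of (JS s.+1) (v - w *m A r.+1).
  move=> Hv Jv; have [_ _ HY] := HA r; have [_ gen _] := HA r.+1.
  have Xv : X r.+1 (r.+1 + s.+1)%N v.
    apply/HY; split=> j; first exact/digr_homS.
    by apply/(degJ _ s.+2); [rewrite addSnnS | exact: Jv].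
  have [w Fw Jw] := gen _ _ Xv; exists w => j; last exact/(digr_JS r.+1)/Jw.
  by apply/(deg r.+2 s); [rewrite addSnnS | exact: Fw].
have row1 (v : 'rV[S]_1) (Q : S -> Prop) : Q (v 0 0) -> row_of Q v by move=> ? j; rewrite ord1.
exists (fun i => projT1 (f i.+1)), (A 0%N), (fun i => A i.+1); split.
- by split=> [j k|i j k]; exact: A1.
- by split=> [j k|i j k]; exact: A2.
- move=> s x Hx; have [_ gen _] := HA 0%N.
  have Xx : X 0%N s.+1 (\row__ x).
    by split; rewrite mxE //; apply/(deg 0 s.+1).
  have [w Fw Jw] := gen _ _ Xx; exists w => [j|].
    by apply/(deg 1 s s.+1); [exact: add1n | exact: Fw].
  by apply/(degJ 0 s.+1 s.+1); [|have := Jw 0; rewrite !mxE].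
- split=> [v Hv /row1|s v Hv /row1]; [exact: (ker0 0%N) | exact: (kerS 0%N)].
- by split=> [i v|i s v]; [exact: ker0 | exact: kerS].
Qed.

End LinearResolution.
End Diagonal.

(** * Gradings of iterated polynomial rings *)

(** [pr a b] projects onto the component of bidegree [(a, b)]. *)
Record graded_proj (S : comNzRingType) (hom : int -> int -> S -> Prop)
    (pr : int -> int -> S -> S) : Prop := GradedProj {
  gp_hom : forall a b x, hom a b (pr a b x);
  gpD : forall a b x y, pr a b (x + y) = pr a b x + pr a b y;
  gp_id : forall a b x, hom a b x -> pr a b x = x;
  gpM : forall a b a' b' f x, hom a' b' f -> pr (a' + a) (b' + b) (f * x) = f * pr a b x }.

Lemma gp0 (S : comNzRingType) (hom : int -> int -> S -> Prop) pr a b :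
  graded_proj hom pr -> pr a b 0 = 0.
Proof. by move=> H; apply: (addrI (pr a b 0)); rewrite -(gpD H) !addr0. Qed.

Lemma gpB (S : comNzRingType) (hom : int -> int -> S -> Prop) pr a b x y :
  graded_proj hom pr -> pr a b (x - y) = pr a b x - pr a b y.
Proof. by move=> H; apply/eqP; rewrite eq_sym subr_eq -(gpD H) subrK. Qed.

Lemma gp_sum (S : comNzRingType) (hom : int -> int -> S -> Prop) pr a b I (r : seq I) (F : I -> S) :
  graded_proj hom pr -> pr a b (\sum_(i <- r) F i) = \sum_(i <- r) pr a b (F i).
Proof.
move=> H; elim: r => [|i r IH]; first by rewrite !big_nil (gp0 a b H).
by rewrite !big_cons (gpD H) IH.
Qed.

Section PolynomialExtension.
Variables (Q : comNzRingType) (h : int -> int -> Q -> Prop) (pr : int -> int -> Q -> Q).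
Hypotheses (HB : bigraded h) (HP : graded_proj h pr).

(** The adjoined variable has degree (0, 1). *)
Definition hpoly a b (x : {poly Q}) : Prop := forall i : nat, h a (b - i%:Z) x`_i.
Definition prpoly a b (x : {poly Q}) : {poly Q} := \poly_(i < size x) pr a (b - i%:Z) x`_i.

Lemma coef_prpoly a b x i : (prpoly a b x)`_i = pr a (b - i%:Z) x`_i.
Proof.
rewrite coef_poly; case: ltnP => // le; by rewrite nth_default // (gp0 _ _ HP).
Qed.

Lemma hpolyC a b p : h a b p -> hpoly a b p%:P.
Proof.
move=> Hp i; rewrite coefC; case: eqP => [->|_]; last exact: (hom0 HB).
by rewrite subr0.
Qed.

Lemma hpolyX : hpoly 0 1 'X.
Proof.
move=> i; rewrite coefX; case: eqP => [->|_]; last exact: (hom0 HB).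
by rewrite subrr; exact: (hom1 HB).
Qed.

Lemma hsum a b I (r : seq I) (P : pred I) (F : I -> Q) :
  (forall i, P i -> h a b (F i)) -> h a b (\sum_(i <- r | P i) F i).
Proof.
move=> H; elim/big_ind: _ => //; first exact: (hom0 HB).
move=> x y Hx Hy; rewrite -[y]opprK; apply: (homB HB) => //.
by rewrite -sub0r; apply: (homB HB) => //; exact: (hom0 HB).
Qed.

Lemma hpoly_size a (b : nat) x : hpoly a b%:Z x -> (size x <= b.+1)%N.
Proof.
move=> Hx; apply/leq_sizeP => j bj; apply: (hom_neg HB _ (Hx j)).
by apply/orP; right; lia.
Qed.

Definition fin_span (Qp : {poly Q} -> Prop) := exists m (l : 'I_m -> {poly Q}),
  (forall i, Qp (l i)) /\ forall x, Qp x -> exists f : 'I_m -> {poly Q},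
    (forall i, hpoly 0 0 (f i)) /\ x = \sum_i f i * l i.

Lemma hpoly_fin_size a b N : fin_span (fun x => hpoly a b x /\ (size x <= N)%N).
Proof.
elim: N => [|N [m [l [Hl gen]]]].
  exists 0%N, (fun=> 0); split=> [[]//|x [_]]; rewrite size_poly_leq0 => /eqP->.
  by exists (fun=> 0); split=> [[]//|]; rewrite big_ord0.
have [m' [l' [Hl' gen']]] := hom_fin HB a (b - N%:Z).
exists (m + m')%N, (cat_fun l (fun i => (l' i)%:P * 'X^N)); split.
  move=> j; case: (split_ordP j) => i ->; rewrite ?cat_funl ?cat_funr.
    by have [? ?] := Hl i; split=> //; exact: leqW.
  split=> [k|]; last first.
    by apply/leq_sizeP => k Nk; rewrite mul_polyC coefZ coefXn eqn_leq leqNgt Nk /= mulr0.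
  rewrite mul_polyC coefZ coefXn; case: eqP => [->|_]; first by rewrite mulr1.
  by rewrite mulr0; exact: (hom0 HB).
move=> x [Hx sx]; have [f' [Hf' ef']] := gen' _ (Hx N).
have Hxl : hpoly a b (x - (x`_N)%:P * 'X^N) /\ (size (x - (x`_N)%:P * 'X^N)%R <= N)%N.
  split=> [k|].
    rewrite coefB mul_polyC coefZ coefXn; case: eqP => [->|_]; rewrite ?mulr1 ?subrr ?mulr0 ?subr0 //.
    exact: (hom0 HB).
  apply/leq_sizeP => k; rewrite coefB mul_polyC coefZ coefXn leq_eqVlt => /orP[/eqP<-|Nk].
    by rewrite eqxx mulr1 subrr.
  by rewrite nth_default ?(leq_trans sx) // gtn_eqF // mulr0 subr0.
have [f [Hf ef]] := gen _ Hxl.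
exists (cat_fun f (fun i => (f' i)%:P)); split.
  move=> j; case: (split_ordP j) => i ->; rewrite ?cat_funl ?cat_funr //.
  exact: hpolyC.
rewrite big_split_ord /=; under eq_bigr => i _ do rewrite !cat_funl.
rewrite -ef; under eq_bigr => i _ do rewrite !cat_funr mulrA -polyCM.
by rewrite -mulr_suml -raddf_sum -ef' subrK.
Qed.

Lemma hpoly_bigraded : bigraded hpoly.
Proof.
split.
- by move=> a b i; rewrite coef0; exact: (hom0 HB).
- by move=> a b x y Hx Hy i; rewrite coefB; exact: (homB HB).
- exact/hpolyC/(hom1 HB).
- move=> a b a' b' x y Hx Hy i; rewrite coefM; apply: hsum => j _.
  have := homM HB (Hx j) (Hy (i - j)%N); apply: hom_cast => //.
  by have := ltn_ord j; lia.
- move=> a b x nab Hx; apply/polyP => i; rewrite coef0; apply: (hom_neg HB _ (Hx i)).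
  by move: nab => /orP[-> //|b0]; apply/orP; right; lia.
- move=> a [b|b].
    have [m [l [Hl gen]]] := hpoly_fin_size a b%:Z b.+1.
    exists m, l; split=> [i|x Hx]; first by have [] := Hl i.
    by have [|f [Hf ef]] := gen x; [split=> //; exact: hpoly_size | exists f].
  exists 0%N, (fun=> 0); split=> [[]//|x Hx]; exists (fun=> 0); split=> [[]//|].
  rewrite big_ord0; apply/polyP => i; rewrite coef0; apply: (hom_neg HB _ (Hx i)).
  by apply/orP; right; lia.
- move=> x Hx.
  have ex : x = (x`_0)%:P.
    by apply: size1_polyC; exact: (@hpoly_size 0 0).
  have := Hx 0%N; rewrite subr0 => /(hom_field HB)[x0|[y Hy yx]]; [left|right].
    by rewrite ex x0.
  by exists y%:P; [exact: hpolyC | rewrite ex -polyCM yx].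
Qed.

Lemma prpoly_proj : graded_proj hpoly prpoly.
Proof.
split.
- by move=> a b x i; rewrite coef_prpoly; exact: (gp_hom HP).
- by move=> a b x y; apply/polyP => i; rewrite coefD !coef_prpoly coefD (gpD HP).
- by move=> a b x Hx; apply/polyP => i; rewrite coef_prpoly (gp_id HP).
- move=> a b a' b' f x Hf; apply/polyP => i; rewrite coef_prpoly !coefM (gp_sum _ _ _ _ HP).
  apply: eq_bigr => j _; rewrite coef_prpoly -(gpM HP _ _ _ (Hf j)).
  by congr (pr _ _ _); have := ltn_ord j; lia.
Qed.

Lemma prpolyC a b p : prpoly a b p%:P = (pr a b p)%:P.
Proof.
apply/polyP => i; rewrite coef_prpoly !coefC; case: eqP => [->|_]; first by rewrite subr0.
exact: (gp0 _ _ HP).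
Qed.

End PolynomialExtension.

Section Base.
Variables (K : fieldType) (n : nat).
Local Notation P := {mpoly K[n]}.

Definition hbase (a b : int) (p : P) : Prop :=
  if (a, b) is (Posz D, Posz 0) then p \is D.-homog for mdeg else p = 0.
Definition prbase (a b : int) (p : P) : P :=
  if (a, b) is (Posz D, Posz 0) then pihomog mdeg D p else 0.

Lemma hbase0 a b : hbase a b 0.
Proof. by case: a => // D; case: b => // -[|b] //; exact: dhomog0. Qed.

Lemma hbaseB a b x y : hbase a b x -> hbase a b y -> hbase a b (x - y).
Proof.
case: a => [D|D]; case: b => [[|b]|b] //=; try by move=> -> ->; rewrite subrr.
exact: rpredB.
Qed.

Lemma hbaseM a b a' b' x y : hbase a b x -> hbase a' b' y -> hbase (a + a') (b + b') (x * y).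
Proof.
case: a => [D|D]; case: b => [[|b]|b] Hx; try (by rewrite [x]Hx mul0r => _; exact: hbase0).
case: a' => [D'|D']; case: b' => [[|b']|b'] Hy; try (by rewrite [y]Hy mulr0; exact: hbase0).
exact: dhomogM.
Qed.

Lemma prbase_proj : graded_proj hbase prbase.
Proof.
split.
- by move=> [D|D] [[|b]|b] x //; exact: pihomogP.
- by move=> [D|D] [[|b]|b] x y; rewrite /prbase ?addr0 // pihomogD.
- by move=> [D|D] [[|b]|b] x Hx; rewrite /prbase; rewrite ?[x in RHS]Hx //; exact: pihomog_dE.
- have Z0 a b : prbase a b 0 = 0.
    by case: a => [D|D]; case: b => [[|b]|b]; rewrite /prbase // pihomog0.
  move=> a b a' b' f x; case: a' => [D'|D']; case: b' => [[|b']|b'] Hf;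
    try by rewrite [f]Hf !mul0r Z0.
  rewrite add0r; case: b => [[|b]|b].
  (* [k] bounds the degrees occurring in [x] and exceeds the absolute value of [a], so the sum over
     degrees below [k] contains the wanted component. *)
  + pose k := (mmeasure mdeg x + `|a|.+1)%N.
    have [D ka] : exists D, (D < k)%N /\ (a = D%:Z \/ a < 0).
      by exists `|a|%N; split; [rewrite /k | case: a {k} => D; [left|right]]; lia.
    have key E : pihomog mdeg E (f * x) =
        \sum_(i < k | (D' + i == E)%N) f * pihomog mdeg i x.
      rewrite {1}[x](@pihomog_partitionE _ _ mdeg k x) ?leq_addr // mulr_sumr.
      rewrite raddf_sum [RHS]big_mkcond /=; apply: eq_bigr => i _.
      have hx : f * pihomog mdeg i x \is (D' + i).-homog for mdeg.
        by apply: dhomogM => //; exact: pihomogP.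
      by case: eqP => [<-|/eqP ne]; [exact: pihomog_dE | exact: pihomog_ne0 ne hx].
    case: ka => Dk [aD|an].
      rewrite aD [LHS]key (big_pred1 (Ordinal Dk)) //= => i.
      by rewrite eqn_add2l.
    have -> : prbase a 0 x = 0 by move: an; case: a {k Dk key}.
    rewrite mulr0; case E: (D'%:Z + a) => [w|w] //; rewrite [LHS]key big_pred0 // => i.
    by apply/eqP => /= iw; move: an E; lia.
  + have -> : prbase a b.+1 x = 0 by case: (a).
    by rewrite mulr0; case: (_ + a).
  + have -> : prbase a (Negz b) x = 0 by case: (a).
    by rewrite mulr0; case: (_ + a).
Qed.

Lemma mdeg_monomials D (p : P) : p \is D.-homog for mdeg ->
  p = \sum_(m : 'X_{1..n < D.+1} | mdeg m == D) p@_m *: 'X_[m].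
Proof.
move=> Hp; rewrite -{1}(pihomog_dE Hp); apply: pihomogwE.
by rewrite msizeE; apply/bigmax_leqP_seq => m mp _; rewrite (dhomog_mf Hp mp).
Qed.

Lemma hbase_bigraded : bigraded hbase.
Proof.
split.
- exact: hbase0.
- exact: hbaseB.
- exact: dhomog1.
- exact: hbaseM.
- move=> [D|D] [[|b]|b] x //=.
- move=> a b.
  have triv : (forall x, hbase a b x -> x = 0) -> exists m (l : 'I_m -> P), (forall i, hbase a b (l i)) /\
      forall x, hbase a b x -> exists f : 'I_m -> P, (forall i, hbase 0 0 (f i)) /\ x = \sum_i f i * l i.
    move=> H; exists 0%N, (fun=> 0); split=> [[]//|x /H->].
    by exists (fun=> 0); split=> [[]//|]; rewrite big_ord0.
  case: a triv => [D|D]; case: b => [[|b]|b] triv; try by apply: triv.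
  pose T : finType := 'X_{1..n < D.+1}.
  pose l (i : 'I_#|T|) : P := if mdeg (enum_val i : T) == D then 'X_[(enum_val i : T)] else 0.
  exists #|T|, l; split=> [i|x Hx].
    by rewrite /hbase /l; case: ifP => [mD|_]; [rewrite dhomogX | exact: dhomog0].
  exists (fun i => (x@_(enum_val i : T))%:MP); split=> [i|].
    by rewrite /hbase; apply/dhomogP => m; rewrite msuppC; case: ifP => // _; rewrite inE => /eqP->; exact: mdeg0.
  rewrite {1}(mdeg_monomials Hx) big_mkcond /= (reindex (fun i : 'I_#|T| => enum_val i)) /=; last first.
    by apply: onW_bij; exact: enum_val_bij.
  apply: eq_bigr => i _; rewrite /l; case: ifP => _; last by rewrite mulr0.
  by rewrite mul_mpolyC.
- move=> x /= Hx.
  have ex : x = (x@_0%MM)%:MP.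
    apply/mpolyP => m; rewrite mcoeffC; case: eqP => [->|/eqP m0]; first by rewrite mulr1.
    by rewrite mulr0; apply: (dhomog_nemf_coeff Hx); rewrite mdeg_eq0.
  case: (eqVneq (x@_0%MM) 0) => [x0|x0]; [left|right].
    by rewrite ex x0 mpolyC0.
  exists ((x@_0%MM)^-1)%:MP.
    by apply/dhomogP => m; rewrite msuppC; case: ifP => // _; rewrite inE => /eqP->; exact: mdeg0.
  by rewrite ex mcoeffC eqxx mulr1 -mpolyCM mulVf.
Qed.

End Base.

(** * Ideals generated by a sequence *)

Section GeneratedIdeals.
Variable R : comNzRingType.

Definition genid (y : nat -> R) j x := exists q : nat -> R, x = \sum_(i < j) y i * q i.

Lemma genid0 y j : genid y j 0.
Proof. by exists (fun=> 0); rewrite big1 // => i _; rewrite mulr0. Qed.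

Lemma genidD y j x z : genid y j x -> genid y j z -> genid y j (x + z).
Proof.
move=> [q ->] [q' ->]; exists (fun i => q i + q' i); rewrite -big_split /=.
by apply: eq_bigr => i _; rewrite mulrDr.
Qed.

Lemma genid_gen y j (i : nat) x : (i < j)%N -> genid y j (y i * x).
Proof.
move=> ij; exists (fun k => if k == i then x else 0).
rewrite (bigD1 (Ordinal ij)) //= eqxx big1 ?addr0 // => k ki.
by rewrite (negPf (_ : k != i :> nat)) ?mulr0.
Qed.

Lemma genidS y j x : genid y j.+1 x <-> exists2 z, genid y j (x - y j * z) & True.
Proof.
split=> [[q ->]|[z [q e] _]].
  by exists (q j) => //; exists q; rewrite big_ord_recr /= addrK.
exists (fun k => if k == j then z else q k); rewrite big_ord_recr /= eqxx.
rewrite -[LHS](subrK (y j * z)) e; congr (_ + _); apply: eq_bigr => i _.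
by rewrite ltn_eqF.
Qed.

Lemma genid_poly (y : nat -> R) j (x : {poly R}) :
  (exists q : nat -> {poly R}, x = \sum_(i < j) (y i)%:P * q i) <-> forall k : nat, genid y j x`_k.
Proof.
split=> [[q ->] k|H].
  exists (fun i => (q i)`_k); rewrite coef_sum; apply: eq_bigr => i _.
  by rewrite coefCM.
pose Q k := proj1_sig (constructive_indefinite_description _ (H k)).
have HQ k : x`_k = \sum_(i < j) y i * Q k i.
  exact: proj2_sig (constructive_indefinite_description _ (H k)).
exists (fun i => \poly_(k < size x) Q k i); apply/polyP => k; rewrite coef_sum.
case: (ltnP k (size x)) => kx.
  by rewrite HQ; apply: eq_bigr => i _; rewrite coefCM coef_poly kx.
rewrite nth_default // big1 // => i _; by rewrite coefCM coef_poly ltnNge kx mulr0.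
Qed.

End GeneratedIdeals.

(** * Homogeneous ideals described by ungraded membership *)

Section GradedSequences.
Variables (S : comNzRingType) (hom : int -> int -> S -> Prop) (pr : int -> int -> S -> S).
Hypotheses (HB : bigraded hom) (HP : graded_proj hom pr).

Record pr_ideal (I : S -> Prop) : Prop := PrIdeal {
  pi0 : I 0;
  piB : forall x y, I x -> I y -> I (x - y);
  piM : forall x y, I x -> I (y * x);
  pi_pr : forall a b x, I x -> I (pr a b x) }.

Definition cut (I : S -> Prop) (s : int * int) (x : S^o) : Prop := hom s.1 s.2 x /\ I x.

Lemma cut_gid I : I 0 -> (forall x y, I x -> I y -> I (x - y)) ->
  (forall x y : S, I x -> I (y * x)) -> gid hom (cut I).
Proof.
move=> I0 IB IM; split=> [s x []//|s|s x y [Hx Ix] [Hy Iy]|a b s x y Hy [Hx Ix]].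
- by split; [exact: (hom0 HB) | exact: I0].
- by split; [exact: (homB HB) | exact: IB].
- split; last exact: IM.
  by rewrite mulrC; have := homM HB Hx Hy.
Qed.

Lemma pr_cut_gid I : pr_ideal I -> gid hom (cut I).
Proof. by case=> I0 IB IM _; exact: cut_gid. Qed.

Definition addid (I : S -> Prop) y j x := exists2 z, I z & genid y j (x - z).

(** Projecting an arbitrary representation of a homogeneous [x] onto its degree makes all
    coefficients homogeneous; so graded questions reduce to ungraded membership. *)
Lemma seqidE gam y I j s x : pr_ideal I -> (forall j, hom gam.1 gam.2 (y j)) ->
  seqid hom gam y (cut I) j s x <-> hom s.1 s.2 x /\ addid I y j x.
Proof.
move=> HI Hy; have HN i := seqid_gid HB i Hy (pr_cut_gid HI); split=> [Nx|[Hx [z Iz [q e]]]].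
  split; first exact: (gid_sub (HN j) Nx).
  elim: j x Nx => [|j IH] x; first by case=> _ Ix; exists x => //; rewrite subrr; exact: genid0.
  move=> [a [w [/IH[z Iz Ga] _ ->]]]; exists z => //; apply/genidS; exists w => //.
  by rewrite addrAC addrK.
have {}e : x = pr s.1 s.2 z + \sum_(i < j) y i * pr (s.1 - gam.1) (s.2 - gam.2) (q i).
  rewrite -{1}(gp_id HP Hx) -[x](subrK z) addrC (gpD HP) e (gp_sum _ _ _ _ HP); congr (_ + _).
  apply: eq_bigr => i _; rewrite -(gpM HP _ _ _ (Hy i)); congr (pr _ _ _); ring.
rewrite e; have: cut I s (pr s.1 s.2 z).
  by split; [exact: (gp_hom HP) | exact: (pi_pr HI)].
move: (pr s.1 s.2 z) => z' Yz'; elim: j {e} => [|j IH]; first by rewrite big_ord0 addr0.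
rewrite big_ord_recr /= addrA.
by exists (z' + \sum_(i < j) y i * pr (s.1 - gam.1) (s.2 - gam.2) (q i)),
  (pr (s.1 - gam.1) (s.2 - gam.2) (q j)); split=> //; exact: (gp_hom HP).
Qed.

Lemma reg_seq_modP gam y I m : pr_ideal I -> (forall j, hom gam.1 gam.2 (y j)) ->
  (forall j z, (j < m)%N -> addid I y j (y j * z) -> addid I y j z) ->
  reg_seq_mod hom gam y (cut I) m.
Proof.
move=> HI Hy reg j s z jm Hz /(seqidE _ _ _ HI Hy)[_ /(reg _ _ jm) Iz].
by apply/(seqidE _ _ _ HI Hy).
Qed.

Lemma pr_ideal0 : pr_ideal (fun x => x = 0).
Proof.
split=> // [x y -> ->|x y ->|a b x ->]; [by rewrite subrr | by rewrite mulr0 | exact: gp0 HP].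
Qed.

Lemma addid0 y j x : addid (fun x => x = 0) y j x <-> genid y j x.
Proof. by split=> [[z ->]|Gx]; [rewrite subr0 | exists 0; rewrite ?subr0]. Qed.

Lemma pr_ideal_add I (a b : int) g : pr_ideal I -> hom a b g ->
  pr_ideal (fun x => exists2 u, I (x - g * u) & True).
Proof.
move=> HI Hg; split.
- by exists 0 => //; rewrite mulr0 subrr; exact: (pi0 HI).
- move=> x y [u Iu _] [v Iv _]; exists (u - v) => //.
  by rewrite mulrBr subr_ACA; exact: (piB HI).
- by move=> x y [u Iu _]; exists (y * u) => //; rewrite mulrCA -mulrBr; exact: (piM HI).
- move=> a' b' x [u Iu _]; exists (pr (a' - a) (b' - b) u) => //.
  rewrite -(gpM HP _ _ _ Hg) [a + _]addrC [b + _]addrC !subrK -(gpB _ _ _ _ HP).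
  exact: (pi_pr HI).
Qed.

Lemma WgE I (del : int * int) g s x : pr_ideal I -> hom del.1 del.2 g ->
  Wg hom (fun _ => cut I) del g s x <-> hom s.1 s.2 x /\ exists2 u, I (x - g * u) & True.
Proof.
move=> HI Hg; split=> [[a [z [[Ha Ia] Hz ->]]]|[Hx [u Iu _]]].
  split; last by exists z => //; rewrite addrK.
  have -> : a + g *: (z : S^o) = a - (- g) * z by rewrite mulNr opprK.
  apply: (homB HB) => //; rewrite mulNr -mulrN.
  have Hz' : hom (pdel del s).1 (pdel del s).2 (- z).
    by rewrite -sub0r; apply: (homB HB) => //; exact: (hom0 HB).
  by have := homM HB Hg Hz'; apply: hom_cast; rewrite /pdel /=; ring.
have HI' := pr_ideal_add HI Hg.
pose z := pr (s.1 - del.1) (s.2 - del.2) u.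
have e : x - g * z = pr s.1 s.2 (x - g * u).
  rewrite (gpB _ _ _ _ HP) (gp_id HP Hx) /z -(gpM HP _ _ _ Hg).
  by rewrite [del.1 + _]addrC [del.2 + _]addrC !subrK.
exists (x - g * z), z; split; [|exact: (gp_hom HP)|by rewrite subrK].
by rewrite e; split; [exact: (gp_hom HP) | exact: (pi_pr HI)].
Qed.

End GradedSequences.

(** * The variables of the base ring as a regular sequence *)

Section VariablesOfBase.
Variables (K : fieldType) (n : nat).
Local Notation P := {mpoly K[n]}.

Definition xvar (j : nat) : P := if insub j is Some i then 'X_i else 0.

Lemma xvarE (i : 'I_n) : xvar i = 'X_i.
Proof. by rewrite /xvar valK. Qed.

Lemma xvar_form j : is_form 1 (xvar j).
Proof.
rewrite /xvar; case: insubP => [i _ _|_]; last exact: dhomog0.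
by rewrite /is_form dhomogX; apply/eqP; exact: mdeg1.
Qed.

(** Membership in a monomial ideal is decided monomial by monomial. *)
Lemma genid_xvar j (p : P) :
  genid xvar j p <-> forall m, m \in msupp p -> exists i : 'I_n, (i < j)%N /\ (0 < m i)%N.
Proof.
split=> [[q ->] m|H].
  rewrite mcoeff_msupp => nz; apply: NNPP => nex; move/eqP: nz; apply.
  rewrite raddf_sum big1 // => i _; rewrite /xvar; case: insubP => [k ki ei|_]; last by rewrite mul0r raddf0.
  apply/eqP; rewrite mcoeff_eq0; apply/negP; rewrite mulrC (perm_mem (msuppMX _ _)).
  move=> /mapP[m' _ em]; apply: nex; exists k; rewrite ei; split=> //.
  by rewrite em mnmDE mnm1E eqxx.
rewrite [p]mpolyE big_seq; elim/big_ind: _ => //; [exact: genid0 | exact: genidD |].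
move=> m /H[i [ij mi]].
have -> : p@_m *: 'X_[m] = xvar i * (p@_m *: 'X_[m - U_(i)]) :> P.
  rewrite xvarE -scalerAr -mpolyXD addmC submK //.
  by apply/mnm_lepP => k; rewrite mnm1E; case: eqP => [<-|].
exact: genid_gen.
Qed.

Lemma xvar_regular j (p : P) : (j < n)%N -> genid xvar j (xvar j * p) -> genid xvar j p.
Proof.
move=> jn /genid_xvar H; apply/genid_xvar => m mp.
have [i [ij]] : exists i : 'I_n, (i < j)%N /\ (0 < (U_(Ordinal jn) + m)%MM i)%N.
  apply: H; rewrite -[j]/(val (Ordinal jn)) xvarE mulrC (perm_mem (msuppMX _ _)).
  exact: map_f.
rewrite mnmDE mnm1E -val_eqE /= gtn_eqF // add0n => mi; by exists i.
Qed.

Lemma form_xvar D (p : P) : is_form D.+1 p -> genid xvar n p.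
Proof.
move=> Hp; apply/genid_xvar => m /(dhomog_mf Hp) mD.
apply: NNPP => nex; suff: mdeg m = 0%N by rewrite mD.
rewrite mdegE big1 // => i _; apply/eqP; rewrite -leqn0 leqNgt; apply/negP => mi.
by apply: nex; exists i.
Qed.

End VariablesOfBase.

(** * Membership and divisibility, coefficient by coefficient *)

Section PolynomialLifting.
Variable R : comNzRingType.

Lemma poly_split (x : {poly R}) :
  exists y, x = (x`_0)%:P + 'X * y /\ forall i, y`_i = x`_i.+1.
Proof.
exists (\poly_(i < size x) x`_i.+1).
have E i : (\poly_(i < size x) x`_i.+1)`_i = x`_i.+1.
  rewrite coef_poly; case: ltnP => // le; by rewrite nth_default // ltnW.
split=> //; apply/polyP => -[|i]; rewrite coefD coefC coefXM ?addr0 //=.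
by rewrite add0r E.
Qed.

Lemma mulX_inj (x y : {poly R}) : 'X * x = 'X * y -> x = y.
Proof. by move=> /polyP e; apply/polyP => i; have := e i.+1; rewrite !coefXM. Qed.

Lemma coef0_mulX (x : {poly R}) : x`_0 = 0 <-> exists y, x = 'X * y.
Proof.
split=> [x0|[y ->]]; last by rewrite coefXM.
by have [y [e _]] := poly_split x; exists y; rewrite {1}e x0 polyC0 add0r.
Qed.

Definition divs (a x : R) := exists w, x = a * w.

Lemma genid_lift_regular (y : nat -> R) j :
  (forall x, genid y j (y j * x) -> genid y j x) ->
  forall x : {poly R}, genid (fun i => (y i)%:P) j ((y j)%:P * x) -> genid (fun i => (y i)%:P) j x.
Proof.
move=> H x /genid_poly Hx; apply/genid_poly => k; apply: H.
by have := Hx k; rewrite coefCM.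
Qed.

Lemma genid_lift_cover (h : int -> int -> R -> Prop) (y : nat -> R) n a b (x : {poly R}) :
  (forall b z, h a b z -> genid y n z) -> hpoly h a b x -> genid (fun i => (y i)%:P) n x.
Proof. by move=> H Hx; apply/genid_poly => k; exact: H (Hx k). Qed.

Lemma hpoly_tail (h : int -> int -> R -> Prop) (a b : int) (x y : {poly R}) :
  hpoly h a b x -> (forall i, y`_i = x`_i.+1) -> hpoly h a (b - 1) y.
Proof. by move=> Hx E i; rewrite E; have := Hx i.+1; apply: hom_cast => //; lia. Qed.

Lemma hpoly_coef0 (h : int -> int -> R -> Prop) (a b : int) (x : {poly R}) :
  hpoly h a b x -> h a b x`_0.
Proof. by move=> Hx; have := Hx 0%N; rewrite subr0. Qed.

End PolynomialLifting.

Lemma divs_poly (R : comNzRingType) (a : R) (x : {poly R}) :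
  divs a%:P x <-> forall k, divs a x`_k.
Proof.
have E (Q : comNzRingType) (c z : Q) : divs c z <-> genid (fun=> c) 1 z.
  by split=> [[w ->]|[q ->]]; [exists (fun=> w); rewrite big_ord1 | rewrite big_ord1; exists (q 0%N)].
split=> [/E/genid_poly H k|H]; first exact/E/H.
by apply/E/genid_poly => k; exact/E.
Qed.

Lemma divs_lift (R : comNzRingType) (a c : R) :
  (forall x, divs a (c * x) -> divs a x) -> forall x : {poly R}, divs a%:P (c%:P * x) -> divs a%:P x.
Proof.
move=> H x /divs_poly Hx; apply/divs_poly => k; apply: H.
by have := Hx k; rewrite coefCM.
Qed.

Lemma divs_mulX (R : comNzRingType) (a : R) (x : {poly R}) : divs a%:P ('X * x) -> divs a%:P x.
Proof. by move=> /divs_poly Hx; apply/divs_poly => k; have := Hx k.+1; rewrite coefXM. Qed.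

(** * The equations of the Rees algebra *)

(** The variables are adjoined one at a time: t3 to [P], then t2 to [R] = P[t3], where [tau]
    is t3, then t1 to [R] = P[t2, t3], where [z] lists t2 and t3; the [psi]'s are the f's in
    [R], and [rho] sends each t to the corresponding f. *)
Section Level1.
Variables (P : comNzRingType) (h : int -> int -> P -> Prop).
Hypothesis HB : bigraded h.
Hypothesis hpos : forall (a b : int) p, 0 < b -> h a b p -> p = 0.
Variables (f1 f2 f3 : P).
Hypothesis reg3 : forall p u v, f3 * p = f1 * u + f2 * v -> exists u' v', p = f1 * u' + f2 * v'.

Lemma level1_split (a b : int) (x : {poly P}) : 0 < b -> hpoly h a b x ->
  exists2 y, hpoly h a (b - 1) y & x = 'X * y.
Proof.
move=> b0 Hx; have [y [ex ey]] := poly_split x; exists y; first exact: hpoly_tail Hx ey.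
by rewrite {1}ex (hpos b0 (hpoly_coef0 Hx)) polyC0 add0r.
Qed.

Lemma level1_deg0 (a : int) (x : {poly P}) : hpoly h a 0 x -> x = (x`_0)%:P.
Proof. by move=> Hx; apply: size1_polyC; exact: (hpoly_size HB (b := 0) Hx). Qed.

(** An element of positive t-degree is t3 times another one, so evaluation gains a factor f3, which
    cancels modulo (f1, f2). *)
Lemma level1_kernel (a : int) (b : nat) (x : {poly P}) u v : hpoly h a b x ->
  x.[f3] = f1 * u + f2 * v -> exists u' v', x = f1%:P * u' + f2%:P * v'.
Proof.
elim: b x u v => [|b IH] x u v Hx ex.
  exists u%:P, v%:P; rewrite -!polyCM -polyCD -ex; move: (level1_deg0 Hx) => e.
  by rewrite e hornerC.
have [//|y Hy exy] := level1_split _ Hx.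
have Hy' : hpoly h a b y by move: Hy; apply: hom_cast => //; lia.
have : f3 * y.[f3] = f1 * u + f2 * v by rewrite -ex exy hornerM hornerX.
move=> /reg3[u1 [v1 /(IH _ _ _ Hy')[u' [v' ey]]]].
exists ('X * u'), ('X * v'); rewrite exy ey mulrDr; congr (_ + _); exact: mulrCA.
Qed.

End Level1.

Section Level2.
Variables (P R : comNzRingType) (h : int -> int -> R -> Prop) (pr : int -> int -> R -> R).
Hypotheses (HB : bigraded h) (HP : graded_proj h pr).
Variables (tau psi1 psi2 psi3 : R) (rho : {rmorphism R -> P}) (f1 f2 f3 : P) (d : nat).
Hypothesis Hpsi1 : h d%:Z 0 psi1.
Hypothesis Hpsi2 : h d%:Z 0 psi2.
Hypothesis Hpsi3 : h d%:Z 0 psi3.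
Hypothesis Htau : h 0 1 tau.
Hypothesis rho1 : rho psi1 = f1.
Hypothesis rho2 : rho psi2 = f2.
Hypothesis rho3 : rho psi3 = f3.
Hypothesis rho_tau : rho tau = f3.
Hypothesis tau_reg : forall x, tau * x = 0 -> x = 0.
Hypothesis tau_div : forall x, divs psi1 (tau * x) -> divs psi1 x.
Hypothesis psi2_div : forall x, divs psi1 (psi2 * x) -> divs psi1 x.
Hypothesis f2_div : forall p, divs f1 (f2 * p) -> divs f1 p.
Hypothesis split1 : forall (a b : int) x, 0 < b -> h a b x -> exists2 y, h a (b - 1) y & x = tau * y.
Hypothesis kernel1 : forall (a : int) (b : nat) x u v, h a b x -> rho x = f1 * u + f2 * v ->
  exists u' v', x = psi1 * u' + psi2 * v'.
Hypothesis kernel0 : forall (a : int) x, h a 0 x -> divs f1 (rho x) -> divs psi1 x.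

Definition minor3 : {poly R} := 'X * psi3%:P - tau%:P * psi2%:P.
Definition ev2 (x : {poly R}) : P := (map_poly rho x).[f2].

Lemma ev2B x y : ev2 (x - y) = ev2 x - ev2 y.
Proof. by rewrite /ev2 rmorphB hornerD hornerN. Qed.

Lemma ev2M x y : ev2 (x * y) = ev2 x * ev2 y.
Proof. by rewrite /ev2 rmorphM hornerM. Qed.

Lemma ev2D x y : ev2 (x + y) = ev2 x + ev2 y.
Proof. by rewrite /ev2 rmorphD hornerD. Qed.

Lemma ev2C c : ev2 c%:P = rho c.
Proof. by rewrite /ev2 map_polyC hornerC. Qed.

Lemma ev2X : ev2 'X = f2.
Proof. by rewrite /ev2 map_polyX hornerX. Qed.

Lemma ev2_minor3 : ev2 minor3 = 0.
Proof. by rewrite ev2B !ev2M !ev2C ev2X rho2 rho3 rho_tau mulrC subrr. Qed.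

Lemma coef0_minor3 : minor3`_0 = - (tau * psi2).
Proof. by rewrite /minor3 coefB coefXM /= -polyCM coefC sub0r. Qed.

(** The constant term of [minor3] in t2 is -t3 f2, a product of two elements regular modulo f1; the
    coefficients of [x] are divided by f1 one after the other. *)
Lemma minor3_div x : divs psi1%:P (minor3 * x) -> divs psi1%:P x.
Proof.
have [N] := ubnP (size x); elim: N x => // N IH x sx Hx.
have [y [ex ey]] := poly_split x.
have [w ew] : divs psi1 x`_0.
  apply/psi2_div/tau_div; have := (divs_poly psi1 _).1 Hx 0%N.
  rewrite coef0M coef0_minor3 mulNr -mulrA => -[w e].
  by exists (- w); rewrite mulrN -e opprK.
case: (eqVneq x 0) => [->|xn0]; first by exists 0; rewrite mulr0.
have sy : (size y <= (size x).-1)%N.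
  by apply/leq_sizeP => j jx; rewrite ey nth_default //; case: (size x) jx.
have [w' ew'] : divs psi1%:P y.
  apply: IH; first by move: sx sy xn0; rewrite -size_poly_gt0; case: (size x) => // m sx sy _; exact: leq_ltn_trans sy _.
  apply: divs_mulX; case: Hx => q eq.
  exists (q - minor3 * w%:P); rewrite mulrBr -eq {1}ex ew polyCM; ring.
exists (w%:P + 'X * w'); rewrite ex ew ew' polyCM; ring.
Qed.

Lemma level2_split (a b : int) x : 0 < b -> hpoly h a b x ->
  exists x1 x2, [/\ hpoly h a (b - 1) x1, hpoly h a (b - 1) x2 & x = 'X * x1 + tau%:P * x2].
Proof.
move=> b0 Hx; have [y [ex ey]] := poly_split x.
have [z Hz ez] := split1 b0 (hpoly_coef0 Hx).
exists y, z%:P; split; [exact: hpoly_tail Hx ey | exact: (hpolyC HB) |].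
by rewrite {1}ex ez polyCM addrC.
Qed.

Lemma level2_regular x u : tau%:P * x = 'X * u -> exists v, x = 'X * v.
Proof.
move=> e; apply/coef0_mulX/tau_reg; have := congr1 (fun p : {poly R} => p`_0) e.
by rewrite coefCM coefXM.
Qed.

(** Equations of the Rees algebra of (f2, f3) modulo f1. The constant term of [x] in t2 lies in
    (psi1, psi2), with coefficient t3 w at psi2. Replacing t3 psi2 by t2 psi3 - [minor3] leaves a
    multiple t2 z, and f2 cancels modulo f1, so z has smaller t-degree and lies in the kernel. *)
Lemma level2_kernel (a : int) (b : nat) x : hpoly h a b x -> divs f1 (ev2 x) ->
  exists q k, x = minor3 * q + psi1%:P * k.
Proof.
have HPp := prpoly_proj HP; have HBp := hpoly_bigraded HB.
have Hm3 : hpoly h d%:Z 1 minor3.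
  apply: (homB HBp).
    by have := homM HBp (hpolyX HB) (hpolyC HB Hpsi3); rewrite add0r addr0.
  by have := homM HBp (hpolyC HB Htau) (hpolyC HB Hpsi2); rewrite add0r addr0.
elim: b x => [|b IH] x Hx [p ep].
  have ex : x = (x`_0)%:P by apply: size1_polyC; exact: (hpoly_size HB (b := 0) Hx).
  have [|k ek] := kernel0 (hpoly_coef0 Hx); first by exists p; rewrite -ep {2}ex ev2C.
  by exists 0, k%:P; rewrite mulr0 add0r -polyCM -ek.
have [y [ex ey]] := poly_split x.
have e0 : rho x`_0 = f1 * p + f2 * (- ev2 y).
  by rewrite -ep {2}ex ev2D ev2M ev2C ev2X mulrN addrK.
have [u [v euv]] := kernel1 (hpoly_coef0 Hx) e0.
have Hv := gp_hom HP (a - d%:Z) b.+1 v.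
have [//|w Hw ew] := split1 _ Hv.
have euv' : x`_0 = psi1 * pr (a - d%:Z) b.+1 u + psi2 * (tau * w).
  rewrite -ew -(gpM HP _ _ _ Hpsi1) -(gpM HP _ _ _ Hpsi2) -(gpD HP) -euv.
  by rewrite [_ + (a - _)]addrC subrK add0r (gp_id HP (hpoly_coef0 Hx)).
pose z := y + psi3%:P * w%:P.
have exz : x = psi1%:P * (pr (a - d%:Z) b.+1 u)%:P - minor3 * w%:P + 'X * z.
  rewrite {1}ex euv' polyCD !polyCM /z /minor3; ring.
have Hz : hpoly h a b z.
  apply: (gidD (unit_gid HBp) (s := (a, b%:Z))).
    by have := hpoly_tail Hx ey; apply: hom_cast => /=; lia.
  by have := homM HBp (hpolyC HB Hpsi3) (hpolyC HB Hw); apply: hom_cast => /=; lia.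
clearbody z.
have [q [k ezk]] : exists q k, z = minor3 * q + psi1%:P * k.
  apply: IH Hz _; apply: f2_div.
  exists (p - rho (pr (a - d%:Z) b.+1 u)); rewrite mulrBr -ep [in ev2 x]exz.
  rewrite ev2D ev2B !ev2M !ev2C ev2X ev2_minor3 rho1; ring.
exists ('X * q - w%:P), ((pr (a - d%:Z) b.+1 u)%:P + 'X * k); rewrite exz ezk; ring.
Qed.

End Level2.

Lemma genidM (R : comNzRingType) (y : nat -> R) j x z : genid y j x -> genid y j (x * z).
Proof.
by move=> [q ->]; exists (fun i => q i * z); rewrite mulr_suml; apply: eq_bigr => i _; rewrite mulrA.
Qed.

Section Level3.
Variables (P R : idomainType) (h : int -> int -> R -> Prop) (pr : int -> int -> R -> R).
Hypotheses (HB : bigraded h) (HP : graded_proj h pr).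
Variables (y z : nat -> R) (n : nat) (psi1 psi2 psi3 : R) (rho : {rmorphism R -> P}).
Variables (f1 f2 f3 : P) (d : nat).
Hypothesis d0 : (0 < d)%N.
Hypotheses (Hpsi1 : h d%:Z 0 psi1) (Hpsi2 : h d%:Z 0 psi2) (Hpsi3 : h d%:Z 0 psi3).
Hypotheses (Hy : forall j, h 1 0 (y j)) (Hz : forall j, h 0 1 (z j)).
Hypotheses (rho1 : rho psi1 = f1) (rho2 : rho psi2 = f2) (rho3 : rho psi3 = f3).
Hypotheses (rhoz0 : rho (z 0%N) = f2) (rhoz1 : rho (z 1%N) = f3).
Hypothesis f1n0 : f1 != 0.
Hypothesis z0n0 : z 0%N != 0.
Hypothesis yreg : forall j x, (j < n)%N -> genid y j (y j * x) -> genid y j x.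
Hypothesis zreg : forall j x, (j < 2)%N -> genid z j (z j * x) -> genid z j x.
Hypothesis ycover : forall (a b : int) x, 0 < a -> h a b x -> genid y n x.
Hypothesis zcover : forall (a b : int) x, 0 < b -> h a b x -> genid z 2 x.
Hypothesis psi1_z : forall x, genid z 2 (psi1 * x) -> genid z 2 x.
Local Notation m3 := (z 0%N * psi3 - z 1%N * psi2).
Hypothesis m3_div : forall x, divs psi1 (m3 * x) -> divs psi1 x.
Hypothesis kernel2 : forall (a : int) (b : nat) x, h a b x -> divs f1 (rho x) ->
  exists q k, x = m3 * q + psi1 * k.
Hypothesis rho_inj : forall (a : int) x, h a 0 x -> rho x = 0 -> x = 0.

Local Notation S := {poly R}.
Let hS : int -> int -> S -> Prop := hpoly h.
Let prS : int -> int -> S -> S := prpoly pr.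
Let HBS : bigraded hS := hpoly_bigraded HB.
Let HPS : graded_proj hS prS := prpoly_proj HP.

Definition g1 : S := 'X * psi2%:P - (z 0%N)%:P * psi1%:P.
Definition g2 : S := 'X * psi3%:P - (z 1%N)%:P * psi1%:P.
Definition g3 : S := m3%:P.
Definition ev3 (x : S) : P := (map_poly rho x).[f1].

Lemma ev3B x x' : ev3 (x - x') = ev3 x - ev3 x'.
Proof. by rewrite /ev3 rmorphB hornerD hornerN. Qed.
Lemma ev3M x x' : ev3 (x * x') = ev3 x * ev3 x'.
Proof. by rewrite /ev3 rmorphM hornerM. Qed.
Lemma ev3D x x' : ev3 (x + x') = ev3 x + ev3 x'.
Proof. by rewrite /ev3 rmorphD hornerD. Qed.
Lemma ev3C c : ev3 c%:P = rho c.
Proof. by rewrite /ev3 map_polyC hornerC. Qed.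
Lemma ev3X : ev3 'X = f1.
Proof. by rewrite /ev3 map_polyX hornerX. Qed.

Lemma ev3_g1 : ev3 g1 = 0.
Proof. by rewrite ev3B !ev3M !ev3C ev3X rho1 rho2 rhoz0 mulrC subrr. Qed.
Lemma ev3_g2 : ev3 g2 = 0.
Proof. by rewrite ev3B !ev3M !ev3C ev3X rho1 rho3 rhoz1 mulrC subrr. Qed.
Lemma ev3_g3 : ev3 g3 = 0.
Proof. by rewrite ev3C rmorphB !rmorphM rho2 rho3 rhoz0 rhoz1 mulrC subrr. Qed.

Lemma psi1n0 : psi1 != 0.
Proof. by apply: contraNneq f1n0 => p0; rewrite -rho1 p0 rmorph0. Qed.

Lemma coef0_g1 : g1`_0 = - (z 0%N * psi1).
Proof. by rewrite /g1 coefB coefXM /= -polyCM coefC sub0r. Qed.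
Lemma coef0_g2 : g2`_0 = - (z 1%N * psi1).
Proof. by rewrite /g2 coefB coefXM /= -polyCM coefC sub0r. Qed.

Lemma g1n0 : g1 != 0.
Proof.
apply/eqP => /(congr1 (fun p : S => p`_0)); rewrite coef0_g1 coef0 => /eqP.
by rewrite oppr_eq0 mulf_eq0 (negPf z0n0) (negPf psi1n0).
Qed.

(** The g's are the 2 x 2 minors of the matrix with rows (t1, t2, t3) and (f1, f2, f3). Repeating a
    row and expanding the determinant gives this relation and the next. *)
Lemma t1g3 : 'X * g3 = (z 0%N)%:P * g2 - (z 1%N)%:P * g1.
Proof. rewrite /g1 /g2 /g3 polyCB !polyCM; ring. Qed.
Lemma psi1g3 : psi1%:P * g3 = psi2%:P * g2 - psi3%:P * g1.
Proof. rewrite /g1 /g2 /g3 polyCB !polyCM; ring. Qed.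

Let X_hom : hS 0 1 'X. Proof. exact: (hpolyX HB). Qed.
Let C_hom a b c : h a b c -> hS a b c%:P. Proof. exact: (hpolyC HB). Qed.

Lemma g1_hom : hS d%:Z 1 g1.
Proof.
apply: (homB HBS).
  by have := homM HBS X_hom (C_hom Hpsi2); rewrite add0r addr0.
by have := homM HBS (C_hom (Hz 0%N)) (C_hom Hpsi1); rewrite add0r addr0.
Qed.
Lemma g2_hom : hS d%:Z 1 g2.
Proof.
apply: (homB HBS).
  by have := homM HBS X_hom (C_hom Hpsi3); rewrite add0r addr0.
by have := homM HBS (C_hom (Hz 1%N)) (C_hom Hpsi1); rewrite add0r addr0.
Qed.
Lemma g3_hom : hS d%:Z 1 g3.
Proof.
apply: C_hom; apply: (homB HB).
  by have := homM HB (Hz 0%N) Hpsi3; rewrite add0r addr0.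
by have := homM HB (Hz 1%N) Hpsi2; rewrite add0r addr0.
Qed.

Lemma z0_div x : divs (z 0%N) (z 1%N * x) -> divs (z 0%N) x.
Proof.
have E (w : R) : divs (z 0%N) w <-> genid z 1 w.
  by split=> [[v ->]|[q ->]]; [exists (fun=> v); rewrite big_ord1 | rewrite big_ord1; exists (q 0%N)].
by move=> /E H; apply/E; exact: zreg.
Qed.

(** The constant term -t2 f1 of [g1] is nonzero in a domain, so t1 is regular modulo [g1]. *)
Lemma g1_divX x : divs g1 ('X * x) -> divs g1 x.
Proof.
move=> [w e]; have : g1`_0 * w`_0 = 0 by rewrite -coef0M -e coefXM.
rewrite coef0_g1 => /eqP; rewrite mulf_eq0 oppr_eq0 mulf_eq0 (negPf z0n0) (negPf psi1n0) /=.
move=> /eqP/coef0_mulX[v ev]; exists v; apply: mulX_inj; by rewrite e ev mulrCA.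
Qed.

(* Modulo g1, an element whose product with g2 vanishes is a multiple of t1,
   which allows an induction on the t-degree. *)
Lemma g2_regular (a : int) (b : nat) x : hS a b x -> divs g1 (g2 * x) -> divs g1 x.
Proof.
have key a' b' w : hS a' b' w -> divs g1 (g2 * w) ->
    exists u v, [/\ w = 'X * u - g1 * v, hS a' (b' - 1) u & divs g1 (g2 * u)].
  move=> Hw [al e].
  have e0 : z 1%N * w`_0 = z 0%N * al`_0.
    have := congr1 (fun p : S => p`_0) e; rewrite !coef0M coef0_g1 coef0_g2 !mulNr => /oppr_inj.
    rewrite -!mulrA ![psi1 * _]mulrC !mulrA => /(mulIf psi1n0); exact.
  have [k ek] : divs (z 0%N) w`_0 by apply: z0_div; exists al`_0.
  have ea : al`_0 = z 1%N * k by apply: (mulfI z0n0); rewrite -e0 ek mulrCA.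
  have [w' [ew _]] := poly_split w; have [al' [eal _]] := poly_split al.
  (* The constant terms of [w] and [al] are t2 k and t3 k; their contribution to g2 w - g1 al is k
     t1 g3, and t1 cancels. *)
  have ek3 : k%:P * g3 + w' * g2 = al' * g1.
    apply: mulX_inj; rewrite mulrDr mulrCA t1g3; apply/eqP; rewrite -subr_eq0; apply/eqP.
    move: e; rewrite {1}ew {1}eal ek ea !polyCM => /eqP; rewrite -subr_eq0 => /eqP e.
    by rewrite -[RHS]e; ring.
  have [k2 ek2] : divs psi1 k.
    apply: m3_div; have := congr1 (fun p : S => p`_0) ek3.
    rewrite coefD !coef0M !coefC /= coef0_g1 coef0_g2 => e'.
    exists (z 1%N * w'`_0 - z 0%N * al'`_0).
    have -> : m3 * k = al'`_0 * - (z 0%N * psi1) - w'`_0 * - (z 1%N * psi1).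
      by rewrite -e' addrK mulrC.
    ring.
  (* Since t2 psi1 = t1 psi2 - g1, the constant term t2 psi1 k2 of [w] is t1 psi2 k2 modulo [g1].
     The projections make the witnesses homogeneous. *)
  pose u := prS a' (b' - 1) (w' + psi2%:P * k2%:P); pose v := prS (a' - d%:Z) (b' - 1) k2%:P.
  have ewuv : w = 'X * u - g1 * v.
    rewrite /u /v -(gpM HPS _ _ _ X_hom) -(gpM HPS _ _ _ g1_hom) -[LHS](gp_id HPS Hw).
    rewrite add0r [1 + _]addrC [d%:Z + _]addrC !subrK -(gpB _ _ _ _ HPS); congr (prS _ _ _).
    rewrite {1}ew ek ek2 !polyCM /g1; ring.
  exists u, v; split=> //; first exact: (gp_hom HPS).
  apply: g1_divX; exists (al + g2 * v).
  have -> : 'X * (g2 * u) = g2 * w + g1 * (g2 * v) by rewrite ewuv; ring.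
  by rewrite e mulrDr.
elim: b x => [|b IH] x Hx Dx; have [u [v [ex Hu Du]]] := key _ _ _ Hx Dx.
  have u0 : u = 0 by apply: (hom_neg HBS _ Hu); apply/orP; right.
  by exists (- v); rewrite ex u0 mulr0 sub0r mulrN.
have [w ew] : divs g1 u by apply: IH => //; move: Hu; apply: hom_cast => //; lia.
by exists ('X * w - v); rewrite ex ew; ring.
Qed.

Lemma split3 (a b : int) x : 0 < b -> hS a b x ->
  exists x1 x2 x3, x = 'X * x1 + (z 0%N)%:P * x2 + (z 1%N)%:P * x3.
Proof.
move=> b0 Hx; have [x1 [ex _]] := poly_split x.
have [q eq] := zcover b0 (hpoly_coef0 Hx).
exists x1, (q 0%N)%:P, (q 1%N)%:P.
by rewrite {1}ex eq !big_ord_recl big_ord0 addr0 polyCD !polyCM addrC addrA.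
Qed.

(** The constant term of [x] in t1 evaluates into (f1), so it is m3 q + psi1 k by [kernel2]. Here k
    has positive t-degree, and t2 psi1 and t3 psi1 are multiples of t1 modulo g1 and g2. Hence [x]
    is t1 u modulo the g's, and cancelling f1 puts u, of smaller t-degree, in the kernel. *)
Lemma kernel3 (a : int) (b : nat) x : hS a b x -> ev3 x = 0 ->
  exists u v w, x = g1 * u + g2 * v + g3 * w.
Proof.
elim: b x => [|b IH] x Hx ex0.
  have ex : x = (x`_0)%:P by apply: size1_polyC; exact: (hpoly_size HB (b := 0) Hx).
  exists 0, 0, 0; rewrite !mulr0 !addr0 ex; have -> : x`_0 = 0; last by [].
  by apply: (rho_inj (hpoly_coef0 Hx)); rewrite -ev3C -ex.
have [x1 [ex _]] := poly_split x.
have [q [k exk]] : exists q k, x`_0 = m3 * q + psi1 * k.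
  apply: (kernel2 (hpoly_coef0 Hx)); exists (- ev3 x1).
  by move: ex0; rewrite {1}ex ev3D ev3M ev3C ev3X mulrN => /eqP; rewrite addr_eq0 => /eqP.
have [//|k1 [k2 [k3 ek]]] := split3 _ (gp_hom HPS (a - d%:Z) b.+1 k%:P).
pose u := prS a b (x1 + psi1%:P * k1 + psi2%:P * k2 + psi3%:P * k3).
pose m := prS a b.+1 (g3 * q%:P - g1 * k2 - g2 * k3).
have exu : x = m + 'X * u.
  rewrite /m /u -(gpM HPS _ _ _ X_hom) -[LHS](gp_id HPS Hx).
  have -> : 0 + a = a by rewrite add0r.
  have -> : 1 + b%:Z = b.+1%:Z by lia.
  rewrite -(gpD HPS) -[in LHS](_ : g3 * q%:P + psi1%:P * k%:P + 'X * x1 = x); last first.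
    by rewrite [RHS]ex exk polyCD !polyCM.
  have E : prS a b.+1 (psi1%:P * k%:P) =
           prS a b.+1 (psi1%:P * ('X * k1 + (z 0%N)%:P * k2 + (z 1%N)%:P * k3)).
    rewrite -{2}(subrK d%:Z a) addrC -[b.+1%:Z]add0r -ek.
    rewrite -{1}[a](subrK d%:Z) [_ - _ + _]addrC.
    rewrite (gpM HPS _ _ _ (C_hom Hpsi1)).
    by rewrite (gpM HPS _ _ _ (C_hom Hpsi1)) (gp_id HPS (gp_hom HPS _ _ _)).
  rewrite !(gpD HPS) E -!(gpD HPS); congr (prS _ _ _); rewrite /g1 /g2 /g3; ring.
have Em : exists u' v' w', m = g1 * u' + g2 * v' + g3 * w'.
  rewrite /m; exists (prS (a - d%:Z) (b.+1%:Z - 1) (- k2)), (prS (a - d%:Z) (b.+1%:Z - 1) (- k3)),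
    (prS (a - d%:Z) (b.+1%:Z - 1) q%:P).
  rewrite -(gpM HPS _ _ _ g1_hom) -(gpM HPS _ _ _ g2_hom) -(gpM HPS _ _ _ g3_hom).
  rewrite [d%:Z + _]addrC [1 + _]addrC !subrK -!(gpD HPS); congr (prS _ _ _); ring.
have [u' [v' [w' em]]] := Em.
have : f1 * ev3 u = 0.
  rewrite -ex0 {1}exu em ev3D !ev3D !ev3M ev3_g1 ev3_g2 ev3_g3 !mul0r !add0r ev3X; by [].
move/eqP; rewrite mulf_eq0 (negPf f1n0) => /eqP eu0.
have [u1 [v1 [w1 eu]]] := IH u (gp_hom HPS _ _ _) eu0.
exists (u' + 'X * u1), (v' + 'X * v1), (w' + 'X * w1).
rewrite exu em eu; ring.
Qed.

Definition zeroI (x : S) : Prop := x = 0.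
Definition t1I (x : S) : Prop := x`_0 = 0.
Definition I1 (x : S) : Prop := exists2 u, zeroI (x - g1 * u) & True.
Definition I2 (x : S) : Prop := exists2 v, I1 (x - g2 * v) & True.
Definition WI (x : S) : Prop := exists2 u, t1I (x - psi1%:P * u) & True.
Definition kerI (x : S) : Prop := ev3 x = 0.

Lemma I2E x : I2 x <-> exists u v, x = g1 * u + g2 * v.
Proof.
split=> [[v [u e _] _]|[u [v ->]]].
  by exists u, v; apply/eqP; rewrite -subr_eq0 opprD addrA addrAC e.
by exists v => //; exists u => //; rewrite /zeroI addrK subrr.
Qed.

Lemma I1E x : I1 x <-> divs g1 x.
Proof.
split=> [[u e _]|[u ->]]; last by exists u => //; rewrite /zeroI subrr.
by exists u; apply/eqP; rewrite -subr_eq0 e.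
Qed.

Lemma zeroI_pr : pr_ideal prS zeroI. Proof. exact: (pr_ideal0 HPS). Qed.

Lemma t1I_pr : pr_ideal prS t1I.
Proof.
split=> [|x w Ix Iw|x w Ix|a b x Ix]; rewrite /t1I.
- exact: coef0.
- by rewrite coefB Ix Iw subrr.
- by rewrite coef0M Ix mulr0.
- by rewrite (coef_prpoly HP) Ix (gp0 _ _ HP).
Qed.

Lemma I1_pr : pr_ideal prS I1. Proof. exact: (pr_ideal_add HPS zeroI_pr g1_hom). Qed.
Lemma I2_pr : pr_ideal prS I2. Proof. exact: (pr_ideal_add HPS I1_pr g2_hom). Qed.

Lemma kerI_gid : gid hS (cut hS kerI).
Proof.
apply: (cut_gid HBS); rewrite /kerI.
- by rewrite /ev3 rmorph0 horner0.
- by move=> x w Ix Iw; rewrite ev3B Ix Iw subrr.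
- by move=> x w Ix; rewrite ev3M Ix mulr0.
Qed.

Lemma WI_coef0 x : WI x <-> divs psi1 x`_0.
Proof.
split=> [[u]|[u e]]; rewrite /t1I.
  by rewrite coefB coefCM => /eqP; rewrite subr_eq0 => /eqP -> _; exists u`_0.
by exists u%:P => //; rewrite /t1I coefB coefCM coefC /= -e subrr.
Qed.

Lemma I2_W x : I2 x -> WI x.
Proof.
move=> /I2E[u [v ->]]; apply/WI_coef0; exists (- (z 0%N * u`_0 + z 1%N * v`_0)).
rewrite coefD !coef0M coef0_g1 coef0_g2; ring.
Qed.

Lemma I2_ker x : I2 x -> kerI x.
Proof. by move=> /I2E[u [v ->]]; rewrite /kerI ev3D !ev3M ev3_g1 ev3_g2 !mul0r addr0. Qed.

(* (g1, g2) : g3 = (t1, f1) *)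
Lemma g3_colon x : WI x <-> I2 (g3 * x).
Proof.
split=> [[u]|/I2E[u [v e]]].
  move=> /coef0_mulX[w ew] _; apply/I2E.
  have -> : x = 'X * w + psi1%:P * u by rewrite -ew subrK.
  exists (- ((z 1%N)%:P * w + psi3%:P * u)), ((z 0%N)%:P * w + psi2%:P * u).
  by rewrite mulrDr !mulrA ![g3 * _]mulrC t1g3 psi1g3; ring.
apply/WI_coef0/m3_div; have := congr1 (fun p : S => p`_0) e.
rewrite coefD !coef0M coef0_g1 coef0_g2 coefC /= => ->.
exists (- (z 0%N * u`_0 + z 1%N * v`_0)); ring.
Qed.

Let yS (j : nat) : S := (y j)%:P.
Let zS' (j : nat) : S := (z j)%:P.
Let zS (j : nat) : S := if j is j'.+1 then zS' j' else 'X.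

Lemma yS_hom j : hS 1 0 (yS j). Proof. exact/C_hom/Hy. Qed.
Lemma zS'_hom j : hS 0 1 (zS' j). Proof. exact/C_hom/Hz. Qed.
Lemma zS_hom j : hS 0 1 (zS j). Proof. by case: j => [|j]; [exact: X_hom | exact: zS'_hom]. Qed.

Lemma addid_t1 (w : nat -> R) j (x : S) :
  addid t1I (fun i => (w i)%:P) j x <-> genid w j x`_0.
Proof.
split=> [[x' x0 /genid_poly/(_ 0%N)]|Gx]; first by rewrite coefB x0 subr0.
have [x' [e _]] := poly_split x; exists ('X * x'); first by rewrite /t1I coefXM.
rewrite {1}e addrK; apply/genid_poly => k; rewrite coefC; case: eqP => // _; exact: genid0.
Qed.

Lemma genid_zS j x : genid zS j.+1 x <-> addid t1I zS' j x.
Proof.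
have E (q : nat -> S) : \sum_(i < j.+1) zS i * q i = 'X * q 0%N + \sum_(i < j) zS' i * q i.+1.
  by rewrite big_ord_recl.
split=> [[q ->]|[w /coef0_mulX[v ->] [q e]]].
  exists ('X * q 0%N); first by rewrite /t1I coefXM.
  by rewrite E addrC addKr; exists (fun i => q i.+1).
pose q' i := if i is i'.+1 then q i' else v.
by exists q'; rewrite (E q') /= -e addrC subrK.
Qed.

Lemma yS_reg0 : reg_seq_mod hS (1, 0) yS (cut hS zeroI) n.
Proof.
apply: (@reg_seq_modP _ _ _ HBS HPS (1, 0) _ _ _ zeroI_pr yS_hom) => j x jn /addid0 H; apply/addid0.
by apply: genid_lift_regular H => w; exact: yreg.
Qed.

Lemma yS_reg1 : reg_seq_mod hS (1, 0) yS (cut hS t1I) n.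
Proof.
apply: (@reg_seq_modP _ _ _ HBS HPS (1, 0) _ _ _ t1I_pr yS_hom) => j x jn /addid_t1 H; apply/addid_t1.
by apply: yreg => //; move: H; rewrite coefCM.
Qed.

Lemma zS'_reg : reg_seq_mod hS (0, 1) zS' (cut hS t1I) 2.
Proof.
apply: (@reg_seq_modP _ _ _ HBS HPS (0, 1) _ _ _ t1I_pr zS'_hom) => j x jn /addid_t1 H; apply/addid_t1.
by apply: zreg => //; move: H; rewrite coefCM.
Qed.

Lemma zS_reg : reg_seq_mod hS (0, 1) zS (cut hS zeroI) 3.
Proof.
apply: (@reg_seq_modP _ _ _ HBS HPS (0, 1) _ _ _ zeroI_pr zS_hom) => -[|j] x jn /addid0 H; apply/addid0.
  have x0 : x = 0; last by rewrite x0; exact: genid0.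
  case: H => q; rewrite big_ord0 /= => e; apply: mulX_inj; by rewrite e mulr0.
move: H => /genid_zS/addid_t1; rewrite coefCM => /(zreg jn) H.
by apply/genid_zS/addid_t1.
Qed.

Lemma yS_cover (s : int * int) x : 0 < s.1 -> hS s.1 s.2 x -> genid yS n x.
Proof. by move=> a0; apply: genid_lift_cover => b w; exact: ycover. Qed.

Lemma zS'_cover (s : int * int) x : 0 < s.2 -> hS s.1 s.2 x -> addid t1I zS' 2 x.
Proof. by move=> b0 Hx; apply/addid_t1; exact: (zcover b0 (hpoly_coef0 Hx)). Qed.

Lemma psi1_y : genid yS n psi1%:P.
Proof. by apply: (@yS_cover (d%:Z, 0)) => //=; exact: C_hom. Qed.
Lemma psi2_y : genid yS n psi2%:P.
Proof. by apply: (@yS_cover (d%:Z, 0)) => //=; exact: C_hom. Qed.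

Lemma g1_y : genid yS n g1.
Proof.
rewrite /g1 ['X * _]mulrC [_ * psi1%:P]mulrC -mulrN; apply: genidD; apply: genidM.
  exact: psi2_y.
exact: psi1_y.
Qed.

Lemma g1_z : genid zS 3 g1.
Proof.
apply/genid_zS/addid_t1; rewrite coef0_g1 -mulrN; by apply: (@genid_gen _ z 2 0).
Qed.

Variables (c e : nat).
Hypotheses (c0 : (0 < c)%N) (e0 : (0 < e)%N) (dc : (d <= 2 * c)%N).

Let A1 := Wg hS (fun _ => cut hS zeroI) (d%:Z, 1) g1.
Let W := Wg hS (fun _ => cut hS t1I) (d%:Z, 0) psi1%:P.
Let J2 := cut hS I2.

Lemma A1E s x : A1 s x <-> cut hS I1 s x.
Proof. exact: (@WgE _ _ _ HBS HPS zeroI (d%:Z, 1) g1 s x zeroI_pr g1_hom). Qed.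

Lemma WE s x : W s x <-> cut hS WI s x.
Proof. exact: (@WgE _ _ _ HBS HPS t1I (d%:Z, 0) psi1%:P s x t1I_pr (C_hom Hpsi1)). Qed.

Lemma A1_gid : gid hS A1.
Proof. exact: (@Wg_gid _ _ HBS (fun _ => cut hS zeroI) (fun _ => pr_cut_gid HBS zeroI_pr) (d%:Z, 1) g1 g1_hom). Qed.
Lemma W_gid : gid hS W.
Proof. exact: (@Wg_gid _ _ HBS (fun _ => cut hS t1I) (fun _ => pr_cut_gid HBS t1I_pr) (d%:Z, 0) _ (C_hom Hpsi1)). Qed.

(** [g1] lies both in (x), as d > 0, and in (t), so both colon ideals are the unit ideal. *)
Lemma A1_step k : all_good hS c e A1 A1 k -> res_good hS c e A1 k ->
  DGood hS c e A1 0 k.+1 (sl c e (unit_id hS) 0 0) (sl c e A1 0 0) -> all_good hS c e A1 A1 k.+1.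
Proof.
have Y0 := pr_cut_gid HBS zeroI_pr.
have EY gam w j s x : (forall j, hS gam.1 gam.2 (w j)) ->
    seqid hS gam w (cut hS zeroI) j s x <-> hS s.1 s.2 x /\ genid w j x.
  move=> Hw; apply: iff_trans (seqidE HBS HPS j s x zeroI_pr Hw) _.
  by split=> -[Hx /addid0].
move=> IH GK G0 a b.
refine (@hypersurface_step _ _ HBS c e c0 e0 _ _ (d%:Z, 1) _ _ _ _ _ A1_gid Y0 g1_hom (fun s x => id) yS_hom zS_hom yS_reg0 zS_reg
  _ _ _ _ _ _ _ _ IH GK G0 a b).
- by move=> s x Hx [_ /eqP]; rewrite mulf_eq0 (negPf g1n0) => /eqP x0; split.
- by move=> s x s0 Hx; apply/(EY (1, 0) _ _ _ _ yS_hom); split=> //; exact: (yS_cover s0 Hx).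
- move=> s x s0 Hx; apply/(EY (0, 1) _ _ _ _ zS_hom); split=> //.
  exact/genid_zS/(zS'_cover s0 Hx).
- left=> s x; split=> [[]//|Hx]; split=> //; apply/(EY (1, 0) _ _ _ _ yS_hom).
  split; first by have := homM HBS Hx g1_hom; rewrite mulrC.
  exact/genidM/g1_y.
- left=> s x; split=> [[]//|Hx]; split=> //; apply/(EY (0, 1) _ _ _ _ zS_hom).
  split; first by have := homM HBS Hx g1_hom; rewrite mulrC.
  exact/genidM/g1_z.
- by rewrite /=; lia.
- by rewrite /=; lia.
Qed.

(** f1 lies in (x), but it is regular modulo (t1, t2, t3): for the t's the colon ideal is (t1, t2,
    t3) itself, and the correction term vanishes. *)
Lemma W_step k : all_good hS c e J2 W k -> res_good hS c e J2 k ->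
  DGood hS c e J2 0 k.+1 (sl c e (unit_id hS) 0 0) (sl c e W 0 0) -> all_good hS c e J2 W k.+1.
Proof.
have Y0 := pr_cut_gid HBS t1I_pr.
have JW s x : J2 s x -> W s x by move=> [Hx Ix]; apply/WE; split=> //; exact: I2_W.
have HJ2 := pr_cut_gid HBS I2_pr.
have EY gam w j s x : (forall j, hS gam.1 gam.2 (w j)%:P) ->
    seqid hS gam (fun j => (w j)%:P) (cut hS t1I) j s x <-> hS s.1 s.2 x /\ genid w j x`_0.
  move=> Hw; apply: iff_trans (seqidE HBS HPS j s x t1I_pr Hw) _.
  by split=> -[Hx /addid_t1].
move=> IH GK G0 a b.
refine (@hypersurface_step _ _ HBS c e c0 e0 _ _ (d%:Z, 0) _ _ _ _ _ HJ2 Y0 (C_hom Hpsi1) JW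
  yS_hom zS'_hom yS_reg1 zS'_reg _ _ _ _ _ _ _ _ IH GK G0 a b).
- move=> s x Hx [_]; rewrite /t1I coefCM => /eqP; rewrite mulf_eq0 (negPf psi1n0) => /eqP x0.
  by split.
- move=> s x s0 Hx; apply/(EY (1, 0) _ _ _ _ yS_hom); split=> //.
  exact: (ycover s0 (hpoly_coef0 Hx)).
- move=> s x s0 Hx; apply/(EY (0, 1) _ _ _ _ zS'_hom); split=> //.
  exact: (zcover s0 (hpoly_coef0 Hx)).
- left=> s x; split=> [[]//|Hx]; split=> //; apply/(EY (1, 0) _ _ _ _ yS_hom).
  split; first by have := homM HBS Hx (C_hom Hpsi1); rewrite mulrC.
  by rewrite coefCM; apply: genidM; apply: (@ycover d%:Z 0).
- right=> s x [Hx /(EY (0, 1) _ _ _ _ zS'_hom)[_]]; rewrite coefCM => /psi1_z Gx.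
  by apply/(EY (0, 1) _ _ _ _ zS'_hom).
- by rewrite /=; lia.
- by rewrite /=; lia.
Qed.

Theorem level3_good k : res_good hS c e (cut hS kerI) k.
Proof.
have prH a b := gp_hom HPS a b.
have HJ2 := pr_cut_gid HBS I2_pr.
apply: (@Rees_diagonal_good _ _ HBS c e c0 e0 d A1 J2 _ W g2 g3 'X dc A1_gid HJ2 kerI_gid W_gid).
- by move=> s x /A1E[Hx /I1E[u ex]]; split=> //; apply/I2E; exists u, 0; rewrite mulr0 addr0.
- by move=> s x [Hx /I2_ker].
- by move=> s x [Hx Ix]; apply/WE; split=> //; exact: I2_W.
- move=> x [/= Hx]; rewrite /kerI.
  have ex : x = (x`_0)%:P by apply: size1_polyC; exact: (hpoly_size HB (b := 0) Hx).
  by rewrite ex ev3C => /(rho_inj (hpoly_coef0 Hx)) ->.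
- move=> x [w [v [[Hw Iw] Hv ->]]].
  have -> : v = 0.
    by apply: (hom_neg HBS _ Hv); rewrite /pdel /=; apply/orP; left; lia.
  rewrite scaler0 addr0; have ew : w = (w`_0)%:P by apply: size1_polyC; exact: (hpoly_size HB (b := 0) Hw).
  by rewrite ew Iw.
- exact: g2_hom.
- exact: g3_hom.
- exact: X_hom.
- move=> s x Hx; split; first by have := homM HBS Hx g2_hom; rewrite mulrC.
  by apply/I2E; exists 0, x; rewrite mulr0 add0r.
- move=> s x [Hx /I2E[u [v ex]]]; exists (prS (s.1 - d%:Z) (s.2 - 1) v) => //.
  apply/A1E; split.
    have Hg := homM HBS g2_hom (prH (s.1 - d%:Z) (s.2 - 1) v).
    by apply: (homB HBS) => //; move: Hg; apply: hom_cast; ring.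
  apply/I1E; exists (- prS (s.1 - d%:Z) (s.2 - 1) u).
  rewrite -[x in LHS](gp_id HPS Hx) ex mulrN (gpD HPS).
  rewrite -!(gpM HPS _ _ _ g2_hom) -!(gpM HPS _ _ _ g1_hom) [d%:Z + _]addrC [1 + _]addrC !subrK; ring.
- move=> s x Hx; split=> [/A1E[_ /I1E[u ex]]|/A1E[_ /I1E Dx]]; apply/A1E.
    split; first by have := homM HBS Hx g2_hom; rewrite mulrC.
    by apply/I1E; exists (g2 * u); rewrite ex mulrCA.
  split=> //; apply/I1E; move: Hx; rewrite /unit_id; case: s.2 => b Hx.
    exact: (g2_regular Hx Dx).
  exists 0; rewrite mulr0; apply: (hom_neg HBS _ Hx); apply/orP; by right.
- move=> s x Hx; split; first by have := homM HBS Hx g3_hom; rewrite mulrC.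
  by rewrite /kerI ev3M ev3_g3 mul0r.
- move=> s x [Hx Kx].
  have [u [v [w ex]]] : exists u v w, x = g1 * u + g2 * v + g3 * w.
    move: Hx; case: s.2 => b Hx; first exact: (kernel3 Hx Kx).
    exists 0, 0, 0; rewrite !mulr0 !addr0; apply: (hom_neg HBS _ Hx); apply/orP; by right.
  exists (prS (s.1 - d%:Z) (s.2 - 1) w) => //; split.
    have Hg := homM HBS g3_hom (prH (s.1 - d%:Z) (s.2 - 1) w).
    by apply: (homB HBS) => //; move: Hg; apply: hom_cast; ring.
  apply/I2E; exists (- prS (s.1 - d%:Z) (s.2 - 1) u), (- prS (s.1 - d%:Z) (s.2 - 1) v).
  rewrite -[x in LHS](gp_id HPS Hx) ex !mulrN !(gpD HPS).
  rewrite -!(gpM HPS _ _ _ g2_hom) -!(gpM HPS _ _ _ g1_hom) -!(gpM HPS _ _ _ g3_hom).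
  rewrite [d%:Z + _]addrC [1 + _]addrC !subrK; ring.
- move=> s x Hx; split=> [/WE[_ /g3_colon Ix]|[_ /g3_colon Ix]]; last by apply/WE.
  by split=> //; have := homM HBS Hx g3_hom; rewrite mulrC.
- move=> s x Hx; apply/WE; split; first by have := homM HBS Hx X_hom; rewrite mulrC.
  by apply/WI_coef0; rewrite coefXM; exists 0; rewrite mulr0.
(* In positive t-degree the coefficient [v] of f1 is a combination of the t's, and t2 f1, t3 f1 are
   multiples of t1 modulo g1 and g2. *)
- move=> s x s0 [w [v [[Hw /coef0_mulX[w' ew]] Hv ex]]].
  have Hx : hS s.1 s.2 x by apply: (gid_sub W_gid); exists w, v; split=> //; split=> //; apply/coef0_mulX; exists w'.
  have [|v1 [v2 [v3 ev]]] := split3 _ Hv; first by rewrite /pdel /=; lia.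
  pose u := prS (s.1 - 0) (s.2 - 1) (w' + psi1%:P * v1 + psi2%:P * v2 + psi3%:P * v3).
  exists u; first exact: prH.
  split.
    have Hg := homM HBS X_hom (prH (s.1 - 0) (s.2 - 1) (w' + psi1%:P * v1 + psi2%:P * v2 + psi3%:P * v3)).
    by apply: (homB HBS) => //; move: Hg; apply: hom_cast; ring.
  rewrite /u -(gpM HPS _ _ _ X_hom) -[x in X in I2 X](gp_id HPS Hx).
  have -> : 0 + (s.1 - 0) = s.1 by rewrite subr0 add0r.
  have -> : 1 + (s.2 - 1) = s.2 by rewrite addrC subrK.
  rewrite -(gpB _ _ _ _ HPS); apply: (pi_pr I2_pr); apply/I2E; exists v2, v3.
  rewrite ex ew ev (_ : psi1%:P *: (_ : S^o) = psi1%:P * ('X * v1 + (z 0%N)%:P * v2 + (z 1%N)%:P * v3)) //.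
  rewrite /g1 /g2; ring.
(* (g1, g2) : t1 is the full kernel: t1 g3 lies in (g1, g2), and conversely evaluation turns t1 into
   f1, which cancels. *)
- move=> s x Hx; split=> [[_ Kx]|[_ /I2_ker]].
    split; first by have := homM HBS Hx X_hom; rewrite mulrC.
    have [u [v [w ex]]] : exists u v w, x = g1 * u + g2 * v + g3 * w.
      move: Hx; rewrite /unit_id; case: s.2 => b Hx; first exact: (kernel3 Hx Kx).
      exists 0, 0, 0; rewrite !mulr0 !addr0; apply: (hom_neg HBS _ Hx); apply/orP; by right.
    apply/I2E; exists ('X * u - (z 1%N)%:P * w), ('X * v + (z 0%N)%:P * w).
    have -> : 'X * x = g1 * ('X * u) + g2 * ('X * v) + 'X * g3 * w by rewrite ex; ring.
    rewrite t1g3; ring.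
  rewrite /kerI ev3M ev3X => /eqP; rewrite mulf_eq0 (negPf f1n0) => /eqP Kx.
  by split.
- exact: A1_step.
- exact: W_step.
Qed.

End Level3.

(** * From S to the subalgebra of K[x_1, ..., x_n] *)

Section Subalgebra.
Variables (K : fieldType) (n : nat).
Local Notation P := {mpoly K[n]}.
Variable V : P -> Prop.

Lemma in_subalg0 : in_subalg V 0.
Proof. by exists [::]; rewrite big_nil. Qed.

Lemma in_subalgD p q : in_subalg V p -> in_subalg V q -> in_subalg V (p + q).
Proof.
move=> [s [Vs ->]] [r [Vr ->]]; exists (s ++ r); rewrite big_cat; split=> // x.
by rewrite mem_cat => /orP[/Vs|/Vr].
Qed.

Lemma in_subalg_sum I (r : seq I) (F : I -> P) :
  (forall i, in_subalg V (F i)) -> in_subalg V (\sum_(i <- r) F i).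
Proof. by move=> H; elim/big_ind: _ => //; [exact: in_subalg0 | exact: in_subalgD]. Qed.

Lemma in_subalg_mul v p : V v -> in_subalg V p -> in_subalg V (p * v).
Proof.
move=> Vv [s [Vs ->]]; exists [seq (x.1, v :: x.2) | x <- s]; split.
  move=> x /mapP[x' xs ->] w /=; rewrite inE => /orP[/eqP->|]; [exact: Vv | exact: Vs xs w].
rewrite big_map mulr_suml; apply: eq_bigr => x _.
by rewrite big_cons -scalerAl mulrC.
Qed.

Lemma in_subalgC k : in_subalg V k%:MP.
Proof.
exists [:: (k, [::])]; split=> [x|]; first by rewrite inE => /eqP->.
by rewrite big_seq1 big_nil /= -mul_mpolyC mulr1.
Qed.

End Subalgebra.

Section IdealPowers.
Variables (K : fieldType) (n k : nat) (f : 'I_k -> {mpoly K[n]}).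

Lemma in_ideal_pow0 e : in_ideal_pow f e 0.
Proof. by exists [::]; rewrite big_nil. Qed.

Lemma in_ideal_powD e p q : in_ideal_pow f e p -> in_ideal_pow f e q -> in_ideal_pow f e (p + q).
Proof.
move=> [s [Vs ->]] [r [Vr ->]]; exists (s ++ r); rewrite big_cat; split=> // x.
by rewrite mem_cat => /orP[/Vs|/Vr].
Qed.

Lemma in_ideal_pow_mul e i p : in_ideal_pow f e p -> in_ideal_pow f e.+1 (f i * p).
Proof.
move=> [s [Vs ->]]; exists [seq (x.1, i :: x.2) | x <- s]; split.
  by move=> x /mapP[x' xs ->] /=; rewrite (Vs _ xs).
rewrite big_map mulr_sumr; apply: eq_bigr => x _.
by rewrite big_cons mulrCA.
Qed.

End IdealPowers.

Lemma homD (S : comNzRingType) (hom : int -> int -> S -> Prop) a b x y :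
  bigraded hom -> hom a b x -> hom a b y -> hom a b (x + y).
Proof.
by move=> HB; exact: (gidD (unit_gid HB) (s := (a, b))).
Qed.

(** The Rees algebra of three elements [f i] of degree [d], as the image of a bigraded ring
    [S] over [P] generated by [t i] of degree [(0, 1)]; [ev] is the map [t i |-> f i], and
    the kernel of [S -> Rees] is spanned by the bihomogeneous elements killed by [ev]. *)
Record rees_cover (P : comNzRingType) (h : int -> int -> P -> Prop) (pi : int -> int -> P -> P)
    (f : 'I_3 -> P) (S : comNzRingType) (hom : int -> int -> S -> Prop)
    (pr : int -> int -> S -> S) (ev : {rmorphism S -> P}) (cst : P -> S) (t : 'I_3 -> S) :
    Prop := ReesCover {
  rc_bigraded : bigraded hom;
  rc_proj : graded_proj hom pr;
  rc_ev_t : forall i, ev (t i) = f i;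
  rc_ev_cst : forall p, ev (cst p) = p;
  rc_t_hom : forall i, hom 0 1 (t i);
  rc_cst_hom : forall a p, h a 0 p -> hom a 0 (cst p);
  rc_pr_cst : forall a p, pr a 0 (cst p) = cst (pi a 0 p);
  rc_split : forall (a b : int) x, 0 < b -> hom a b x ->
    exists2 q : 'I_3 -> S, forall i, hom a (b - 1) (q i) & x = \sum_i t i * q i;
  rc_deg0 : forall (a : int) x, hom a 0 x -> exists2 p, h a 0 p & x = cst p;
  rc_cst0 : cst 0 = 0 }.

(** * Transfer of the linear resolution along the evaluation map *)

Section Transfer.
Variables (K : fieldType) (n d : nat) (f : 'I_3 -> {mpoly K[n]}).
Local Notation P := {mpoly K[n]}.
Hypothesis Hf : forall i, is_form d (f i).
Variables (S : comNzRingType) (hom : int -> int -> S -> Prop) (pr : int -> int -> S -> S).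
Variables (ev : {rmorphism S -> P}) (cst : P -> S) (t : 'I_3 -> S).
Hypothesis cover : rees_cover (@hbase K n) (@prbase K n) f hom pr ev cst t.

Let HB := rc_bigraded cover.
Let HP := rc_proj cover.
Let ev_t := rc_ev_t cover.
Let ev_cst := rc_ev_cst cover.
Let t_hom := rc_t_hom cover.
Let cst_hom := rc_cst_hom cover.
Let pr_cst := rc_pr_cst cover.
Let t_split := rc_split cover.
Let deg0 := rc_deg0 cover.
Let cst0 := rc_cst0 cover.

Lemma ev_form (a : int) (b : nat) x : hom a b x ->
  hbase (a + b%:Z * d%:Z) 0 (ev x) /\ in_ideal_pow f b (ev x).
Proof.
elim: b x => [|b IH] x Hx.
  have [p Hp ->] := deg0 Hx; rewrite ev_cst mul0r addr0; split=> //.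
  by exists [:: (p, [::])]; split=> [y|]; [rewrite inE => /eqP-> | rewrite big_seq1 big_nil mulr1].
have [//|q Hq ->] := t_split _ Hx; rewrite rmorph_sum.
have {}Hq i : hbase (a + b%:Z * d%:Z) 0 (ev (q i)) /\ in_ideal_pow f b (ev (q i)).
  by apply: IH; have := Hq i; apply: hom_cast => //; lia.
split.
  elim/big_ind: _ => //; first exact: (hom0 (@hbase_bigraded K n)).
    by move=> u v Hu Hv; exact: homD (@hbase_bigraded K n) Hu Hv.
  move=> i _; rewrite rmorphM ev_t; have [H1 _] := Hq i.
  have Hfi : hbase d%:Z 0 (f i) := Hf i.
  have := homM (@hbase_bigraded K n) Hfi H1; apply: hom_cast => //; lia.
elim/big_ind: _ => [|u v|i _]; [exact: in_ideal_pow0 | exact: in_ideal_powD |].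
by rewrite rmorphM ev_t; apply: in_ideal_pow_mul; have [] := Hq i.
Qed.

Variables (c e : nat).
Hypotheses (c0 : (0 < c)%N) (e0 : (0 < e)%N) (d0 : (0 < d)%N).
Local Notation V := (pow_component f e (e * d + c)).
Local Notation homS := (homS hom c e).
Definition kerJ : int * int -> S^o -> Prop := cut hom (fun x => ev x = 0).
Local Notation JS := (JS c e kerJ).

Lemma homS_form s x : homS s x -> is_form ((e * d + c) * s)%N (ev x).
Proof.
rewrite /homS -!PoszM => /ev_form[Hx _].
suff : hbase ((e * d + c) * s)%N%:Z 0 (ev x) by [].
by move: Hx; apply: hom_cast => //; rewrite -PoszM -PoszD; congr Posz; ring.
Qed.

Lemma homS_V x : homS 1 x -> V (ev x).
Proof.
move=> Hx; split; first by have := homS_form Hx; rewrite muln1.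
by move: Hx; rewrite /homS !mulr1 => /ev_form[].
Qed.

(** Replacing the f's by t's lifts any representation of [p]. Projection onto bidegree (c, e) keeps
    the degree c parts of the coefficients, which still represent [p] because [p] is a form of
    degree ed + c. *)
Lemma V_homS p : V p -> exists2 x, homS 1 x & ev x = p.
Proof.
move=> [Fp [s [Vs ep]]].
pose T (l : seq 'I_3) : S := \prod_(i <- l) t i.
have T_hom l : hom 0 (size l)%:Z (T l).
  rewrite /T; elim: l => [|i l IH]; first by rewrite big_nil; exact: (hom1 HB).
  by rewrite big_cons; have := homM HB (t_hom i) IH; apply: hom_cast => //=; lia.
have F_hom l : hbase ((size l)%:Z * d%:Z) 0 (\prod_(i <- l) f i).
  elim: l => [|i l IH]; first by rewrite big_nil mul0r; exact: (hom1 (@hbase_bigraded K n)).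
  have Hfi : hbase d%:Z 0 (f i) := Hf i.
  rewrite big_cons; have := homM (@hbase_bigraded K n) Hfi IH; apply: hom_cast => //=; lia.
have prT l q : size l = e -> pr c%:Z e%:Z (T l * cst q) = T l * cst (prbase c%:Z 0 q).
  move=> sl; have := gpM HP c%:Z 0 (cst q) (T_hom l).
  by rewrite add0r addr0 sl pr_cst.
exists (pr c%:Z e%:Z (\sum_(x <- s) T x.2 * cst x.1)).
  by rewrite /homS !mulr1; exact: (gp_hom HP).
have Fp' : hbase (c%:Z + e%:Z * d%:Z) 0 p.
  suff : hbase (e * d + c)%N%:Z 0 p by apply: hom_cast => //; rewrite PoszD PoszM addrC.
  exact: Fp.
rewrite -[RHS](gp_id (@prbase_proj K n) Fp') ep (gp_sum _ _ _ _ (@prbase_proj K n)).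
rewrite (gp_sum _ _ _ _ HP) rmorph_sum !big_seq; apply: eq_bigr => x xs.
rewrite (prT _ _ (Vs _ xs)) rmorphM ev_cst rmorph_prod (eq_bigr f) // mulrC.
rewrite [RHS](_ : _ = prbase ((size x.2)%:Z * d%:Z + c%:Z) (0 + 0) (\prod_(i <- x.2) f i * x.1)).
  by rewrite (gpM (@prbase_proj K n) _ _ _ (F_hom x.2)) mulrC.
rewrite (Vs _ xs) addr0 [X in prbase X _ _]addrC; congr (prbase _ _ _); exact: mulrC.
Qed.

(* The summands are forms of pairwise distinct degrees. *)
Lemma homS_form_sum_eq0 o m (x : nat -> S) : (forall s, homS (s + o) (x s)) ->
  \sum_(s < m) ev (x s) = 0 -> forall s, (s < m)%N -> ev (x s) = 0.
Proof.
move=> Hx /(congr1 (pihomog (@mdeg n) ((e * d + c) * ((_ : nat) + o)))) H s sm.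
have := H s; rewrite pihomog0 raddf_sum (bigD1 (Ordinal sm)) //= big1 => [|i ne].
  by rewrite addr0 pihomog_dE //; exact: homS_form.
apply: pihomog_ne0 (homS_form (Hx i)).
by rewrite eqn_mul2l eqn_add2r negb_or -lt0n addn_gt0 c0 orbT.
Qed.

(** Sums of images of elements of the degrees [o], ..., [o + m - 1] of the diagonal. *)
Definition ev_sum o m b (v : 'rV[P]_b) := exists2 X : nat -> 'rV[S]_b,
  forall s, row_of (homS (s + o)) (X s) & v = \sum_(s < m) map_mx ev (X s).

Lemma ev_sum_le o m m' b (v : 'rV[P]_b) : (m <= m')%N -> ev_sum o m v -> ev_sum o m' v.
Proof.
move=> mm [X HX ->]; exists (fun s => if (s < m)%N then X s else 0).
  by move=> s; case: ifP => // _ j; rewrite mxE; exact: (hom0 HB).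
rewrite (big_ord_widen _ (fun s => map_mx ev (X s)) mm) big_mkcond /=.
by apply: eq_bigr => i _; case: ifP => //; rewrite map_mx0.
Qed.

Lemma ev_sum_vec m b (v : 'rV[P]_b) :
  (forall j, ev_sum 0 m (v 0 j)%:M) -> ev_sum 0 m v.
Proof.
move=> /fin_all_exists2[X HX eX]; exists (fun s => \row_j X j s 0 0).
  by move=> s j; rewrite mxE; exact: HX.
apply/rowP => j; have /matrixP/(_ 0 0) := eX j; rewrite !mxE eqxx mulr1n => ->.
by rewrite !summxE; apply: eq_bigr => s _; rewrite !mxE.
Qed.

Lemma ev_sum_terms o (s : seq (K * seq P)) :
  (forall x, x \in s -> (o <= size x.2)%N /\ forall v, v \in x.2 -> V v) ->
  exists m, ev_sum o m (\sum_(x <- s) x.1 *: \prod_(v <- x.2) v)%:M.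
Proof.
elim: s => [|x s IH] Hs.
  by exists 0%N; exists (fun=> 0); rewrite ?big_nil ?big_ord0 ?raddf0 // => i j; rewrite mxE; exact: (hom0 HB).
have [m Hm] : exists m, ev_sum o m (\sum_(x <- s) x.1 *: \prod_(v <- x.2) v)%:M.
  by apply: IH => y ys; apply: Hs; rewrite inE ys orbT.
have [ox Vx] := Hs x (mem_head _ _).
have [y Hy ey] : exists2 y, homS (size x.2) y & ev y = x.1 *: \prod_(v <- x.2) v.
  move: Vx; elim: x.2 => [|v l IHl] Vl.
    exists (cst (x.1 *: 1)); last by rewrite ev_cst big_nil.
    by rewrite /homS !mulr0; apply: cst_hom; apply: dhomogZ; exact: dhomog1.
  have [|y Hy ey] := IHl; first by move=> w wl; apply: Vl; rewrite inE wl orbT.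
  have [z Hz ez] := V_homS (Vl v (mem_head _ _)).
  exists (z * y); last by rewrite rmorphM ey ez big_cons scalerAr.
  have := homM HB Hz Hy; apply: hom_cast => //=; lia.
(* Index [s'] stands for degree [s' + o], so a product of [size x.2] generators belongs at
   [size x.2 - o]. *)
pose X s' : 'rV[S]_1 := (if s' == (size x.2 - o)%N then y else 0)%:M.
have HX s' : row_of (homS (s' + o)) (X s').
  move=> j; rewrite mxE ord1 eqxx mulr1n; case: eqP => [->|_]; last exact: (hom0 HB).
  by rewrite subnK.
exists (maxn m (size x.2).+1); have [Z HZ eZ] := ev_sum_le (leq_maxl m (size x.2).+1) Hm.
exists (fun s' => X s' + Z s').
  by move=> s' j; rewrite mxE; apply: homD; [exact: HB | exact: HX | exact: HZ].
rewrite big_cons raddfD /= eZ; under [RHS]eq_bigr do rewrite map_mxD.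
rewrite big_split; congr (_ + _) => /=.
have sm : (size x.2 - o < maxn m (size x.2).+1)%N by rewrite leq_max ltnS leq_subr orbT.
rewrite (bigD1 (Ordinal sm)) //= [X in _ + X]big1 => [|i ne].
  by rewrite addr0 /X eqxx map_scalar_mx /= ey.
by rewrite /X (_ : _ == _ = false) ?raddf0 ?map_mx0 //; apply/negbTE.
Qed.

Lemma in_subalg_ev_sum p : in_subalg V p -> exists m, ev_sum 0 m p%:M.
Proof. by move=> [s [Vs ->]]; apply: ev_sum_terms => x xs; split=> //; exact: Vs. Qed.

Lemma in_irrelevant_ev_sum p : in_irrelevant V p -> exists m, ev_sum 1 m p%:M.
Proof. by move=> [s [Vs ->]]; exact: ev_sum_terms. Qed.

Lemma row_in_ev_sum b (v : 'rV[P]_b) : row_in V v -> exists m, ev_sum 0 m v.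
Proof.
move=> Vv; have /fin_all_exists[m Hm] j := in_subalg_ev_sum (Vv j).
exists (\max_j m j); apply: ev_sum_vec => j; exact: ev_sum_le (leq_bigmax j) (Hm j).
Qed.

Lemma row_in_sum b m (F : nat -> 'rV[P]_b) :
  (forall s, row_in V (F s)) -> row_in V (\sum_(s < m) F s).
Proof. by move=> HF j; rewrite summxE; apply: in_subalg_sum => i; exact: HF. Qed.

(** That the diagonal is generated in degree 1 is read off the resolution: exactness at the ring
    writes elements of positive degree through the entries of [d1]. *)
Lemma homS_in_subalg b (d1 : 'M[S]_(b, 1)) : (forall j k, homS 1 (d1 j k)) ->
  (forall s x, homS s.+1 x -> exists2 w, row_of (homS s) w & JS s.+1 (x - (w *m d1) 0 0)) ->
  forall s x, homS s x -> in_subalg V (ev x).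
Proof.
move=> Hd1 Hgen; elim=> [|s IH] x Hx.
  move: Hx; rewrite /homS !mulr0 => /deg0[p Hp ->]; rewrite ev_cst.
  rewrite (_ : p = (p@_0%MM)%:MP); first exact: in_subalgC.
  apply/mpolyP => m; rewrite mcoeffC; case: eqP => [<-|m0]; first by rewrite mulr1.
  rewrite mulr0 (dhomog_nemf_coeff Hp) // mdeg_eq0; exact/eqP.
have [w Hw [_]] := Hgen _ _ Hx; rewrite rmorphB => /eqP; rewrite subr_eq0 => /eqP ->.
rewrite mxE rmorph_sum; apply: in_subalg_sum => j; rewrite rmorphM; apply: in_subalg_mul.
  exact: homS_V (Hd1 _ _).
exact: IH (Hw j).
Qed.

Lemma row_of_mulmx s b b' (v : 'rV[S]_b) (A : 'M[S]_(b, b')) :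
  (forall j k, homS 1 (A j k)) -> row_of (homS s) v -> row_of (homS s.+1) (v *m A).
Proof.
move=> HA Hv k; rewrite mxE; elim/big_ind: _ => [|y z|i _]; first exact: (hom0 HB).
  exact: homD.
by have := homM HB (Hv i) (HA i k); apply: hom_cast => //; lia.
Qed.

(** The row is split into components of the diagonal grading. Its image vanishes in each one, since
    evaluated components are forms of distinct degrees; injectivity handles degree 0 and exactness
    the others. *)
Lemma map_row_exact b0 b1 b2 (A : 'M[S]_(b1, b0)) (B : 'M[S]_(b2, b1)) :
  (forall s x, homS s x -> in_subalg V (ev x)) -> (forall j k, homS 1 (A j k)) ->
  (forall v, row_of (homS 0) v -> row_of (JS 1) (v *m A) -> v = 0) ->
  (forall s v, row_of (homS s.+1) v -> row_of (JS s.+2) (v *m A) ->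
    exists2 w, row_of (homS s) w & row_of (JS s.+1) (v - w *m B)) ->
  forall v, row_in V v -> v *m map_mx ev A = 0 ->
    exists w, row_in V w /\ v = w *m map_mx ev B.
Proof.
move=> HV HA inj ex v /row_in_ev_sum[m [X HX ->]]; rewrite mulmx_suml => eq0.
have HX0 s : row_of (homS s) (X s) by have := HX s; rewrite addn0.
have XA s : (s < m)%N -> row_of (JS s.+1) (X s *m A).
  move=> sm k; split; first exact: row_of_mulmx (HX0 s) k.
  apply: (@homS_form_sum_eq0 1 m (fun s => (X s *m A) 0 k)) sm => [s'|].
    by rewrite addn1; exact: row_of_mulmx (HX0 s') k.
  have /rowP/(_ k) := eq0; rewrite summxE mxE => E0; rewrite -[RHS]E0.
  by apply: eq_bigr => i _; rewrite -map_mxM [in RHS]mxE.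
have /choice[W HW] s : exists w : 'rV[P]_b2, row_in V w /\
    ((s < m)%N -> map_mx ev (X s) = w *m map_mx ev B).
  have [sm|_] := boolP (s < m)%N; last by exists 0; split=> // j; rewrite mxE; exact: in_subalg0.
  case: s sm (HX0 s) (XA s sm) => [|s] sm Xs XAs.
    exists 0; rewrite (inj _ Xs XAs) map_mx0 mul0mx; split=> // j.
    by rewrite mxE; exact: in_subalg0.
  have [w Hw Jw] := ex _ _ Xs XAs; exists (map_mx ev w); split.
    by move=> j; rewrite mxE; exact: HV (Hw j).
  move=> _; rewrite -map_mxM; apply/rowP => j; have [_] := Jw j.
  by rewrite !mxE rmorphB => /eqP; rewrite subr_eq0 => /eqP.
exists (\sum_(s < m) W s); split; first by apply: row_in_sum => s; have [] := HW s.
by rewrite mulmx_suml; apply: eq_bigr => s _; have [_ ->] := HW s.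
Qed.

Theorem Koszul_of_res_good : (forall k, res_good hom c e kerJ k) -> Koszul V.
Proof.
have kerJ_gid : gid hom kerJ.
  apply: cut_gid => //; first exact: rmorph0.
    by move=> x y Hx Hy; rewrite rmorphB Hx Hy subrr.
  by move=> x y Hx; rewrite rmorphM Hx mulr0.
have J00 x : kerJ (0, 0) x -> x = 0.
  by move=> [/deg0[p _ ->]]; rewrite ev_cst => ->.
move=> /(linear_resolution HB c0 kerJ_gid J00).
move=> [b [d1 [M [[Hd1 HM] [Jd1 JM] gen [inj0 ex0] [inj ex]]]]].
have HV := homS_in_subalg Hd1 gen.
exists b, (map_mx ev d1), (fun i => map_mx ev (M i)).
split; first by move=> j k; rewrite mxE; exact: homS_V.
split; first by move=> i j k; rewrite mxE; exact: homS_V.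
split; first by rewrite -map_mxM; apply/matrixP => j k; have [_] := Jd1 j k; rewrite !mxE.
split; first by move=> i; rewrite -map_mxM; apply/matrixP => j k; have [_] := JM i j k; rewrite !mxE.
split.
  move=> p /in_irrelevant_ev_sum[m [X HX /matrixP/(_ 0 0)]]; rewrite mxE eqxx mulr1n => ->.
  have /choice[W HW] s : exists w, row_in V w /\ ev (X s 0 0) = (w *m map_mx ev d1) 0 0.
    have := HX s 0; rewrite addn1 => /gen[w Hw [_]].
    rewrite rmorphB => /eqP; rewrite subr_eq0 => /eqP ->; exists (map_mx ev w).
    by split=> [j|]; [rewrite mxE; exact: HV (Hw j) | rewrite -map_mxM [RHS]mxE].
  exists (\sum_(s < m) W s); split; first by apply: row_in_sum => s; have [] := HW s.
  rewrite mulmx_suml !summxE; apply: eq_bigr => s _; have [_ <-] := HW s.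
  by rewrite mxE.
split.
  apply: (map_row_exact HV Hd1) => [v Hv Jv|s v Hv Jv]; first exact: inj0 Hv (Jv 0).
  exact: ex0 Hv (Jv 0).
by move=> i; apply: (map_row_exact HV (HM i)) => *; [exact: (inj i) | exact: (ex i)].
Qed.

End Transfer.

(** * The polynomial ring P[t3][t2][t1] *)

Section Tower.
Variables (P : idomainType) (hb : int -> int -> P -> Prop) (prb : int -> int -> P -> P).
Hypotheses (HB : bigraded hb) (HP : graded_proj hb prb).
Hypothesis hpos : forall (a b : int) p, 0 < b -> hb a b p -> p = 0.
Variables (x : nat -> P) (n : nat) (f : 'I_3 -> P) (d : nat).
Local Notation f1 := (f 0).
Local Notation f2 := (f 1).
Local Notation f3 := (f (inord 2)).
Hypothesis Hf : forall i, hb d%:Z 0 (f i).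
Hypothesis Hx : forall j, hb 1 0 (x j).
Hypothesis xreg : forall j p, (j < n)%N -> genid x j (x j * p) -> genid x j p.
Hypothesis xcover : forall (a b : int) p, 0 < a -> hb a b p -> genid x n p.
Hypothesis f1n0 : f1 != 0.
Hypothesis f2_div : forall p, divs f1 (f2 * p) -> divs f1 p.
Hypothesis reg3 : forall p u v, f3 * p = f1 * u + f2 * v -> exists u' v', p = f1 * u' + f2 * v'.
Hypothesis d0 : (0 < d)%N.

Local Notation Q := {poly P}.
Local Notation R := {poly {poly P}}.
Let h1 : int -> int -> Q -> Prop := hpoly hb.
Let h2 : int -> int -> R -> Prop := hpoly h1.
Let HB1 : bigraded h1 := hpoly_bigraded HB.
Let HB2 : bigraded h2 := hpoly_bigraded HB1.
Let HP1 : graded_proj h1 (prpoly prb) := prpoly_proj HP.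
Let HP2 : graded_proj h2 (prpoly (prpoly prb)) := prpoly_proj HP1.

Let tau : Q := 'X.
Let z (j : nat) : R := nth tau%:P [:: 'X] j.
Definition eval2 : {rmorphism R -> P} := horner_eval f2 \o map_poly (horner_eval f3).

Lemma genid_z1 p : genid z 1 p <-> exists q, p = 'X * q.
Proof. by split=> [[q ->]|[q ->]]; [exists (q 0%N) | exists (fun=> q)]; rewrite big_ord1. Qed.

Lemma genid_z2 p : genid z 2 p <-> p`_0`_0 = 0.
Proof.
split=> [[q ->]|p0].
  by rewrite !big_ord_recr big_ord0 /z /= add0r coefD coefXM add0r coefCM coefXM.
have [y [ep _]] := poly_split p; have /coef0_mulX[w ew] := p0.
exists (fun j => nth w%:P [:: y] j).
by rewrite !big_ord_recr big_ord0 /z /= add0r {1}ep ew polyCM addrC.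
Qed.

Lemma h2_deg0 (a : int) p : h2 a 0 p -> p = (p`_0`_0)%:P%:P.
Proof.
move=> Hp; have e1 := size1_polyC (hpoly_size HB1 (b := 0) Hp).
by rewrite {1}e1 {1}(size1_polyC (hpoly_size HB (b := 0) (hpoly_coef0 Hp))).
Qed.

Lemma eval2C p : eval2 p%:P%:P = p.
Proof. by rewrite /eval2 /= map_polyC /horner_eval /= hornerC; exact: hornerC. Qed.

Lemma eval2X : eval2 'X = f2.
Proof. by rewrite /eval2 /= map_polyX /horner_eval hornerX. Qed.

Lemma eval2XC : eval2 'X%:P = f3.
Proof. by rewrite /eval2 /= map_polyC /horner_eval /= hornerC; exact: hornerX. Qed.

Lemma eval2_kernel (a : int) (b : nat) (p : R) : h2 a b p -> divs f1 (eval2 p) ->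
  exists q k, p = (z 0 * f3%:P%:P - z 1 * f2%:P%:P) * q + f1%:P%:P * k.
Proof.
have hC g : hb d%:Z 0 g -> h1 d%:Z 0 g%:P := @hpolyC _ _ HB _ _ g.
apply: (level2_kernel HB1 HP1 (hC _ (Hf _)) (hC _ (Hf _)) (hC _ (Hf _)) (hpolyX HB)
  (rho := horner_eval f3) (hornerC _ _) (hornerC _ _) (hornerC _ _) (hornerX _) f2_div).
- by move=> a' b' q; exact: (level1_split hpos).
- by move=> a' b' q u v; exact: (level1_kernel HB hpos reg3).
- move=> a' q Hq; rewrite (level1_deg0 HB Hq) => -[w ew]; exists w%:P.
  by rewrite -polyCM -ew; congr polyC; rewrite [RHS]hornerC.
Qed.

Theorem tower_good c e : (0 < c)%N -> (0 < e)%N -> (d <= 2 * c)%N ->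
  forall k, res_good (hpoly h2) c e (cut (hpoly h2) (kerI eval2 f1)) k.
Proof.
have hC a b g : hb a b g -> h2 a b g%:P%:P.
  by move=> Hg; apply: (hpolyC HB1); exact: (hpolyC HB).
apply: (level3_good HB2 HP2 d0 (hC _ _ _ (Hf _)) (hC _ _ _ (Hf _)) (hC _ _ _ (Hf _))
  (y := fun j => (x j)%:P%:P) (z := z) (n := n) _ _ (eval2C _) (eval2C _) (eval2C _) eval2X eval2XC) => //.
- by move=> j; exact: hC.
- move=> [|j]; first exact: (hpolyX HB1).
  by rewrite /z nth_default //; apply: (hpolyC HB1); exact: (hpolyX HB).
- exact: monic_neq0 (monicX _).
- by move=> j p jn; do 2!apply: genid_lift_regular => {}p; exact: xreg.
- case=> [|[|//]] p _; last first.
    move=> /genid_z1[u eu]; apply/genid_z1; apply: (@level2_regular _ tau) eu.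
    by move=> q eq; apply: mulX_inj; rewrite mulr0.
  by move=> [q]; rewrite big_ord0 -(mulr0 'X) => /mulX_inj ->; exact: genid0.
- move=> a b p a0; do 2!apply: (genid_lift_cover (a := a)) => {}b {}p; exact: xcover.
- move=> a b p b0 Hp; have [p1 [p2 [_ _ ->]]] := level2_split HB1 (level1_split hpos) b0 Hp.
  by apply/genid_z2; rewrite coefD coefXM coefCM add0r coefXM.
- move=> p /genid_z2; rewrite !coefCM => /eqP; rewrite mulf_eq0 (negPf f1n0) => /eqP p0.
  by apply/genid_z2.
- move=> p; apply: minor3_div => q; first exact: divs_mulX.
  exact: divs_lift.
- exact: eval2_kernel.
- by move=> a p /h2_deg0 ->; rewrite eval2C => ->.
Qed.

Lemma tower_split (a b : int) (p : {poly R}) : 0 < b -> hpoly h2 a b p ->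
  exists p1 p2 p3, [/\ hpoly h2 a (b - 1) p1, hpoly h2 a (b - 1) p2, hpoly h2 a (b - 1) p3 &
    p = 'X * p1 + 'X%:P * p2 + 'X%:P%:P * p3].
Proof.
move=> b0 Hp; have [y [ep ey]] := poly_split p.
have [p2 [p3 [H2 H3 e0]]] := level2_split HB1 (level1_split hpos) b0 (hpoly_coef0 Hp).
exists y, p2%:P, p3%:P; split; [exact: hpoly_tail Hp ey | exact: (hpolyC HB2) | exact: (hpolyC HB2) |].
by rewrite {1}ep e0 polyCD !polyCM addrC addrA.
Qed.

Lemma tower_deg0 (a : int) (p : {poly R}) : hpoly h2 a 0 p ->
  exists2 q, hb a 0 q & p = q%:P%:P%:P.
Proof.
move=> Hp; exists p`_0`_0`_0; first by do 2!apply: hpoly_coef0; exact: hpoly_coef0.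
by rewrite -(h2_deg0 (hpoly_coef0 Hp)) -(size1_polyC (hpoly_size HB2 (b := 0) Hp)).
Qed.

Definition eval3 : {rmorphism {poly R} -> P} := horner_eval f1 \o map_poly eval2.

Lemma eval3C p : eval3 p%:P = eval2 p.
Proof. by rewrite /eval3 /= map_polyC; exact: hornerC. Qed.

Lemma eval3X : eval3 'X = f1.
Proof. by rewrite /eval3 /= map_polyX; exact: hornerX. Qed.

Definition tvar (i : 'I_3) : {poly R} := nth 'X%:P%:P [:: 'X; 'X%:P] i.

Lemma tower_cover : rees_cover hb prb f (hpoly h2) (prpoly (prpoly (prpoly prb)))
  eval3 (fun p => p%:P%:P%:P) tvar.
Proof.
have ord3 (i : 'I_3) : [\/ i = 0, i = 1 | i = inord 2].
  case: i => [[|[|[|//]]] lt]; [apply: Or31 | apply: Or32 | apply: Or33]; apply: val_inj => //=.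
  by rewrite inordK.
have t2 : tvar (inord 2) = 'X%:P%:P by rewrite /tvar inordK.
split.
- exact: hpoly_bigraded.
- exact: prpoly_proj.
- move=> i; case: (ord3 i) => ->; first exact: eval3X.
    by rewrite [tvar 1]/= eval3C eval2X.
  by rewrite t2 eval3C eval2XC.
- by move=> p; rewrite eval3C eval2C.
- move=> i; case: (ord3 i) => ->; first exact: (hpolyX HB2).
    by apply: (hpolyC HB2); exact: (hpolyX HB1).
  by rewrite t2; apply: (hpolyC HB2); apply: (hpolyC HB1); exact: (hpolyX HB).
- by move=> a p Hp; apply: (hpolyC HB2); apply: (hpolyC HB1); exact: (hpolyC HB).
- by move=> a p; rewrite (prpolyC HP2) (prpolyC HP1) (prpolyC HP).
- move=> a b p b0 /(tower_split b0)[p1 [p2 [p3 [H1 H2 H3 ->]]]].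
  exists (fun i : 'I_3 => nth p3 [:: p1; p2] i); last by rewrite !big_ord_recr big_ord0 /= add0r.
  by case=> [[|[|[|//]]] lt].
- exact: tower_deg0.
- by rewrite polyC0.
Qed.

Theorem Rees_presentation : exists (S : comNzRingType) hom pr (ev : {rmorphism S -> P}) cst t,
  rees_cover hb prb f hom pr ev cst t /\
  forall c e, (0 < c)%N -> (0 < e)%N -> (d <= 2 * c)%N ->
    forall k, res_good hom c e (cut hom (fun p => ev p = 0)) k.
Proof.
exists {poly R}, (hpoly h2), (prpoly (prpoly (prpoly prb))), eval3, (fun p => p%:P%:P%:P), tvar.
by split; [exact: tower_cover | exact: tower_good].
Qed.

End Tower.

(** * Consequences of the regularity of f1, f2, f3 *)

Section RegularSequences.
Variables (K : fieldType) (n d : nat) (f : 'I_3 -> {mpoly K[n]}).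
Hypotheses (Hf : forall i, is_form d (f i)) (reg : regular_seq f).
Local Notation f1 := (f 0).
Local Notation f2 := (f 1).
Local Notation f3 := (f (inord 2)).

Lemma regular_seq_neq0 : f1 != 0.
Proof.
apply/eqP => f0; have [/(_ 0 1) R0 _] := reg.
case: R0 => [|g /eqP]; last by rewrite big_ord0 oner_eq0.
by exists (fun=> 0); rewrite big_ord0 f0 mulr0.
Qed.

Lemma regular_seq_div p : divs f1 (f2 * p) -> divs f1 p.
Proof.
have E (i : 'I_1) : f (widen_ord (ltnW (ltn_ord (1 : 'I_3))) i) = f1.
  by congr f; apply: val_inj; rewrite /= ord1.
have [/(_ 1 p) R1 _] := reg.
move=> [w e]; case: R1 => [|g ->].
  by exists (fun=> w); rewrite big_ord1 E mulrC e mulrC.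
by exists (g 0); rewrite big_ord1 E mulrC.
Qed.

Lemma regular_seq_div2 p u v : f3 * p = f1 * u + f2 * v -> exists u' v', p = f1 * u' + f2 * v'.
Proof.
have i2 : inord 2 = @Ordinal 3 2 isT by apply: val_inj; rewrite /= inordK.
rewrite i2; have [/(_ (@Ordinal 3 2 isT) p) R2 _] := reg => e.
have E (g : 'I_2 -> {mpoly K[n]}) :
    \sum_(i < 2) g i * f (widen_ord (ltnW (ltn_ord (@Ordinal 3 2 isT))) i) = f1 * g 0 + f2 * g 1.
  rewrite big_ord_recl big_ord1 ![g _ * _]mulrC.
  by congr (f _ * g _ + f _ * g _); apply: val_inj.
case: R2 => [|g ->]; first by exists (fun i => if i == 0 then u else v); rewrite E mulrC.
by exists (g 0), (g 1); exact: E.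
Qed.

(** In degree 0 the nonzero form f1 would be a unit, against the properness of the ideal. With d <=
    2c this also yields c > 0, which the diagonal requires. *)
Lemma regular_seq_deg_gt0 : (0 < d)%N.
Proof.
rewrite lt0n; apply/eqP => d0; have [_ []] := reg.
have C : f1 = (f1@_0%MM)%:MP.
  apply/mpolyP => m; rewrite mcoeffC; case: eqP => [<-|m0]; first by rewrite mulr1.
  by rewrite mulr0 (dhomog_nemf_coeff (Hf 0)) // d0 mdeg_eq0; exact/eqP.
have nz : f1@_0%MM != 0.
  by apply: contraNneq regular_seq_neq0 => e; rewrite C e mpolyC0.
exists (fun i => if i == 0 then (f1@_0%MM)^-1%:MP else 0).
rewrite (bigD1 0) //= big1 => [|i /negPf ->]; last by rewrite mul0r.
by rewrite addr0 {2}C -mpolyCM mulVf // mpolyC1.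
Qed.

End RegularSequences.

Lemma hbase_pos (K : fieldType) (n : nat) (a b : int) (p : {mpoly K[n]}) : 0 < b -> hbase a b p -> p = 0.
Proof. by case: a b => [a|a] [[|b]|b]. Qed.

Lemma hbase_xvar (K : fieldType) (n : nat) (a b : int) (p : {mpoly K[n]}) :
  0 < a -> hbase a b p -> genid (xvar K n) n p.
Proof.
by case: a b => [[|a]|a] [[|b]|b] // _ Hp; [exact: (form_xvar Hp) | rewrite [p]Hp; exact: genid0..].
Qed.

Theorem theorem3p1 (K : fieldType) (n d : nat) (f : 'I_3 -> {mpoly K[n]}) :
  (forall i, is_form d (f i)) -> regular_seq f ->
  forall c e : nat, (d <= 2 * c)%N -> (0 < e)%N ->
    Koszul (pow_component f e (e * d + c)).
Proof.
move=> Hf reg c e dc e0.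
have d0 := regular_seq_deg_gt0 Hf reg.
have c0 : (0 < c)%N by rewrite lt0n; apply/eqP => z; move: dc d0; rewrite z muln0 leqn0 => /eqP ->.
have [S [hom [pr [ev [cst [t [cover good]]]]]]] := Rees_presentation (@hbase_bigraded K n)
  (@prbase_proj K n) (@hbase_pos K n) (Hf : forall i, hbase d 0 (f i)) (xvar_form K n : forall j, hbase 1 0 (xvar K n j))
  (@xvar_regular K n) (@hbase_xvar K n) (regular_seq_neq0 reg) (@regular_seq_div _ _ _ reg)
  (@regular_seq_div2 _ _ _ reg) d0.
apply: (Koszul_of_res_good Hf cover c0 e0 d0).
exact: good.
Qed.
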